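(* Let $D\subset\mathbb{C}^n$ be a bounded $\mathcal{C}^1$-smooth domain. If $\ell_D$ satisfies a quasi triangle inequality or $\kappa_D$ satisfies a quasi triangle inequality, then $D$ is pseudoconvex.
   Context: $\mathbb{D}$ is the open unit disc in $\mathbb{C}$ and $\mathcal{O}(\mathbb{D},D)$ is the set of holomorphic maps $\mathbb{D}\to D$. For $z,w\in D$ and $X\in\mathbb{C}^n$: the Lempert function is $\ell_D(z,w):=\inf\{|\alpha|:\alpha\in\mathbb{D},\ \exists\varphi\in\mathcal{O}(\mathbb{D},D)\text{ with }\varphi(0)=z,\ \varphi(\alpha)=w\}$, and the Kobayashi-Royden metric is $\kappa_D(z;X):=\inf\{|\alpha|:\alpha\in\mathbb{C},\ \exists\varphi\in\mathcal{O}(\mathbb{D},D),\ \varphi(0)=z,\ \alpha\varphi'(0)=X\}$. The function $\ell_D$ satisfies a quasi triangle inequality if there is $C\ge1$ such that $\ell_D(x,z)\le C(\ell_D(x,y)+\ell_D(y,z))$ for all $x,y,z\in D$. The pseudometric $\kappa_D$ satisfies a quasi triangle inequality if there is $C>0$ such that $\kappa_D(z;X+Y)\le C(\kappa_D(z;X)+\kappa_D(z;Y))$ for all $z\in D$ and $X,Y\in\mathbb{C}^n$. *)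

(* Defs.v *)
From HB Require Import structures.
From mathcomp Require Import all_boot all_order all_algebra.
From mathcomp Require Import complex.
From mathcomp Require Import all_classical all_reals all_analysis.

Set Implicit Arguments.
Unset Strict Implicit.
Unset Printing Implicit Defensive.

Import Order.TTheory GRing.Theory Num.Theory.
Import numFieldNormedType.Exports.

Local Open Scope classical_set_scope.
Local Open Scope ring_scope.
Local Open Scope complex_scope.

(* The normed module structure of R[i] over itself, transferred from R[i]^o. *)
HB.instance Definition _ (R : rcfType) :=
  PseudoPointedMetric.copy R[i] R[i]^o.
HB.instance Definition _ (R : rcfType) := GRing.ComAlgebra.copy R[i] R[i]^o.
HB.instance Definition _ (R : rcfType) := Vector.copy R[i] R[i]^o.
HB.instance Definition _ (R : rcfType) := NormedModule.copy R[i] R[i]^o.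

(* The space C^n is 'rV[R[i]]_n. The norms of R[i] and 'rV[R[i]]_n take their
   values in R[i]; the real modulus of a : R[i] is Re `|a|. *)

Section Disc.
Context {R : realType}.

Definition unit_disc : set R[i] := [set z | `|z| < 1].

(* Only the values of f on the unit disc are constrained. *)
Definition holo_disc n (D : set 'rV[R[i]]_n) (f : R[i] -> 'rV[R[i]]_n) :=
  forall z, unit_disc z -> derivable f z 1 /\ D (f z).

End Disc.

Section Domain.
Context {R : realType} {n : nat}.
Implicit Types (D U : set 'rV[R[i]]_n) (rho : 'rV[R[i]]_n -> R).

Definition domain D := [/\ open D, connected D & D !=set0].

(* The directions of the real coordinates x_j, y_j, where z_j = x_j + i y_j. *)
Definition real_basis : set 'rV[R[i]]_n :=
  range (fun j : 'I_n => delta_mx 0 j) `|`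
  range (fun j : 'I_n => 'i%C *: delta_mx 0 j).

Definition real_slice rho (z v : 'rV[R[i]]_n) : R -> R :=
  fun t => rho (z + t%:C *: v).

Definition partial v rho : 'rV[R[i]]_n -> R :=
  fun z => (real_slice rho z v)^`()%classic 0.

Definition C1_on U rho :=
  forall v, real_basis v -> forall z, U z ->
    derivable (real_slice rho z v) 0 1 /\ {for z, continuous (partial v rho)}.

Definition C1_boundary D :=
  forall p, (closure D `\` interior D) p ->
    exists (U : set 'rV[R[i]]_n) rho,
      [/\ open U /\ U p,
          C1_on U rho,
          forall z, U z -> exists2 v, real_basis v & partial v rho z != 0
        & D `&` U = [set z | U z /\ rho z < 0]].

End Domain.

Section Invariants.
Context {R : realType} {n : nat}.
Local Open Scope ereal_scope.
Implicit Types (D : set 'rV[R[i]]_n).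

(* The infima are taken in \bar R, so that the infimum of the empty set is
   +oo. *)
Definition lempert D (z w : 'rV[R[i]]_n) : \bar R :=
  ereal_inf [set (complex.Re `|a|)%:E | a in
    [set a : R[i] | unit_disc a /\
      exists f, [/\ holo_disc D f, f 0%R = z & f a = w]]].

Definition kobayashi D (z X : 'rV[R[i]]_n) : \bar R :=
  ereal_inf [set (complex.Re `|a|)%:E | a in
    [set a : R[i] |
      exists f, [/\ holo_disc D f, f 0%R = z & (a *: f^`()%classic 0 = X)%R]]].

Definition lempert_quasi_triangle D :=
  exists2 C : R, (1 <= C)%R &
    forall x y z, D x -> D y -> D z ->
      lempert D x z <= C%:E * (lempert D x y + lempert D y z).

Definition kobayashi_quasi_triangle D :=
  exists2 C : R, (0 < C)%R &
    forall z X Y, D z ->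
      kobayashi D z (X + Y)%R <= C%:E * (kobayashi D z X + kobayashi D z Y).

End Invariants.

Section Pseudoconvex.
Context {R : realType}.
Local Open Scope ereal_scope.

Definition circle_point (a : R[i]) (r t : R) : R[i] :=
  (a + r%:C * (cos t +i* sin t))%R.

Definition usc_on (T : topologicalType) (U : set T) (u : T -> \bar R) :=
  forall z, U z -> forall c, u z < c -> \forall w \near z, u w < c.

(* U is meant to be open. The values are in [-oo, +oo[, and the function that
   is identically -oo is allowed. Upper semicontinuity bounds u from above on
   the circle, so that the integral is well defined, possibly -oo. *)
Definition subharmonic (U : set R[i]) (u : R[i] -> \bar R) :=
  [/\ forall z, U z -> u z < +oo,
      usc_on U u
    & forall (a : R[i]) (r : R), (0 < r)%R ->
        [set z | (`|z - a| <= r%:C)%R] `<=` U ->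
        u a <= ((2 * pi)^-1)%:E *
          \int[lebesgue_measure]_(t in `[0%R, (2 * pi)%R])
            u (circle_point a r t)].

Definition plurisubharmonic n (D : set 'rV[R[i]]_n)
    (u : 'rV[R[i]]_n -> \bar R) :=
  usc_on D u /\
  forall z X, subharmonic [set t | D (z + t *: X)%R]
                          (fun t => u (z + t *: X)%R).

(* Pseudoconvexity through a continuous plurisubharmonic exhaustion function;
   u is unconstrained outside D. *)
Definition pseudoconvex n (D : set 'rV[R[i]]_n) :=
  exists u : 'rV[R[i]]_n -> R,
    [/\ forall z, D z -> {for z, continuous u},
        plurisubharmonic D (EFin \o u)
      & forall c : R, let K := closure [set z | D z /\ (u z < c)%R] in
          compact K /\ K `<=` D].

End Pseudoconvex.

(* Main.v *)
Require Import Defs.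
From mathcomp Require Import all_boot all_order all_algebra.
From mathcomp Require Import complex.
From mathcomp Require Import all_classical all_reals all_analysis.
From mathcomp Require Import ring lra.
Import numFieldNormedType.Exports.

(** The exhaustion is [1 / dist (z, complement of D)], for the sup norm. It is
    continuous, and as [D] is bounded its sublevel sets are relatively compact in
    [D], so the point is the sub-mean value inequality along complex lines
    ([inv_cdist_submean]).

    Suppose that it fails on some disc in a line [z0 + t X]. Approximating the
    boundary values by the real part of a polynomial and applying the maximum
    principle with a small quadratic term ([circle_approx], [touching_point]),
    one may choose [z0] and an entire function [F] such that [F 0 = 1 / d0], where
    [d0] is the distance at [z0], and the inverse distance at [z0 + t X] is at most
    [Re (F t) - e |t| ^ 2]. If [p = z0 + d0 Y] is a nearest point of the complement,
    [D] therefore contains the points [z0 + t X + (w / F t) Y] with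
    [|w| < 1 + eps |t| ^ 2], while [(t, w) = (0, 1)] gives [p]: the domain is
    pseudoconcave at [p], in a quantitative way.

    For small [s], the discs with [t = a x] or [t = - a x] and
    [w = 1 - eps s ^ 2 + eps a s x] lie in [D] ([graph_disc_pair]). They start at
    the same point, at distance of order [s ^ 2] from [p], and the sum of their
    velocities is a multiple of [Y] of order [s]. A quasi triangle inequality for
    the Kobayashi metric yields one disc in [D] from that point whose velocity is a
    multiple of [Y] at least of order [s] ([kobayashi_fast_discs]). For the Lempert
    function, the two discs are followed one after the other, for a parameter of
    order [s ^ 2], and the Taylor formula gives the same conclusion up to
    [O (s ^ 2)] ([lempert_fast_discs]).

    Such discs do not exist ([no_fast_normal_discs]). By smoothness of the boundary
    [D] lies near [p], to first order, on one side of a real hyperplane transversal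
    to [Y]; the Borel-Caratheodory inequality on a circle of radius proportional to
    [s] then bounds the velocity in the direction [Y] by an arbitrarily small
    multiple of [s].

    The complex analysis is phrased with means of real parts over circles. They do
    not depend on the radius, by Goursat's subdivision argument in logarithmic
    polar coordinates ([boxflux_eq0], [cmean_annulus], [cmean_value]); applied to
    difference quotients, this gives the second order Taylor estimate
    ([taylor2_le]) and [borel_caratheodory]. *)

Set Implicit Arguments.
Unset Strict Implicit.
Unset Printing Implicit Defensive.

Import Order.TTheory GRing.Theory Num.Theory.

Local Open Scope classical_set_scope.
Local Open Scope ring_scope.
Local Open Scope complex_scope.

(** * Real-valued norms over the complex numbers *)

Section Modulus.
Context {R : realType}.
Local Notation C := R[i].
Implicit Types (x y z : C).

Definition rnorm {V : normedZmodType C} (x : V) : R := complex.Re `|x|.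

Lemma rnormE {V : normedZmodType C} (x : V) : `|x| = (rnorm x)%:C.
Proof. by rewrite /rnorm RRe_real// normr_real. Qed.

Lemma rnorm_ge0 {V : normedZmodType C} (x : V) : 0 <= rnorm x.
Proof. by rewrite -lecR -rnormE normr_ge0. Qed.

Lemma rnorm0 {V : normedZmodType C} : rnorm (0 : V) = 0.
Proof. by apply: complexI; rewrite -rnormE normr0. Qed.

Lemma rnorm1 : rnorm (1 : C) = 1.
Proof. by apply: complexI; rewrite -rnormE normr1. Qed.

Lemma rnorm0_eq0 {V : normedZmodType C} (x : V) : rnorm x = 0 -> x = 0.
Proof. by move=> h; apply: normr0_eq0; rewrite rnormE h. Qed.

Lemma rnorm_gt0 {V : normedZmodType C} (x : V) : (0 < rnorm x) = (x != 0).
Proof. by rewrite -ltcR -rnormE normr_gt0. Qed.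

Lemma rnormD {V : normedZmodType C} (x y : V) :
  rnorm (x + y) <= rnorm x + rnorm y.
Proof. by rewrite -lecR rmorphD /= -!rnormE ler_normD. Qed.

Lemma rnormN {V : normedZmodType C} (x : V) : rnorm (- x) = rnorm x.
Proof. by rewrite /rnorm normrN. Qed.

Lemma rnorm_distC {V : normedZmodType C} (x y : V) :
  rnorm (x - y) = rnorm (y - x).
Proof. by rewrite /rnorm distrC. Qed.

Lemma rnormB {V : normedZmodType C} (x y : V) :
  rnorm (x - y) <= rnorm x + rnorm y.
Proof. by rewrite -(rnormN y) rnormD. Qed.

Lemma rnorm_sub_ge {V : normedZmodType C} (x y : V) :
  rnorm x - rnorm y <= rnorm (x - y).
Proof.
by rewrite lerBlDr; apply: le_trans (rnormD _ _); rewrite subrK.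
Qed.

Lemma rnorm_triangle {V : normedZmodType C} (y x z : V) :
  rnorm (x - z) <= rnorm (x - y) + rnorm (y - z).
Proof. by apply: le_trans (rnormD _ _); rewrite addrA subrK. Qed.

Lemma rnormZ (V : normedModType C) x (v : V) :
  rnorm (x *: v) = rnorm x * rnorm v.
Proof. by apply: complexI; rewrite rmorphM /= -!rnormE normrZ. Qed.

Lemma rnormM x y : rnorm (x * y) = rnorm x * rnorm y.
Proof. by apply: complexI; rewrite rmorphM /= -!rnormE normrM. Qed.

Lemma rnormV x : rnorm x^-1 = (rnorm x)^-1.
Proof.
have [->|x0] := eqVneq x 0; first by rewrite invr0 rnorm0 invr0.
have h : rnorm x != 0 by rewrite gt_eqF// rnorm_gt0.
by apply: (mulfI h); rewrite -rnormM !divff// rnorm1.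
Qed.

Lemma rnormX x k : rnorm (x ^+ k) = rnorm x ^+ k.
Proof.
by elim: k => [|k IH]; rewrite ?expr0 ?rnorm1// !exprS rnormM IH.
Qed.

Lemma rnormc (r : R) : rnorm r%:C = `|r|.
Proof. by rewrite /rnorm normc_def /= expr0n addr0 sqrtr_sqr. Qed.

Lemma rnorm_sqr x : rnorm x ^+ 2 = complex.Re x ^+ 2 + complex.Im x ^+ 2.
Proof. by rewrite /rnorm normc_def /= sqr_sqrtr// addr_ge0// sqr_ge0. Qed.

Lemma rnormJ x : rnorm (x^*) = rnorm x.
Proof. by rewrite /rnorm normcJ. Qed.

Lemma Re_le_rnorm x : `|complex.Re x| <= rnorm x.
Proof. by rewrite -lecR -rnormE normc_ge_Re. Qed.

Lemma Im_le_rnorm x : `|complex.Im x| <= rnorm x.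
Proof.
rewrite -(@ler_pXn2r _ 2)// ?nnegrE ?rnorm_ge0//.
by rewrite rnorm_sqr real_normK ?num_real// lerDr sqr_ge0.
Qed.

Lemma rnorm_le_ReIm x : rnorm x <= `|complex.Re x| + `|complex.Im x|.
Proof.
rewrite -(@ler_pXn2r _ 2)// ?nnegrE ?rnorm_ge0 ?addr_ge0//.
rewrite rnorm_sqr -(real_normK (num_real (complex.Re x))).
rewrite -(real_normK (num_real (complex.Im x))).
have := normr_ge0 (complex.Re x); have := normr_ge0 (complex.Im x); nra.
Qed.

Lemma mulcJ x : x * x^* = ((rnorm x) ^+ 2)%:C.
Proof. by rewrite -sqr_normc rnormE rmorphXn. Qed.

Lemma nbhs_rnormP (V : normedModType C) (x : V) (P : set V) :
  nbhs x P <-> exists2 e, 0 < e & forall y : V, rnorm (y - x) < e -> P y.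
Proof.
split.
  move=> /nbhs_normP[e /= e0 h]; exists (complex.Re e).
    by move: e0; rewrite ltcE => /andP[].
  move=> y hy; apply: h => /=; rewrite -normrN opprB rnormE.
  by move: e0; rewrite !ltcE /= => /andP[/eqP-> _]; rewrite eqxx.
move=> [e e0 h]; apply/nbhs_normP; exists e%:C => /=; first by rewrite ltcR.
by move=> y; rewrite /= -normrN opprB rnormE ltcR; apply: h.
Qed.

Lemma continuous_rnormP (V W : normedModType C) (f : V -> W) (x : V) :
  {for x, continuous f} <-> forall e, 0 < e ->
    exists2 d, 0 < d & forall y : V, rnorm (y - x) < d -> rnorm (f y - f x) < e.
Proof.
split=> [fx e e0|h].
  have : nbhs (f x) [set w | rnorm (w - f x) < e] by apply/nbhs_rnormP; exists e.
  by move=> /fx /nbhs_rnormP.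
move=> A /nbhs_rnormP[e e0 /= hA]; have [d d0 hd] := h e e0.
by apply/nbhs_rnormP; exists d => // y hy; apply: hA; exact: hd.
Qed.

Lemma continuous_RP (V : normedModType C) (f : V -> R) (x : V) :
  {for x, continuous f} <-> forall e, 0 < e ->
    exists2 d, 0 < d & forall y : V, rnorm (y - x) < d -> `|f y - f x| < e.
Proof.
split=> [/cvgrPdist_lt fx e e0|h].
  have /nbhs_rnormP[d d0 hd] := fx e e0.
  by exists d => // y hy; rewrite distrC; exact: hd.
apply/cvgrPdist_lt => e e0; have [d d0 hd] := h e e0.
by apply/nbhs_rnormP; exists d => // y hy; rewrite distrC; exact: hd.
Qed.

End Modulus.

(** * Complex derivatives *)

Section ComplexDerivative.
Context {R : realType}.
Local Notation C := R[i].

(** The first order expansion is multiplicative in [h], so no point has to be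
    removed when rules are combined; [cdiff_derivable] relates it to limits of
    difference quotients. *)
Definition cdiff {V : normedModType C} (f : C -> V) (z : C) (l : V) :=
  forall e, 0 < e -> exists2 d, 0 < d &
    forall h, rnorm h < d -> rnorm (f (z + h) - f z - h *: l) <= e * rnorm h.

Lemma cdiff_derivable {V : normedModType C} (f : C -> V) z l :
  cdiff f z l <-> derivable f z 1 /\ f^`()%classic z = l.
Proof.
have key : (fun h => h^-1 *: (f (h + z) - f z)) @ 0^' --> l <-> cdiff f z l.
  split.
    move=> H e e0.
    have : nbhs l [set w | rnorm (w - l) < e] by apply/nbhs_rnormP; exists e.
    move=> /H; rewrite /= /dnbhs /within /= => /nbhs_rnormP[d d0 hd].
    exists d => // h hh; have [->|h0] := eqVneq h 0.
      by rewrite addr0 subrr scale0r subr0 !rnorm0 mulr0.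
    have := hd h; rewrite subr0 => /(_ hh h0) /ltW.
    rewrite -(ler_pM2r (_ : 0 < rnorm h)) ?rnorm_gt0// mulrC -rnormZ.
    by rewrite scalerBr scalerA divff// scale1r (addrC h).
  move=> H A /nbhs_rnormP[e e0 hA].
  have [d d0 hd] := H (e / 2) ltac:(lra).
  rewrite /= /dnbhs /within /=; apply/nbhs_rnormP; exists d => // h.
  rewrite subr0 => hh h0; apply: hA; have := hd h hh.
  rewrite -[X in rnorm X]scale1r -[X in X *: _](divff h0) -scalerA rnormZ.
  rewrite mulrC ler_pM2r ?rnorm_gt0// scalerBr scalerA mulVf// scale1r.
  by rewrite (addrC z) => /le_lt_trans; apply; lra.
rewrite /derivable /derive1 -key; split.
  move=> h; suff -> : (fun h => h^-1 *: (f (h *: 1 + z) - f z)) =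
     (fun h => h^-1 *: (f (h + z) - f z)).
    by split; [exact: (cvgP l) | apply/cvg_lim].
  by apply/funext => k; rewrite [_ *: 1]mulr1.
move=> [h <-]; move: h => /cvg_ex[/= l' hl].
suff h : (fun h => h^-1 *: (f (h + z) - f z)) @ 0^' --> l' by rewrite (cvg_lim _ h).
suff -> : (fun h => h^-1 *: (f (h + z) - f z)) = (fun h => h^-1 *: (f (h *: 1 + z) - f z)) by [].
by apply/funext => k; rewrite [_ *: 1]mulr1.
Qed.

Lemma cdiff_lipschitz {V : normedModType C} (f : C -> V) z l : cdiff f z l ->
  exists2 d, 0 < d & forall h, rnorm h < d ->
    rnorm (f (z + h) - f z) <= (rnorm l + 1) * rnorm h.
Proof.
move=> /(_ 1 ltr01)[d d0 hd]; exists d => // h /hd.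
rewrite mul1r mulrDl mul1r mulrC -rnormZ => hh.
rewrite -[X in rnorm X](subrK (h *: l)) (le_trans (rnormD _ _))//.
by rewrite addrC lerD2l.
Qed.

Lemma cdiff_continuous {V : normedModType C} (f : C -> V) z l : cdiff f z l ->
  {for z, continuous f}.
Proof.
move=> /cdiff_lipschitz[d d0 hd]; apply/continuous_rnormP => e e0.
have l1 : 0 < rnorm l + 1 by rewrite ltr_wpDl// rnorm_ge0.
exists (Num.min d (e / (rnorm l + 1))); first by rewrite lt_min d0 divr_gt0.
move=> y; rewrite lt_min => /andP[/hd]; rewrite (addrC z) subrK => h.
by rewrite ltr_pdivlMr// mulrC => /(le_lt_trans h).
Qed.

Lemma cdiff_near {V : normedModType C} (f g : C -> V) z l d :
  0 < d -> (forall w, rnorm (w - z) < d -> f w = g w) ->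
  cdiff f z l -> cdiff g z l.
Proof.
move=> d0 fg fz e e0; have [d' d'0 h'] := fz e e0.
exists (Num.min d d'); first by rewrite lt_min d0.
move=> h; rewrite lt_min => /andP[hd hd'].
rewrite -!fg ?subrr ?rnorm0//; first exact: h'.
by rewrite addrAC subrr add0r.
Qed.

Lemma cdiff_cst {V : normedModType C} (v : V) z : cdiff (fun=> v) z 0.
Proof.
move=> e e0; exists 1 => // h _.
by rewrite subrr scaler0 subr0 rnorm0 mulr_ge0// ?rnorm_ge0// ltW.
Qed.

Lemma cdiff_id z : cdiff (id : C -> C) z 1.
Proof.
move=> e e0; exists 1 => // h _.
rewrite /= [z + h]addrC addrK [_ *: _]mulr1 subrr.
by rewrite rnorm0 mulr_ge0// ?rnorm_ge0// ltW.
Qed.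

Lemma cdiffD {V : normedModType C} (f g : C -> V) z l m :
  cdiff f z l -> cdiff g z m -> cdiff (fun w => f w + g w) z (l + m).
Proof.
move=> fz gz e e0; have e2 : 0 < e / 2 by lra.
have [d d0 hd] := fz _ e2; have [d' d'0 hd'] := gz _ e2.
exists (Num.min d d'); first by rewrite lt_min d0.
move=> h; rewrite lt_min => /andP[/hd{}hd /hd'{}hd'].
have -> : f (z + h) + g (z + h) - (f z + g z) - h *: (l + m) =
  (f (z + h) - f z - h *: l) + (g (z + h) - g z - h *: m).
  by rewrite scalerDr !opprD (addrACA (f _)) [LHS]addrACA.
by rewrite (le_trans (rnormD _ _))// (splitr e) mulrDl lerD.
Qed.

Lemma cdiffZ {V : normedModType C} (f : C -> C) (g : C -> V) z l m :
  cdiff f z l -> cdiff g z m ->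
  cdiff (fun w => f w *: g w) z (l *: g z + f z *: m).
Proof.
move=> fz gz e e0.
pose K := rnorm (g z) + 1 + rnorm l + rnorm (f z) + 1.
have gz0 := rnorm_ge0 (g z); have l0 := rnorm_ge0 l.
have fz0 := rnorm_ge0 (f z).
have K0 : 0 < K by rewrite /K; lra.
have e1 : 0 < e / K by rewrite divr_gt0.
have [d d0 hd] := fz _ e1; have [d' d'0 hd'] := gz _ e1.
have /continuous_rnormP/(_ (Num.min 1 (e / K))) := cdiff_continuous gz.
rewrite lt_min ltr01 e1 => /(_ isT)[d'' d''0 hd''].
exists (Num.min d (Num.min d' d'')); first by rewrite !lt_min d0 d'0.
move=> h; rewrite !lt_min => /and3P[/hd{}hd /hd'{}hd' hh].
have := hd'' (z + h); rewrite addrAC subrr add0r => /(_ hh).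
rewrite lt_min => /andP[g1 g2].
have -> : f (z + h) *: g (z + h) - f z *: g z - h *: (l *: g z + f z *: m) =
  (f (z + h) - f z - h *: l) *: g (z + h) +
  h *: (l *: (g (z + h) - g z)) + f z *: (g (z + h) - g z - h *: m).
  rewrite !scalerBl !scalerDr !scalerN !scalerA [h *: l](_ : _ = h * l)//.
  rewrite (mulrC h (f z)).
  set A' := f (z + h) *: g (z + h); set B := f z *: g (z + h).
  set D := (h * l) *: g (z + h); set E := (h * l) *: g z.
  set F := f z *: g z; set G := (f z * h) *: m.
  rewrite (addrA _ D) subrK (addrAC A' (- B)) -(addrA B) (addrA _ B) subrK.
  by rewrite -!addrA -!opprD addrCA.
apply: le_trans (rnormD _ _) _.
apply: le_trans (lerD (rnormD _ _) (lexx _)) _; rewrite !rnormZ.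
have g3 : rnorm (g (z + h)) <= rnorm (g z) + 1.
  by have := rnorm_sub_ge (g (z + h)) (g z); lra.
have hh0 := rnorm_ge0 h.
have E : e = e / K * K by rewrite divfK// gt_eqF.
rewrite [in leRHS]E; move: hd hd' g1 g2 e1.
set t := e / K => hd hd' g1 g2 e1.
have -> : t * K * rnorm h = (t * rnorm h) * (rnorm (g z) + 1) +
  rnorm h * (rnorm l * t) + (rnorm (f z) * (t * rnorm h)) + t * rnorm h.
  by rewrite /K; ring.
apply: ler_wpDr; first by rewrite mulr_ge0// ltW.
rewrite lerD//; last by rewrite ler_wpM2l.
rewrite lerD//; first by rewrite ler_pM// rnorm_ge0.
by rewrite ler_wpM2l// ler_wpM2l// ltW.
Qed.

Lemma cdiffM (f g : C -> C) z l m :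
  cdiff f z l -> cdiff g z m ->
  cdiff (fun w => f w * g w) z (l * g z + f z * m).
Proof. exact: cdiffZ. Qed.

Lemma cdiff_comp {V : normedModType C} (f : C -> V) (g : C -> C) z l m :
  cdiff f (g z) l -> cdiff g z m -> cdiff (fun w => f (g w)) z (m *: l).
Proof.
move=> fz gz e e0.
have l0 := rnorm_ge0 l; have m0 := rnorm_ge0 m.
pose K := rnorm m + 1 + rnorm l.
have K0 : 0 < K by rewrite /K; lra.
have e1 : 0 < e / K by rewrite divr_gt0.
have [d d0 hd] := fz _ e1; have [d' d'0 hd'] := gz _ e1.
have [d1 d10 hd1] := cdiff_lipschitz gz.
have m1 : 0 < rnorm m + 1 by lra.
exists (Num.min d' (Num.min d1 (d / (rnorm m + 1)))).
  by rewrite !lt_min d'0 d10 divr_gt0.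
move=> h; rewrite !lt_min => /and3P[/hd'{}hd' /hd1{}hd1].
rewrite ltr_pdivlMr// mulrC => hh.
have := hd (g (z + h) - g z) (le_lt_trans hd1 hh).
rewrite (addrC (g z)) subrK => {}hd.
have -> : f (g (z + h)) - f (g z) - h *: (m *: l) =
  (f (g (z + h)) - f (g z) - (g (z + h) - g z) *: l) +
  (g (z + h) - g z - h *: m) *: l.
  by rewrite [(_ - h *: m) *: l]scalerBl addrA subrK scalerA.
apply: le_trans (rnormD _ _) _; rewrite rnormZ.
have E : e = e / K * K by rewrite divfK// gt_eqF.
rewrite [in leRHS]E; move: hd hd' e1.
set t := e / K => hd hd' e1.
have -> : t * K * rnorm h = t * ((rnorm m + 1) * rnorm h) + t * rnorm h * rnorm l.
  by rewrite /K; ring.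
rewrite lerD//; last by rewrite ler_wpM2r.
by rewrite (le_trans hd)// ler_wpM2l// ltW.
Qed.

Lemma cdiffVid z : z != 0 -> cdiff (fun w : C => w^-1) z (- z ^- 2).
Proof.
move=> z0 e e0; have nz : 0 < rnorm z by rewrite rnorm_gt0.
exists (Num.min (rnorm z / 2) (e * rnorm z ^+ 3 / 2)).
  by rewrite lt_min !divr_gt0// mulr_gt0// exprn_gt0.
move=> h; rewrite lt_min => /andP[h1 h2].
have h3 : rnorm z / 2 < rnorm (z + h).
  by have := rnorm_sub_ge z (- h); rewrite opprK rnormN; lra.
have zh0 : z + h != 0 by rewrite -rnorm_gt0; lra.
have -> : (z + h)^-1 - z^-1 - h *: (- z ^- 2) = h ^+ 2 / (z ^+ 2 * (z + h)).
  rewrite [h *: _](_ : _ = h * (- z ^- 2))//; field.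
  by rewrite zh0.
rewrite rnormM rnormV rnormM !rnormX expr2 -mulrA mulrC ler_wpM2r ?rnorm_ge0//.
rewrite ler_pdivrMr; last by rewrite mulr_gt0// ?exprn_gt0//; lra.
apply: le_trans (ltW h2) _; rewrite -mulrA ler_pM2l// exprSr -mulrA.
by rewrite ler_wpM2l ?sqr_ge0// ltW.
Qed.

Lemma cdiffV (f : C -> C) z l : cdiff f z l -> f z != 0 ->
  cdiff (fun w => (f w)^-1) z (l * - (f z) ^- 2).
Proof. by move=> fz f0; apply: cdiff_comp fz; exact: cdiffVid. Qed.

Lemma rnorm_coord n (v : 'rV[C]_n) j : rnorm (v 0 j) <= rnorm v.
Proof.
rewrite -lecR -!rnormE [leRHS]mx_normE.
rewrite -[leLHS]nngE num_le.
exact: (le_bigmax _ (fun i : 'I_1 * 'I_n => `|v i.1 i.2|%:nng) (0, j)).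
Qed.

Lemma rnorm_le_coord n (v : 'rV[C]_n) M : 0 <= M ->
  (forall j, rnorm (v 0 j) <= M) -> rnorm v <= M.
Proof.
move=> M0 h; rewrite -lecR -!rnormE [leLHS]mx_normE.
have M0' : 0 <= M%:C by rewrite lecR.
rewrite -[leRHS](_ : (NngNum M0')%:num = _)// num_le; apply/bigmax_leP.
split=> [|[i j] _]; first by rewrite -num_le.
by rewrite -num_le /= ord1 rnormE lecR.
Qed.

Lemma cdiff_coord n (f : C -> 'rV[C]_n) z l j :
  cdiff f z l -> cdiff (fun w => f w 0 j) z (l 0 j).
Proof.
move=> fz e e0; have [d d0 hd] := fz e e0; exists d => // h /hd.
by apply: le_trans; apply: le_trans (rnorm_coord _ j); rewrite !mxE.
Qed.

Lemma cdiff_sum n (f : 'I_n -> C -> C) (l : 'I_n -> C) z :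
  (forall j, cdiff (f j) z (l j)) ->
  cdiff (fun w => \sum_(j < n) f j w) z (\sum_(j < n) l j).
Proof.
elim: n f l => [|n IH] f l h.
  rewrite big_ord0; under eq_fun do rewrite big_ord0; exact: cdiff_cst.
have -> : (fun w => \sum_(j < n.+1) f j w) =
    (fun w => \sum_(j < n) f (widen_ord (leqnSn n) j) w + f ord_max w).
  by apply/funext => w; rewrite big_ord_recr.
rewrite big_ord_recr /=.
by apply: (@cdiffD C _ (f ord_max)) => //; apply: IH.
Qed.

End ComplexDerivative.

(** * Compact sets *)

Section Compactness.
Context {R : realType}.
Local Notation C := R[i].

(** A closed square is the image of a product of two compact real intervals, and
    a disc is closed in such a square. *)
Lemma compact_disc (a : C) (r : R) : compact [set z : C | rnorm (z - a) <= r].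
Proof.
pose g (x : 'rV[R]_2) : C := (x 0 0) +i* (x 0 1).
pose I : set R := `[- (rnorm a + r), rnorm a + r]%classic.
pose A := [set x : 'rV[R]_2 | forall j, I (x 0 j)].
have cA : compact A.
  by apply: (@rV_compact R 2 (fun=> I)) => j; exact: segment_compact.
have cg : continuous g.
  move=> x B /nbhs_rnormP[e e0 hB].
  have e2 : 0 < e / 2 by lra.
  apply/nbhs_ballP; exists (e / 2) => //= y [_ hy]; apply: hB.
  apply: le_lt_trans (rnorm_le_ReIm _) _.
  have := hy 0 0; have := hy 0 1; rewrite /ball /= => h1 h2.
  rewrite /g /= (distrC (y 0 0)) (distrC (y 0 1)); lra.
have cK : compact (g @` A).
  apply: continuous_compact => //; exact: continuous_subspaceT.
apply: subclosed_compact cK _.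
  rewrite -[X in closed X]setCK; apply: open_closedC.
  rewrite openE => z /= /negP; rewrite -ltNge => hz.
  apply/nbhs_rnormP; exists (rnorm (z - a) - r); first by lra.
  move=> y hy /= h; have := rnorm_triangle y z a; rewrite (rnorm_distC z y); lra.
move=> z /= hz; exists (\row_j (if j == 0 then complex.Re z else complex.Im z)).
  move=> j; rewrite /I /= mxE in_itv/= -ler_norml.
  have h : rnorm z <= rnorm a + r by have := rnorm_sub_ge z a; lra.
  by case: ifP => _; apply: le_trans h; rewrite ?Re_le_rnorm ?Im_le_rnorm.
by rewrite /g !mxE /=; case: z hz.
Qed.

Lemma compact_rV n (A : set 'rV[C]_n) (M : R) : closed A ->
  (forall v, A v -> rnorm v <= M) -> compact A.
Proof.
move=> cA hA.
have cK : compact [set v : 'rV[C]_n | forall j, rnorm (v 0 j - 0) <= M].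
  by apply: (@rV_compact _ _ (fun=> [set z : C | rnorm (z - 0) <= M])) => j;
    exact: compact_disc.
apply: subclosed_compact cK _ => // v /hA h j /=.
by rewrite subr0 (le_trans (rnorm_coord _ _)).
Qed.

End Compactness.

(** * Integrals of continuous functions over an interval *)

Section RealIntegral.
Context {R : realType}.
Implicit Types (f g : R -> R) (a b c M : R).

Lemma cont_realP f x : {for x, continuous f} <-> forall e, 0 < e ->
  exists2 d, 0 < d & forall y, `|y - x| < d -> `|f y - f x| < e.
Proof.
split=> [/cvgrPdist_lt fx e e0|h].
  have /nbhs_ballP[d d0 hd] := fx e e0; exists d => // y hy.
  by rewrite distrC; apply: hd; rewrite /ball /= distrC.
apply/cvgrPdist_lt => e e0; have [d d0 hd] := h e e0.
apply/nbhs_ballP; exists d => // y; rewrite /ball /= distrC => /hd.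
by rewrite distrC.
Qed.

(** Two-sided continuity at the end points too: no interval is ever restricted
    to a subspace, and [cont_onS] is immediate. *)
Definition cont_on a b f := forall x, a <= x <= b -> {for x, continuous f}.

Definition rint a b f : R := \int[lebesgue_measure]_(x in `[a, b]) f x.

Lemma cont_on_integrable a b f : cont_on a b f ->
  lebesgue_measure.-integrable `[a, b]%classic (EFin \o f).
Proof.
move=> cf; apply: continuous_compact_integrable; first exact: segment_compact.
by apply: continuous_in_subspaceT => x /set_mem /=; rewrite in_itv/=; apply: cf.
Qed.

Lemma cont_onS a b a' b' f : a <= a' -> b' <= b -> cont_on a b f ->
  cont_on a' b' f.
Proof.
move=> aa bb cf x /andP[h1 h2]; apply: cf.
by rewrite (le_trans aa)// (le_trans h2).
Qed.

Lemma cont_onD a b f g : cont_on a b f -> cont_on a b g ->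
  cont_on a b (fun x => f x + g x).
Proof. by move=> cf cg x xab; apply: cvgD; [exact: cf|exact: cg]. Qed.

Lemma cont_onN a b f : cont_on a b f -> cont_on a b (fun x => - f x).
Proof. by move=> cf x xab; apply: cvgN; exact: cf. Qed.

Lemma cont_onB a b f g : cont_on a b f -> cont_on a b g ->
  cont_on a b (fun x => f x - g x).
Proof. by move=> cf cg; exact: (cont_onD cf (cont_onN cg)). Qed.

Lemma cont_on_cst a b c : cont_on a b (fun=> c).
Proof. by move=> x _; exact: cvg_cst. Qed.

Lemma rint_split a b c f : a <= c <= b -> cont_on a b f ->
  rint a b f = rint a c f + rint c b f.
Proof.
move=> /andP[ac cb] cf; have fi := cont_on_integrable cf.
rewrite {3}/rint -Rintegral_itv_obnd_cbnd.
  by rewrite -(Rintegral_itvB fi)// addrC subrK.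
by apply: integrableS fi => //; apply: subset_itvr; rewrite bnd_simp.
Qed.

Lemma rintD a b f g : cont_on a b f -> cont_on a b g ->
  rint a b (fun x => f x + g x) = rint a b f + rint a b g.
Proof. by move=> cf cg; apply: RintegralD => //; exact: cont_on_integrable. Qed.

Lemma rintB a b f g : cont_on a b f -> cont_on a b g ->
  rint a b (fun x => f x - g x) = rint a b f - rint a b g.
Proof. by move=> cf cg; apply: RintegralB => //; exact: cont_on_integrable. Qed.

Lemma rintZ a b c f : cont_on a b f ->
  rint a b (fun x => c * f x) = c * rint a b f.
Proof. by move=> cf; apply: RintegralZl => //; exact: cont_on_integrable. Qed.

Lemma rint_cst a b c : a <= b -> rint a b (fun=> c) = c * (b - a).
Proof.
move=> ab; rewrite /rint Rintegral_cst//= lebesgue_measure_itv/= lte_fin.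
by move: ab; rewrite le_eqVlt => /predU1P[->|->] //=; rewrite ltxx /= subrr.
Qed.

Lemma le_rint a b f g : cont_on a b f -> cont_on a b g ->
  (forall x, a <= x <= b -> f x <= g x) -> rint a b f <= rint a b g.
Proof.
by move=> cf cg fg; apply: le_Rintegral => //; exact: cont_on_integrable.
Qed.

Lemma eq_rint a b f g : (forall x, a <= x <= b -> f x = g x) ->
  rint a b f = rint a b g.
Proof.
by move=> fg; apply: eq_Rintegral => x /set_mem /=; rewrite in_itv; exact: fg.
Qed.

Lemma norm_rint_le a b f M : a <= b -> cont_on a b f ->
  (forall x, a <= x <= b -> `|f x| <= M) -> `|rint a b f| <= M * (b - a).
Proof.
move=> ab cf fM; rewrite ler_norml -mulNr -!rint_cst//.
by rewrite !le_rint//; try exact: cont_on_cst;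
  move=> x /fM; rewrite ler_norml => /andP[].
Qed.

End RealIntegral.

(** * Vanishing flux through the boundary of a box *)

Section Divergence.
Context {R : realType}.
Implicit Types (P Q : R -> R -> R).

(** Total differentiability at [(s, t)], with partial derivatives [p] and [q]. *)
Definition pdiff P (s t p q : R) := forall e : R, 0 < e -> exists2 d : R, 0 < d &
  forall s' t', `|s' - s| < d -> `|t' - t| < d ->
    `|P s' t' - P s t - p * (s' - s) - q * (t' - t)| <=
      e * (`|s' - s| + `|t' - t|).

Lemma pdiff_cont P s t p q : pdiff P s t p q ->
  {for t, continuous (P s)} /\ {for s, continuous (P ^~ t)}.
Proof.
move=> /(_ 1 ltr01)[d d0 hd].
have K0 : 0 < `|p| + `|q| + 1 by rewrite ltr_wpDl// addr_ge0.
have key s' t' e : 0 < e -> `|s' - s| < d -> `|t' - t| < d ->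
  `|s' - s| + `|t' - t| < e / (`|p| + `|q| + 1) -> `|P s t - P s' t'| < e.
  move=> e0 h1 h2; rewrite ltr_pdivlMr// => h3.
  have := hd s' t' h1 h2; rewrite mul1r distrC => h4.
  have n1 := normrM p (s' - s); have n2 := normrM q (t' - t).
  have := ler_norm (p * (s' - s)); have := ler_norm (- (p * (s' - s))).
  have := ler_norm (q * (t' - t)); have := ler_norm (- (q * (t' - t))).
  rewrite !normrN n1 n2; move: h4; rewrite ler_norml ltr_norml => /andP[h4 h5].
  have := mulr_ge0 (normr_ge0 p) (normr_ge0 (t' - t)).
  have := mulr_ge0 (normr_ge0 q) (normr_ge0 (s' - s)).
  by move=> *; apply/andP; split; lra.
split; apply/cont_realP => e e0;
  exists (Num.min d (e / (`|p| + `|q| + 1))); rewrite ?lt_min ?d0 ?divr_gt0//;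
  move=> x; rewrite lt_min => /andP[h1 h2]; rewrite distrC;
  by apply: key; rewrite // subrr normr0 ?addr0 ?add0r.
Qed.

(** The outward flux of the field [(P, Q)] through the sides of
    [[s1, s2] x [t1, t2]]. *)
Definition boxflux P Q s1 s2 t1 t2 : R :=
  rint t1 t2 (P s2) - rint t1 t2 (P s1) +
  (rint s1 s2 (Q ^~ t2) - rint s1 s2 (Q ^~ t1)).

(** The affine part of a field of divergence [p + - p = 0] has no flux, so only
    the error terms of the two expansions at [(s, t)] remain. *)
Lemma boxflux_affine_le P Q (s t p q q' e d s1 s2 t1 t2 : R) : 0 <= e ->
  (forall s' t', `|s' - s| < d -> `|t' - t| < d ->
    `|P s' t' - P s t - p * (s' - s) - q * (t' - t)| <=
      e * (`|s' - s| + `|t' - t|)) ->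
  (forall s' t', `|s' - s| < d -> `|t' - t| < d ->
    `|Q s' t' - Q s t - q' * (s' - s) - - p * (t' - t)| <=
      e * (`|s' - s| + `|t' - t|)) ->
  s1 <= s <= s2 -> t1 <= t <= t2 -> s2 - s1 < d -> t2 - t1 < d ->
  cont_on t1 t2 (P s1) -> cont_on t1 t2 (P s2) ->
  cont_on s1 s2 (Q ^~ t1) -> cont_on s1 s2 (Q ^~ t2) ->
  `|boxflux P Q s1 s2 t1 t2| <= 2 * e * (s2 - s1 + (t2 - t1)) ^+ 2.
Proof.
move=> e0 hP hQ /andP[s1s ss2] /andP[t1t tt2] sd td c1 c2 c3 c4.
have inS x : s1 <= x <= s2 -> `|x - s| <= s2 - s1.
  by move=> /andP[? ?]; rewrite ler_norml; apply/andP; split; lra.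
have inT x : t1 <= x <= t2 -> `|x - t| <= t2 - t1.
  by move=> /andP[? ?]; rewrite ler_norml; apply/andP; split; lra.
have s1s2 : s1 <= s2 by lra.
have t1t2 : t1 <= t2 by lra.
have hs1 : s1 <= s1 <= s2 by rewrite lexx.
have hs2 : s1 <= s2 <= s2 by rewrite lexx andbT.
have ht1 : t1 <= t1 <= t2 by rewrite lexx.
have ht2 : t1 <= t2 <= t2 by rewrite lexx andbT.
have mono a b a' b' : a <= a' -> b <= b' -> e * (a + b) <= e * (a' + b').
  by move=> ? ?; rewrite ler_wpM2l// lerD.
have I1 : `|rint t1 t2 (P s2) - rint t1 t2 (P s1) - p * (s2 - s1) * (t2 - t1)|
   <= (2 * e * (s2 - s1 + (t2 - t1))) * (t2 - t1).
  rewrite -rintB// -rint_cst// -rintB//; last 2 first.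
  - exact: cont_onB.
  - exact: cont_on_cst.
  apply: norm_rint_le => // [|x hx].
    exact: (cont_onB (cont_onB c2 c1) (@cont_on_cst _ t1 t2 (p * (s2 - s1)))).
  have hh := inT _ hx; have g1 := inS _ hs1; have g2 := inS _ hs2.
  have := hP s1 x (le_lt_trans g1 sd) (le_lt_trans hh td).
  have := hP s2 x (le_lt_trans g2 sd) (le_lt_trans hh td).
  have := mono _ _ _ _ g1 hh; have := mono _ _ _ _ g2 hh.
  move=> m2 m1 /le_trans/(_ m2)/ler_normlP[? ?].
  move=> /le_trans/(_ m1)/ler_normlP[? ?].
  by apply/ler_normlP; split; lra.
have I2 : `|rint s1 s2 (Q^~ t2) - rint s1 s2 (Q^~ t1) + p * (t2 - t1) * (s2 - s1)|
   <= (2 * e * (s2 - s1 + (t2 - t1))) * (s2 - s1).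
  rewrite -rintB// -rint_cst// -rintD//; last 2 first.
  - exact: cont_onB.
  - exact: cont_on_cst.
  apply: norm_rint_le => // [|x hx].
    exact: (cont_onD (cont_onB c4 c3) (@cont_on_cst _ s1 s2 (p * (t2 - t1)))).
  have hh := inS _ hx; have g1 := inT _ ht1; have g2 := inT _ ht2.
  have := hQ x t1 (le_lt_trans hh sd) (le_lt_trans g1 td).
  have := hQ x t2 (le_lt_trans hh sd) (le_lt_trans g2 td).
  have := mono _ _ _ _ hh g1; have := mono _ _ _ _ hh g2.
  move=> m2 m1 /le_trans/(_ m2)/ler_normlP[? ?].
  move=> /le_trans/(_ m1)/ler_normlP[? ?].
  by apply/ler_normlP; split; lra.
rewrite (_ : boxflux _ _ _ _ _ _ =
  rint t1 t2 (P s2) - rint t1 t2 (P s1) - p * (s2 - s1) * (t2 - t1) +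
  (rint s1 s2 (Q^~ t2) - rint s1 s2 (Q^~ t1) + p * (t2 - t1) * (s2 - s1)));
  last by rewrite /boxflux; ring.
by apply: le_trans (ler_normD _ _) _; apply: le_trans (lerD I1 I2) _; lra.
Qed.

Lemma boxflux_quarter P Q (s1 s s2 t1 t t2 : R) :
  s1 <= s <= s2 -> t1 <= t <= t2 ->
  (forall x, s1 <= x <= s2 -> cont_on t1 t2 (P x)) ->
  (forall y, t1 <= y <= t2 -> cont_on s1 s2 (Q ^~ y)) ->
  boxflux P Q s1 s2 t1 t2 =
    boxflux P Q s1 s t1 t + boxflux P Q s s2 t1 t +
    (boxflux P Q s1 s t t2 + boxflux P Q s s2 t t2).
Proof.
move=> /andP[h1 h2] /andP[h3 h4] cP cQ.
have sP x : s1 <= x <= s2 -> rint t1 t2 (P x) = rint t1 t (P x) + rint t t2 (P x).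
  by move=> hx; rewrite (@rint_split _ _ _ t)// ?h3//; exact: cP.
have sQ y : t1 <= y <= t2 ->
    rint s1 s2 (Q ^~ y) = rint s1 s (Q ^~ y) + rint s s2 (Q ^~ y).
  by move=> hy; rewrite (@rint_split _ _ _ s)// ?h1//; exact: cQ.
rewrite /boxflux !sP ?sQ ?lexx ?h3 ?h4 ?h1 ?h2 ?(le_trans h1 h2) ?(le_trans h3 h4)//.
by ring.
Qed.

(** Goursat's subdivision argument, which needs no continuity of the derivatives:
    by [boxflux_quarter] one of the four quarters of a box carries a quarter of
    the flux, and at the common point of the nested boxes
    [boxflux_affine_le] makes the flux small compared with the area. *)
Lemma boxflux_eq0 P Q (S1 S2 T1 T2 : R) : S1 <= S2 -> T1 <= T2 ->
  (forall s t, S1 <= s <= S2 -> T1 <= t <= T2 -> exists p q q',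
    pdiff P s t p q /\ pdiff Q s t q' (- p)) ->
  boxflux P Q S1 S2 T1 T2 = 0.
Proof.
move=> S12 T12 PQ.
have cP x : S1 <= x <= S2 -> cont_on T1 T2 (P x).
  by move=> hx y hy; have [p [q [q' [/pdiff_cont[]]]]] := PQ _ _ hx hy.
have cQ y : T1 <= y <= T2 -> cont_on S1 S2 (Q ^~ y).
  by move=> hy x hx; have [p [q [q' [_ /pdiff_cont[]]]]] := PQ _ _ hx hy.
pose A := S2 - S1; pose B := T2 - T1.
have A0 : 0 <= A by rewrite subr_ge0.
have B0 : 0 <= B by rewrite subr_ge0.
apply/eqP; rewrite -normr_eq0 -(negbK (_ == _)) -normr_gt0 normr_id; apply/negP.
set c := `|_| => c0.
pose h k : R := 2^-1 ^+ k.
have h0 k : 0 < h k by rewrite exprn_gt0// invr_gt0.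
have hS k : h k = h k.+1 + h k.+1 by rewrite /h exprS; field.
have Ah k : 0 <= A * h k by rewrite mulr_ge0// ltW.
have Bh k : 0 <= B * h k by rewrite mulr_ge0// ltW.
pose flux k (x : R * R) :=
  boxflux P Q x.1 (x.1 + A * h k) x.2 (x.2 + B * h k).
pose G k (x : R * R) := [/\ S1 <= x.1, x.1 + A * h k <= S2, T1 <= x.2,
  x.2 + B * h k <= T2 & c * h k ^+ 2 <= `|flux k x|].
pose sub k (x y : R * R) := [/\ x.1 <= y.1, y.1 + A * h k.+1 <= x.1 + A * h k,
  x.2 <= y.2 & y.2 + B * h k.+1 <= x.2 + B * h k].
have step k x : G k x -> exists y, G k.+1 y /\ sub k x y.
  move=> [g1 g2 g3 g4 g5]; have Ak := Ah k.+1; have Bk := Bh k.+1.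
  have AS : A * h k = A * h k.+1 + A * h k.+1 by rewrite hS mulrDr.
  have BS : B * h k = B * h k.+1 + B * h k.+1 by rewrite hS mulrDr.
  have : `|flux k x| <= `|flux k.+1 x| + `|flux k.+1 (x.1 + A * h k.+1, x.2)| +
      (`|flux k.+1 (x.1, x.2 + B * h k.+1)| +
       `|flux k.+1 (x.1 + A * h k.+1, x.2 + B * h k.+1)|).
    have -> : flux k x = flux k.+1 x + flux k.+1 (x.1 + A * h k.+1, x.2) +
      (flux k.+1 (x.1, x.2 + B * h k.+1) +
       flux k.+1 (x.1 + A * h k.+1, x.2 + B * h k.+1)).
      rewrite /flux /= -(addrA x.1) -AS -(addrA x.2) -BS.
      rewrite (@boxflux_quarter _ _ _ (x.1 + A * h k.+1) _ _ (x.2 + B * h k.+1)).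
      - by [].
      - by apply/andP; split; lra.
      - by apply/andP; split; lra.
      - move=> s /andP[? ?]; by apply: cont_onS (cP s _); lra.
      - move=> t /andP[? ?]; by apply: cont_onS (cQ t _); lra.
    by do !apply: le_trans (ler_normD _ _) _; rewrite lerD// ler_normD.
  have E : c * h k ^+ 2 = c * h k.+1 ^+ 2 *+ 4.
    by rewrite hS -mulrnAr; congr (_ * _); ring.
  move=> F; have {F} := le_trans g5 F; rewrite E => F.
  have e1 : x.1 + A * h k.+1 <= x.1 + A * h k by rewrite AS lerD2l lerDl.
  have e2 : x.2 + B * h k.+1 <= x.2 + B * h k by rewrite BS lerD2l lerDl.
  have e3 : x.1 <= x.1 + A * h k.+1 by rewrite lerDl.
  have e4 : x.2 <= x.2 + B * h k.+1 by rewrite lerDl.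
  have e5 : x.1 + A * h k.+1 + A * h k.+1 = x.1 + A * h k by rewrite AS addrA.
  have e6 : x.2 + B * h k.+1 + B * h k.+1 = x.2 + B * h k by rewrite BS addrA.
  have e7 := le_trans e1 g2; have e8 := le_trans e2 g4.
  have e9 := le_trans g1 e3; have e10 := le_trans g3 e4.
  have [G1|G1] := leP (c * h k.+1 ^+ 2) `|flux k.+1 x|.
    by exists x; split; split; rewrite ?lexx.
  have [G2|G2] := leP (c * h k.+1 ^+ 2) `|flux k.+1 (x.1 + A * h k.+1, x.2)|.
    by exists (x.1 + A * h k.+1, x.2); split; split; rewrite //= ?e5 ?lexx.
  have [G3|G3] := leP (c * h k.+1 ^+ 2) `|flux k.+1 (x.1, x.2 + B * h k.+1)|.
    by exists (x.1, x.2 + B * h k.+1); split; split; rewrite //= ?e6 ?lexx.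
  exists (x.1 + A * h k.+1, x.2 + B * h k.+1).
  split; split; rewrite //= ?e5 ?e6 ?lexx //.
  by move: F G1 G2 G3; clear; lra.
(* The lower left corners of the chosen boxes. *)
pose u := fix u k : R * R := if k is k'.+1 then
  xget (0, 0) [set y | G k'.+1 y /\ sub k' (u k') y] else (S1, T1).
have Gu k : G k (u k).
  elim: k => [|k /step/xgetPex/= /(_ (0, 0)) []]//.
  split; rewrite /flux /= ?lexx// /h expr0 !mulr1 /A /B ?expr1n ?mulr1.
  - by rewrite addrC subrK.
  - by rewrite addrC subrK.
  - by rewrite !(addrC _ (_ - _)) !subrK.
have subu k : sub k (u k) (u k.+1).
  by have /step/xgetPex/= /(_ (0, 0)) [] := Gu k.
have mono1 k m : (u k).1 <= (u (m + k)%N).1 /\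
    (u (m + k)%N).1 + A * h (m + k)%N <= (u k).1 + A * h k.
  elim: m => [|m [IH1 IH2]]; first by rewrite add0n.
  by have [? ? _ _] := subu (m + k)%N; rewrite addSn; split; lra.
have mono2 k m : (u k).2 <= (u (m + k)%N).2 /\
    (u (m + k)%N).2 + B * h (m + k)%N <= (u k).2 + B * h k.
  elim: m => [|m [IH1 IH2]]; first by rewrite add0n.
  by have [_ _ ? ?] := subu (m + k)%N; rewrite addSn; split; lra.
have limit (v : nat -> R) (K : R) : 0 <= K ->
    (forall k m, v k <= v (m + k)%N /\ v (m + k)%N + K * h (m + k)%N <= v k + K * h k) ->
    exists l, forall k, v k <= l <= v k + K * h k.
  move=> K0 H; have H' k m : v k <= v m + K * h m.
    have [le_km|/ltnW le_mk] := leqP k m.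
      have [a _] := H k (m - k)%N; rewrite subnK// in a.
      by have := mulr_ge0 K0 (ltW (h0 m)); lra.
    have [_ b] := H m (k - m)%N; rewrite subnK// in b.
    by have := mulr_ge0 K0 (ltW (h0 k)); lra.
  exists (sup (range v)) => k; apply/andP; split.
    apply: ub_le_sup; last by exists k.
    by exists (v 0%N + K * h 0%N) => _ [j _ <-].
  apply: ge_sup; first by exists (v 0%N), 0%N.
  by move=> _ [j _ <-].
have [s hs] := limit _ _ A0 mono1; have [t ht] := limit _ _ B0 mono2.
have [g1 g2 g3 g4 _] := Gu 0%N.
have hs0 := hs 0%N; have ht0 := ht 0%N.
have sI : S1 <= s <= S2 by move/andP: hs0 => [? ?]; apply/andP; split; lra.
have tI : T1 <= t <= T2 by move/andP: ht0 => [? ?]; apply/andP; split; lra.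
have [p [q [q' [dP dQ]]]] := PQ _ _ sI tI.
pose K := 2 * (A + B) ^+ 2 + 1.
have K0 : 0 < K by have := sqr_ge0 (A + B); rewrite /K; lra.
have e0 : 0 < c / K by rewrite divr_gt0.
have [d /= d0 hd] := dP _ e0; have [d' /= d'0 hd'] := dQ _ e0.
(* The extra [1] keeps the factor positive when the box is a point. *)
have [k hk] : exists k, h k * (A + B + 1) < Num.min d d'.
  have m0 : 0 < Num.min d d' / (A + B + 1) by rewrite divr_gt0 ?lt_min ?d0//; lra.
  have : (fun k => h k) @ \oo --> (0 : R).
    by apply: cvg_expr; rewrite ger0_norm ?invr_ge0// invf_lt1// ltr1n.
  move=> /cvgrPdist_lt/(_ _ m0)[k _ /(_ k (leqnn k))] /=.
  rewrite sub0r normrN gtr0_norm// ltr_pdivlMr; first by exists k.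
  by lra.
move: hk; rewrite lt_min => /andP[hk1 hk2].
have [g1' g2' g3' g4' g5'] := Gu k.
have hAB : A * h k + B * h k < d /\ A * h k + B * h k < d'.
  by move: (h0 k) hk1 hk2; clear; split; lra.
have Ak := Ah k; have Bk := Bh k.
have [Ad Ad'] : A * h k < d /\ A * h k < d'.
  by move: hAB Ak Bk; clear => -[]; split; lra.
have [Bd Bd'] : B * h k < d /\ B * h k < d'.
  by move: hAB Ak Bk; clear => -[]; split; lra.
have := @boxflux_affine_le P Q s t p q q' (c / K) (Num.min d d') (u k).1
  ((u k).1 + A * h k) (u k).2 ((u k).2 + B * h k) (ltW e0).
have side : forall x y, `|x - s| < Num.min d d' -> `|y - t| < Num.min d d' ->
  [/\ `|x - s| < d, `|x - s| < d', `|y - t| < d & `|y - t| < d'].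
  by move=> x y; rewrite !lt_min => /andP[? ?] /andP[? ?].
move=> /(_ _ _ (hs k) (ht k)).
have -> : (u k).1 + A * h k - (u k).1 = A * h k by ring.
have -> : (u k).2 + B * h k - (u k).2 = B * h k by ring.
rewrite !lt_min.
have uS1 : S1 <= (u k).1 <= S2 by rewrite g1' (le_trans _ g2')// lerDl.
have uS2 : S1 <= (u k).1 + A * h k <= S2 by rewrite g2' (le_trans g1')// lerDl.
have uT1 : T1 <= (u k).2 <= T2 by rewrite g3' (le_trans _ g4')// lerDl.
have uT2 : T1 <= (u k).2 + B * h k <= T2 by rewrite g4' (le_trans g3')// lerDl.
rewrite Ad Ad' Bd Bd'.
move=> H; have {H} : `|flux k (u k)| <= 2 * (c / K) * (A * h k + B * h k) ^+ 2.
  apply: H => //.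
  - by move=> x y hx hy; have [? ? ? ?] := side _ _ hx hy; exact: hd.
  - by move=> x y hx hy; have [? ? ? ?] := side _ _ hx hy; exact: hd'.
  - exact: cont_onS (cP _ uS1).
  - exact: cont_onS (cP _ uS2).
  - exact: cont_onS (cQ _ uT1).
  - exact: cont_onS (cQ _ uT2).
move=> /(le_trans g5').
have -> : 2 * (c / K) * (A * h k + B * h k) ^+ 2 =
  h k ^+ 2 * (c / K * (K - 1)).
  have -> : K - 1 = 2 * (A + B) ^+ 2 by rewrite /K addrK.
  by ring.
rewrite mulrC ler_pM2l ?exprn_gt0//.
by rewrite mulrBr mulr1 divfK ?gt_eqF// lerBrDl gerDr leNgt e0.
Qed.

End Divergence.

(** * The complex exponential *)

Section ComplexExp.
Context {R : realType}.
Local Notation C := R[i].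

Lemma is_derive_approx (f : R -> R) (x l : R) : is_derive x 1 f l ->
  forall e : R, 0 < e -> exists2 d : R, 0 < d &
    forall h : R, `|h| < d -> `|f (x + h) - f x - l * h| <= e * `|h|.
Proof.
move=> [fx <-] e e0; have := fx => /cvg_lim -/(_ (@Rhausdorff R)).
rewrite -/(derive f x 1) => E.
have /cvgrPdist_lt/(_ e e0) := fx; rewrite E /= /dnbhs /within /= => /nbhs_ballP.
move=> [d d0 hd]; exists d => // h hh; have [->|h0] := eqVneq h 0.
  by rewrite addr0 subrr mulr0 subr0 normr0 mulr0.
have := hd h; rewrite /ball /= sub0r normrN => /(_ hh h0).
rewrite [h *: 1]mulr1 (addrC h) => /ltW.
have hp : 0 < `|h| by rewrite normr_gt0.
rewrite -(ler_pM2r hp) -normrM mulrBl [_ *: _]mulrC mulfVK // distrC.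
by [].
Qed.

Definition cexp (w : C) : C :=
  (expR (complex.Re w))%:C * (cos (complex.Im w) +i* sin (complex.Im w)).

Lemma cexpD w h : cexp (w + h) = cexp w * cexp h.
Proof.
case: w => a b; case: h => c d; rewrite /cexp /= expRD cosD sinD.
by apply/eqP; rewrite eq_complex /=; apply/andP; split; apply/eqP; ring.
Qed.

Lemma cdiff_cexp0 : cdiff cexp 0 1.
Proof.
move=> e e0.
pose e1 := Num.min (e / 8) 1.
have e10 : 0 < e1 by rewrite lt_min ltr01 andbT divr_gt0.
have e11 : e1 <= 1 by rewrite /e1 ge_min lexx orbT.
have e18 : 8 * e1 <= e.
  have : e1 <= e / 8 by rewrite /e1 ge_min lexx.
  by clear; lra.
have [d1 d10 hd1] := is_derive_approx (is_derive_expR (0 : R)) e10.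
have [d2 d20 hd2] := is_derive_approx (is_derive_cos (0 : R)) e10.
have [d3 d30 hd3] := is_derive_approx (is_derive_sin (0 : R)) e10.
exists (Num.min (Num.min d1 d2) (Num.min d3 (e1 / 2))).
  by rewrite !lt_min d10 d20 d30 divr_gt0.
move=> [s t]; set n := rnorm _; rewrite !lt_min => /andP[/andP[n1 n2] /andP[n3 n4]].
have sn : `|s| <= n by apply: (Re_le_rnorm (s +i* t)).
have tn : `|t| <= n by apply: (Im_le_rnorm (s +i* t)).
have := hd1 _ (le_lt_trans sn n1); have := hd2 _ (le_lt_trans tn n2).
have := hd3 _ (le_lt_trans tn n3).
rewrite !add0r expR0 cos0 sin0 oppr0 mul0r !mul1r !subr0.
set E := expR s; set c := cos t; set sn' := sin t => h3 h2 h1; rewrite addr0 in h3.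
have n0 : 0 <= n by exact: rnorm_ge0.
have E0 : 0 < E by exact: expR_gt0.
have E1 : `|E - 1| <= 2 * `|s|.
  rewrite -(subrK s (E - 1)); apply: le_trans (ler_normD _ _) _.
  by have := ler_wpM2r (normr_ge0 s) e11; move: h1; clear; lra.
have E2 : E <= 3.
  by have := ler_norm (E - 1); move: E1 sn n4 e11; clear; lra.
rewrite /cexp /= !expR0 !cos0 !sin0 -/E -/c -/sn'.
rewrite [_ *: 1]mulr1 (_ : _ - _ - _ = (E * c - 1 - s) +i* (E * sn' - t)); last first.
  by apply/eqP; rewrite eq_complex /=; apply/andP; split; apply/eqP; ring.
apply: le_trans (rnorm_le_ReIm _) _ => /=.
have -> : E * c - 1 - s = (E - 1 - s) + E * (c - 1) by ring.
have -> : E * sn' - t = E * (sn' - t) + t * (E - 1) by ring.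
have H1 : `|(E - 1 - s) + E * (c - 1)| <= e1 * n + 3 * (e1 * n).
  apply: le_trans (ler_normD _ _) _; apply: lerD.
    by apply: le_trans h1 _; rewrite ler_pM2l.
  rewrite normrM (gtr0_norm E0) ler_pM// ?(ltW E0)//.
  by apply: le_trans h2 _; rewrite ler_pM2l.
have H2 : `|E * (sn' - t) + t * (E - 1)| <= 3 * (e1 * n) + n * e1.
  apply: le_trans (ler_normD _ _) _; apply: lerD.
    rewrite normrM (gtr0_norm E0) ler_pM// ?(ltW E0)//.
    by apply: le_trans h3 _; rewrite ler_pM2l.
  rewrite normrM ler_pM//; apply: le_trans E1 _.
  by move: sn n4; clear; lra.
have := ler_wpM2r n0 e18; move: H1 H2; clear; lra.
Qed.

Lemma cdiff_cexp w : cdiff cexp w (cexp w).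
Proof.
move=> e e0; have K0 : 0 < rnorm (cexp w) + 1.
  by rewrite ltr_wpDl// rnorm_ge0.
have [d d0 hd] := cdiff_cexp0 (divr_gt0 e0 K0); exists d => // h /hd.
have c0 : cexp 0 = 1 :> C.
  by rewrite /cexp /= expR0 cos0 sin0 mulr1.
rewrite add0r c0 cexpD [h *: 1]mulr1 => hh.
have -> : cexp w * cexp h - cexp w - h *: cexp w =
  cexp w * (cexp h - 1 - h) by rewrite [h *: _](_ : _ = h * cexp w)//; ring.
rewrite rnormM; apply: le_trans (ler_wpM2l (rnorm_ge0 _) hh) _.
rewrite mulrA ler_wpM2r ?rnorm_ge0// mulrCA ler_piMr ?(ltW e0)//.
by rewrite ler_pdivrMr// mul1r lerDl.
Qed.

(** The Cauchy-Riemann equations say that the field [(Re G, - Im G)] has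
    divergence zero. *)
Lemma cdiff_pdiff (G : C -> C) (s t : R) l : cdiff G (s +i* t) l ->
  pdiff (fun x y => complex.Re (G (x +i* y))) s t (complex.Re l)
    (- complex.Im l) /\
  pdiff (fun x y => - complex.Im (G (x +i* y))) s t (- complex.Im l)
    (- complex.Re l).
Proof.
move=> Gl; split=> e e0; have [d d0 hd] := Gl e e0;
  exists (d / 2); rewrite ?divr_gt0// => x y xs yt;
  (have hn : rnorm ((x - s) +i* (y - t)) <= `|x - s| + `|y - t|
    by exact: rnorm_le_ReIm);
  have := hd ((x - s) +i* (y - t)) ltac:(move: hn xs yt; clear; lra);
  rewrite (_ : (s +i* t) + ((x - s) +i* (y - t)) = x +i* y);
  try (by apply/eqP; rewrite eq_complex /=; apply/andP; split; apply/eqP; ring);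
  move=> H; have {H} := le_trans H (ler_wpM2l (ltW e0) hn).
- apply: le_trans; apply: le_trans (Re_le_rnorm _).
  case: (G (x +i* y)) => [a b]; case: (G (s +i* t)) => a' b'.
  case: l {Gl hd} => p q /=.
  by rewrite le_eqVlt; apply/orP; left; apply/eqP; congr (`|_|); ring.
- apply: le_trans; apply: le_trans (Im_le_rnorm _); rewrite -normrN.
  case: (G (x +i* y)) => [a b]; case: (G (s +i* t)) => a' b'.
  case: l {Gl hd} => p q /=.
  by rewrite le_eqVlt; apply/orP; left; apply/eqP; congr (`|_|); ring.
Qed.

End ComplexExp.

(** * Means over circles *)

Section CircleMean.
Context {R : realType}.
Local Notation C := R[i].
Implicit Types (u v : C -> R) (r : R) (g : C -> C).

Lemma rnorm_cis (t : R) : rnorm (cos t +i* sin t) = 1.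
Proof.
have := rnorm_sqr (cos t +i* sin t); rewrite /= cos2Dsin2 => /eqP.
by rewrite sqrf_eq1 => /orP[/eqP//|/eqP E]; have := rnorm_ge0 (cos t +i* sin t); lra.
Qed.

Lemma rnorm_circle_point (a : C) r t : 0 <= r ->
  rnorm (circle_point a r t - a) = r.
Proof.
move=> r0; rewrite /circle_point addrAC subrr add0r rnormM.
by rewrite rnormc rnorm_cis mulr1 ger0_norm.
Qed.

Lemma rnorm_circle_point0 r t : 0 <= r -> rnorm (circle_point 0 r t : C) = r.
Proof. by move=> r0; rewrite -{2}(rnorm_circle_point 0 t r0) subr0. Qed.

Lemma circle_point_near (a : C) r t e : 0 < e -> exists2 d : R, 0 < d &
  forall r' t', `|r' - r| < d -> `|t' - t| < d ->
    rnorm (circle_point a r' t' - circle_point a r t) < e.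
Proof.
move=> e0; pose K := 2 * `|r| + 1.
have K0 : 0 < K by rewrite /K ltr_wpDl// mulr_ge0.
have e20 : 0 < e / 2 by rewrite divr_gt0.
have eK : 0 < e / 2 / K by rewrite divr_gt0.
have /cont_realP/(_ _ eK)[d1 d10 hd1] := @continuous_cos R t.
have /cont_realP/(_ _ eK)[d2 d20 hd2] := @continuous_sin R t.
exists (Num.min (e / 2) (Num.min d1 d2)); first by rewrite !lt_min e20 d10.
move=> r' t'; rewrite !lt_min => /andP[hr _] /and3P[_ /hd1{}hd1 /hd2{}hd2].
rewrite /circle_point opprD addrACA subrr add0r.
have -> : r'%:C * (cos t' +i* sin t') - r%:C * (cos t +i* sin t) =
  (r' - r)%:C * (cos t' +i* sin t') +
  r%:C * ((cos t' - cos t) +i* (sin t' - sin t)).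
  by apply/eqP; rewrite eq_complex /=; apply/andP; split; apply/eqP; ring.
apply: le_lt_trans (rnormD _ _) _.
rewrite !rnormM !rnormc rnorm_cis mulr1.
have h : rnorm ((cos t' - cos t) +i* (sin t' - sin t)) <= 2 * (e / 2 / K).
  apply: le_trans (rnorm_le_ReIm _) _ => /=.
  by move: hd1 hd2; clear; lra.
have h2 : `|r| * (2 * (e / 2 / K)) <= e / 2.
  have xK : e / 2 / K * K = e / 2 by rewrite divfK// gt_eqF.
  by move: xK eK; rewrite /K; clear; set x := e / 2 / _ => xK x0; lra.
have := ler_wpM2l (normr_ge0 r) h; move: h2 hr; clear; lra.
Qed.

Definition circle_cont r u :=
  forall z, rnorm z = r -> {for z, continuous u}.

Definition cmean r u : R :=
  (2 * pi)^-1 * rint 0 (2 * pi) (fun t => u (circle_point 0 r t)).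

Let pi2 : 0 < 2 * pi :> R.
Proof. by rewrite mulr_gt0// pi_gt0. Qed.

Let pi2_ge0 : 0 <= 2 * pi :> R := ltW pi2.

Lemma circle_cont_on a b r u : 0 <= r -> circle_cont r u ->
  cont_on a b (fun t => u (circle_point 0 r t)).
Proof.
move=> r0 cu t _; apply/cont_realP => e e0.
have /continuous_RP/(_ e e0)[d d0 hd] := cu _ (rnorm_circle_point0 t r0).
have [d' d'0 hd'] := circle_point_near 0 r t d0.
exists d' => // t' tt'; apply: hd; apply: hd' => //.
by rewrite subrr normr0.
Qed.

Lemma circle_contD r u v : circle_cont r u -> circle_cont r v ->
  circle_cont r (fun z => u z + v z).
Proof. by move=> cu cv z zr; exact: (continuousD (cu z zr) (cv z zr)). Qed.

Lemma circle_contM r u v : circle_cont r u -> circle_cont r v ->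
  circle_cont r (fun z => u z * v z).
Proof. by move=> cu cv z zr; exact: (continuousM (cu z zr) (cv z zr)). Qed.

Lemma circle_cont_cst r (c : R) : circle_cont r (fun=> c).
Proof. by move=> z _; exact: (@cst_continuous _ _ c z). Qed.

Lemma circle_cont_Re r g :
  (forall z, rnorm z = r -> {for z, continuous g}) ->
  circle_cont r (fun z => complex.Re (g z)).
Proof.
move=> cg z zr; apply/continuous_RP => e e0.
have /continuous_rnormP/(_ e e0)[d d0 hd] := cg z zr.
exists d => // y /hd; apply: le_lt_trans.
by case: (g y) (g z) => a b [a' b']; exact: (Re_le_rnorm ((a - a') +i* (b - b'))).
Qed.

Lemma cmeanD r u v : 0 <= r -> circle_cont r u -> circle_cont r v ->
  cmean r (fun z => u z + v z) = cmean r u + cmean r v.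
Proof.
by move=> r0 cu cv; rewrite /cmean rintD ?mulrDr//; exact: circle_cont_on.
Qed.

Lemma cmeanZ r c u : 0 <= r -> circle_cont r u ->
  cmean r (fun z => c * u z) = c * cmean r u.
Proof.
by move=> r0 cu; rewrite /cmean rintZ ?(mulrCA c)//; exact: circle_cont_on.
Qed.

Lemma cmean_cst r c : cmean r (fun=> c) = c.
Proof. by rewrite /cmean rint_cst// subr0 mulrCA mulVf ?mulr1// gt_eqF. Qed.

Lemma le_cmean r u v : 0 <= r -> circle_cont r u -> circle_cont r v ->
  (forall z, rnorm z = r -> u z <= v z) -> cmean r u <= cmean r v.
Proof.
move=> r0 cu cv uv; rewrite /cmean ler_pM2l ?invr_gt0//.
apply: le_rint; try exact: circle_cont_on.
by move=> t _; apply: uv; exact: rnorm_circle_point0.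
Qed.

Lemma eq_cmean r u v : 0 <= r -> (forall z, rnorm z = r -> u z = v z) ->
  cmean r u = cmean r v.
Proof.
move=> r0 uv; congr (_ * _); apply: eq_rint => t _.
by apply: uv; exact: rnorm_circle_point0.
Qed.

Lemma cmean_le r u (c : R) : 0 <= r -> circle_cont r u ->
  (forall z, rnorm z = r -> u z <= c) -> cmean r u <= c.
Proof.
move=> r0 cu uc; rewrite -(cmean_cst r c).
by apply: le_cmean => //; exact: circle_cont_cst.
Qed.

(** [boxflux_eq0] in logarithmic polar coordinates: the two radial sides of the
    box cancel by periodicity of the angle. *)
Lemma cmean_annulus r1 r2 g : 0 < r1 -> r1 <= r2 ->
  (forall z, r1 <= rnorm z <= r2 -> exists l, cdiff g z l) ->
  cmean r1 (fun z => complex.Re (g z)) = cmean r2 (fun z => complex.Re (g z)).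
Proof.
move=> r10 r12 dg; have r20 : 0 < r2 := lt_le_trans r10 r12.
pose P s t := complex.Re (g (cexp (s +i* t))).
pose Q s t := - complex.Im (g (cexp (s +i* t))).
have E (s t : R) : cexp (s +i* t) = circle_point 0 (expR s) t.
  by rewrite /circle_point add0r.
have ln12 : ln r1 <= ln r2 by rewrite ler_ln// posrE.
have := @boxflux_eq0 _ P Q _ _ _ _ ln12 pi2_ge0.
have -> : boxflux P Q (ln r1) (ln r2) 0 (2 * pi) =
  rint 0 (2 * pi) (P (ln r2)) - rint 0 (2 * pi) (P (ln r1)).
  have QE : Q ^~ (2 * pi) = Q ^~ 0.
    apply/funext => s; rewrite /Q !E /circle_point.
    by rewrite -[2 * pi]add0r mulr_natl cosD2pi sinD2pi.
  by rewrite /boxflux QE [X in _ + X]subrr addr0.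
have M r : 0 < r -> rint 0 (2 * pi) (P (ln r)) =
    2 * pi * cmean r (fun z => complex.Re (g z)).
  move=> r0; rewrite /cmean mulrA divff ?gt_eqF// mul1r.
  by apply: eq_rint => t _; rewrite /P E lnK// posrE.
rewrite !M// => H; apply/esym/(mulfI (lt0r_neq0 pi2))/eqP.
rewrite -subr_eq0 H// => s t /andP[s1 s2] _.
have [l hl] : exists l, cdiff g (cexp (s +i* t)) l.
  apply: dg; rewrite E rnorm_circle_point0 ?expR_ge0//.
  by rewrite -{1}(lnK r10) -(lnK r20) !ler_expR s1.
have := cdiff_pdiff (cdiff_comp hl (cdiff_cexp _)).
set m := _ *: _ => -[h1 h2].
by exists (complex.Re m), (- complex.Im m), (- complex.Im m); split.
Qed.

(** Uniform continuity in the angle comes from compactness of the period. *)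
Lemma cmean_near r u : 0 <= r -> circle_cont r u ->
  (exists2 d : R, 0 < d & forall r', 0 <= r' -> `|r' - r| < d ->
    circle_cont r' u) ->
  forall e, 0 < e -> exists2 d : R, 0 < d &
    forall r', 0 <= r' -> `|r' - r| < d -> `|cmean r' u - cmean r u| <= e.
Proof.
move=> r0 cu [d1 d10 hd1] e e0.
have /compact_near_coveringP/(_ R (nbhs r)
  (fun r' t => `|u (circle_point 0 r' t) - u (circle_point 0 r t)| < e)) :=
  @segment_compact _ (0 : R) (2 * pi).
case.
  move=> t _; have e20 : 0 < e / 2 by rewrite divr_gt0.
  have /continuous_RP/(_ _ e20)[d d0 hd] := cu _ (rnorm_circle_point0 t r0).
  have [d' d'0 hd'] := circle_point_near 0 r t d0.
  exists (ball t d', ball r d').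
    by split; apply: nbhsx_ballx.
  move=> [t' r'] [] /=; rewrite /ball /= => tt' rr'.
  rewrite distrC in tt'; rewrite distrC in rr'.
  have rr : `|r - r| < d' by rewrite subrr normr0.
  have h1 := hd (circle_point 0 r' t') (hd' _ _ rr' tt').
  have h2 := hd (circle_point 0 r t') (hd' _ _ rr tt').
  set A := u _ in h1 *; set B := u (circle_point 0 r t') in h2 *.
  rewrite (_ : A - B = A - u (circle_point 0 r t) - (B - u (circle_point 0 r t)));
    last by ring.
  apply: le_lt_trans (ler_normB _ _) _; move: h1 h2; clear; lra.
move=> d2 d20 hd2; exists (Num.min d1 d2); first by rewrite lt_min d10.
move=> r' r'0; rewrite lt_min => /andP[/(hd1 _ r'0) cr' rr'].
rewrite /cmean -mulrBr -rintB; try exact: circle_cont_on.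
rewrite normrM gtr0_norm ?invr_gt0// mulrC ler_pdivrMr//.
rewrite -[in leRHS](subr0 (2 * pi)); apply: norm_rint_le => //.
  by apply: cont_onB; exact: circle_cont_on.
move=> t ht; apply/ltW; apply: hd2; first by rewrite /ball /= distrC.
by rewrite /= in_itv.
Qed.

End CircleMean.

(** * Cauchy estimates *)

Section CauchyEstimates.
Context {R : realType}.
Local Notation C := R[i].
Implicit Types (f g : C -> C) (r : R).

Lemma eq_of_dist_le (x y : R) : (forall e, 0 < e -> `|x - y| <= e) -> x = y.
Proof.
move=> h; apply/eqP; rewrite -subr_eq0 -normr_eq0 eq_le normr_ge0 andbT.
by apply/ler_addgt0Pr => e e0; rewrite add0r; exact: h.
Qed.

(** The point [0] is exceptional because logarithmic polar coordinates miss it,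
    and [a] because a difference quotient at [a] is only known to be continuous
    there. The mean is constant on each of the annuli that avoid the radius of
    [a] by [cmean_annulus], and [cmean_near] joins them. *)
Lemma cmean_value rho a g :
  (forall z, rnorm z < rho -> {for z, continuous g}) ->
  (forall z, rnorm z < rho -> z != 0 -> z != a -> exists l, cdiff g z l) ->
  forall r, 0 <= r < rho ->
  cmean r (fun z => complex.Re (g z)) = complex.Re (g 0).
Proof.
move=> cg dg r rI; pose M r := cmean r (fun z => complex.Re (g z)).
pose c := rnorm a; have c0 : 0 <= c by exact: rnorm_ge0.
have ccont r' : r' < rho -> circle_cont r' (fun z => complex.Re (g z)).
  by move=> r'rho; apply: circle_cont_Re => z zr; apply: cg; rewrite zr.
have near r' e : 0 <= r' < rho -> 0 < e -> exists2 d : R, 0 < d &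
    forall r'', 0 <= r'' -> `|r'' - r'| < d -> `|M r'' - M r'| <= e.
  move=> /andP[r'0 r'rho] e0; apply: cmean_near => //; first exact: ccont.
  exists (rho - r'); first by rewrite subr_gt0.
  move=> r'' r''0 /ltr_normlP[_ h]; apply: ccont.
  by move: h; clear; lra.
have M0 : M 0 = complex.Re (g 0).
  rewrite -[RHS](cmean_cst 0); apply: eq_cmean => // z /rnorm0_eq0 -> //.
have ann r1 r2 : 0 < r1 -> r1 <= r2 -> r2 < rho -> (r2 < c \/ c < r1) ->
    M r1 = M r2.
  move=> r10 r12 r2rho h; apply: cmean_annulus => // z /andP[z1 z2].
  have z0 : 0 < rnorm z := lt_le_trans r10 z1.
  apply: dg; first exact: le_lt_trans r2rho.
    by rewrite -rnorm_gt0.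
  apply/eqP => za; case: h; rewrite /c -za.
    by rewrite ltNge z2.
  by rewrite ltNge z1.
have inner r' : 0 < r' -> r' < c -> r' < rho -> M r' = M 0.
  move=> r'0 r'c r'rho; apply: eq_of_dist_le => e e0.
  have rho0 : 0 <= (0 : R) < rho by rewrite lexx (lt_trans r'0).
  have [d d0 hd] := near 0 e rho0 e0.
  pose s := Num.min r' (d / 2).
  have s0 : 0 < s by rewrite lt_min r'0 divr_gt0.
  have sd : s < d.
    by apply: le_lt_trans (_ : d / 2 < d); [rewrite ge_min lexx orbT|lra].
  rewrite -(@ann s r')//; last by left.
    by apply: hd; rewrite ?(ltW s0)// subr0 gtr0_norm.
  by rewrite ge_min lexx.
have Mc : c < rho -> M c = M 0.
  move=> crho; move: c0; rewrite le_eqVlt => /predU1P[<-//|c0'].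
  apply: eq_of_dist_le => e e0.
  have cI : 0 <= c < rho by rewrite (ltW c0').
  have [d d0 hd] := near c e cI e0.
  pose s := Num.max (c - d / 2) (c / 2).
  have s0 : 0 < s by rewrite lt_max (divr_gt0 c0')// orbT.
  have sc : s < c by rewrite gt_max; apply/andP; split; move: c0' d0; clear; lra.
  have sd : c - d < s.
    by apply: lt_le_trans (_ : c - d / 2 <= s); [lra|rewrite le_max lexx].
  rewrite -(inner s)// ?(lt_trans sc)// distrC; apply: hd; rewrite ?(ltW s0)//.
  by rewrite ler0_norm; move: sc sd; clear; lra.
rewrite -M0 -/(M r); case/andP: rI => r0 rrho.
move: r0; rewrite le_eqVlt => /predU1P[<-//|r0].
have [rc|] := ltP r c; first exact: inner.
rewrite le_eqVlt => /predU1P[cr|cr]; first by rewrite -cr Mc// cr.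
have crho := lt_trans cr rrho; rewrite -Mc//.
apply: eq_of_dist_le => e e0.
have cI : 0 <= c < rho by rewrite c0.
have [d d0 hd] := near c e cI e0.
pose s := Num.min r (c + d / 2).
have cs : c < s by rewrite lt_min cr; move: d0; clear; lra.
have sd : s < c + d.
  by apply: le_lt_trans (_ : c + d / 2 < c + d); [rewrite ge_min lexx orbT|lra].
rewrite -(@ann s r)//; last by right.
- by apply: hd; rewrite ?(le_trans c0 (ltW cs))// ltr_norml; move: cs sd; clear => *;
    apply/andP; split; lra.
- exact: le_lt_trans cs.
- by rewrite ge_min lexx.
Qed.

(** [l] is meant to be the derivative of [f] at [a], which removes the
    singularity. *)
Definition dquot f a l z : C := if z == a then l else (f z - f a) / (z - a).

Lemma dquot_continuous f a l : cdiff f a l ->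
  {for a, continuous (dquot f a l)}.
Proof.
move=> fa; apply/continuous_rnormP => e e0.
have e20 : 0 < e / 2 by rewrite divr_gt0.
have [d d0 hd] := fa _ e20; exists d => // z za.
rewrite /dquot eqxx; case: eqVneq => [_|na]; first by rewrite subrr rnorm0.
have := hd _ za; rewrite (addrC a) subrK => h.
have za0 : z - a != 0 by rewrite subr_eq0.
have -> : (f z - f a) / (z - a) - l = (f z - f a - (z - a) *: l) / (z - a).
  by rewrite [_ *: l](_ : _ = (z - a) * l)//; field.
rewrite rnormM rnormV ltr_pdivrMr ?rnorm_gt0//; apply: le_lt_trans h _.
by rewrite ltr_pM2r ?rnorm_gt0//; move: e0; clear; lra.
Qed.

Lemma dquot_cdiff f a l z m : z != a -> cdiff f z m ->
  exists m', cdiff (dquot f a l) z m'.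
Proof.
move=> za fz; have za0 : z - a != 0 by rewrite subr_eq0.
have d1 : cdiff (fun w => f w - f a) z (m + 0) := cdiffD fz (cdiff_cst _ _).
have d2 : cdiff (fun w : C => w - a) z (1 + 0) :=
  cdiffD (@cdiff_id R z) (cdiff_cst _ _).
have d3 := cdiffM d1 (cdiffV d2 za0).
set m' := (X in cdiff _ _ X) in d3; exists m'.
apply: (@cdiff_near _ _ _ _ _ _ (rnorm (z - a)) _ _ d3).
  by rewrite rnorm_gt0; exact: za0.
move=> w wz; rewrite /dquot; case: eqVneq => // wa.
by move: wz; rewrite wa rnorm_distC ltxx.
Qed.

Lemma continuous_scale f (c : C) z : {for z, continuous f} ->
  {for z, continuous (fun w => c * f w)}.
Proof.
move=> /continuous_rnormP fz; apply/continuous_rnormP => e e0.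
have K0 : 0 < rnorm c + 1 by rewrite ltr_wpDl// rnorm_ge0.
have [d d0 hd] := fz _ (divr_gt0 e0 K0); exists d => // y /hd.
rewrite ltr_pdivlMr// -mulrBr rnormM; apply: le_lt_trans.
by rewrite mulrC ler_wpM2l ?rnorm_ge0// lerDl.
Qed.

(** On the circle, [z / (z - a)] is the conjugate of a function holomorphic in
    the closed disc. *)
Lemma cmean_kernel (a c : C) r : rnorm a < r ->
  cmean r (fun z => complex.Re (c * (z / (z - a)))) = complex.Re c.
Proof.
move=> ar; have a0 := rnorm_ge0 a; have r0 : 0 < r := le_lt_trans a0 ar.
pose b : C := a^* / (r ^+ 2)%:C.
have r2 : (r ^+ 2)%:C != 0 :> C.
  by rewrite -rnorm_gt0 rnormc normr_gt0 gt_eqF// exprn_gt0.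
have nb : rnorm b = rnorm a / r ^+ 2.
  by rewrite rnormM rnormV rnormc rnormJ ger0_norm// sqr_ge0.
pose k (z : C) : C := c^* * (1 - b * z)^-1.
have K0 : 0 < rnorm a + r by rewrite ltr_wpDl.
pose rho := 2 * r ^+ 2 / (rnorm a + r).
have rrho : r < rho.
  by rewrite ltr_pdivlMr// expr2; move: ar r0; clear; nra.
have nz z : rnorm z < rho -> 1 - b * z != 0.
  move=> zrho; rewrite subr_eq0 eq_sym -subr_eq0 -rnorm_gt0.
  have : rnorm (b * z) < 1.
    rewrite rnormM nb mulrAC ltr_pdivrMr ?exprn_gt0// mul1r.
    have : rnorm z * (rnorm a + r) < 2 * r ^+ 2 by rewrite -ltr_pdivlMr.
    have := rnorm_ge0 z; move: zrho ar r0 a0; clear; rewrite expr2; nra.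
  have := rnorm_sub_ge (1 : C) (b * z); rewrite rnorm1 rnorm_distC.
  by move=> h1 h2; lra.
have dk z : rnorm z < rho -> exists l, cdiff k z l.
  move=> zrho.
  have d1 : cdiff (fun w => 1 - b * w) z (0 + (0 * (z : C) + - b * 1)).
    rewrite (_ : (fun w => 1 - b * w) = (fun w => 1 + - b * w)); last first.
      by apply/funext => w; rewrite mulNr.
    by apply: (cdiffD (cdiff_cst _ _)); apply: (cdiffM (cdiff_cst _ _)); exact: cdiff_id.
  have d2 := cdiffM (@cdiff_cst R _ c^* z) (cdiffV d1 (nz _ zrho)).
  by eexists; exact: d2.
rewrite (_ : cmean _ _ = cmean r (fun z => complex.Re (k z))).
  rewrite (@cmean_value rho 0 k) ?rrho ?(ltW r0)//.
  - by rewrite /k mulr0 subr0 invr1 mulr1; case: (c).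
  - by move=> z /dk[l hl]; exact: cdiff_continuous hl.
  - by move=> z /dk.
apply: eq_cmean => [|z zr]; first exact: ltW.
have Re_conj (x : C) : complex.Re (x^*) = complex.Re x by case: x.
rewrite -[RHS]Re_conj; congr complex.Re.
rewrite /k rmorphM /= conjcK; congr (c * _).
have bE : b = (r ^- 2)%:C * a^* by rewrite /b fmorphV mulrC.
rewrite conjc_inv (_ : (1 - b * z)^* = 1 - a / (r ^+ 2)%:C * z^*); last first.
  rewrite bE -fmorphV; case: (a) (z) => x y [x' y'].
  by apply/eqP; rewrite eq_complex /=; apply/andP; split; apply/eqP; ring.
have zz := mulcJ z; rewrite zr in zz.
have z0 : z != 0 by rewrite -rnorm_gt0 zr.
have za : z - a != 0.
  by rewrite subr_eq0; apply/eqP => E; move: ar; rewrite -E zr ltxx.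
have zJ : z^* != 0 by rewrite conjc_eq0.
rewrite -[LHS]invf_div; congr (_^-1).
by rewrite -zz invfM mulrA mulfVK// mulrBl divff.
Qed.

(** Cauchy's formula for the second order Taylor remainder, tested against a
    constant [c] since only means of real parts occur: the kernel is
    [z / (z - a) - 1 - a / z = a ^+ 2 / (z * (z - a))]. *)
Lemma cmean_remainder f l (a c : C) r : 0 < r < 1 -> rnorm a < r ->
  (forall z, rnorm z < 1 -> exists m, cdiff f z m) -> cdiff f 0 l ->
  complex.Re (c * (f a - f 0 - a * l)) =
  cmean r (fun z => complex.Re (c * ((f z - f 0) * (a ^+ 2 / (z * (z - a)))))).
Proof.
move=> /andP[r0 r1] ar df f0.
have rI : 0 <= r < 1 by rewrite (ltW r0).
have [m fa] := df a (lt_trans ar r1).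
have cf z : rnorm z < 1 -> {for z, continuous f}.
  by move=> /df[k]; exact: cdiff_continuous.
have cdq b k : cdiff f b k -> forall z, rnorm z < 1 ->
    {for z, continuous (dquot f b k)}.
  move=> fb z z1; have [->|zb] := eqVneq z b; first exact: dquot_continuous.
  have [k' fz] := df z z1; have [k'' dz] := dquot_cdiff k zb fz.
  exact: cdiff_continuous dz.
have ddq b k : cdiff f b k -> forall z, rnorm z < 1 -> z != b ->
    exists k', cdiff (dquot f b k) z k'.
  by move=> fb z /df[k' fz] zb; exact: dquot_cdiff fz.
pose g1 z : C := c * (z * dquot f a m z).
pose g2 z : C := (- (c * a)) * dquot f 0 l z.
pose g3 z : C := (- c) * (f z + - f 0).
pose g4 z : C := c * (f a - f 0) * (z / (z - a)).
have cg1 z : rnorm z < 1 -> {for z, continuous g1}.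
  move=> z1; apply: continuous_scale.
  rewrite (_ : (fun w => w * dquot f a m w) =
    (fun w => f w + - f a + a * dquot f a m w)); last first.
    apply/funext => w; rewrite /dquot; case: eqVneq => [->|wa].
      by rewrite subrr add0r.
    have wa0 : w - a != 0 by rewrite subr_eq0.
    by field.
  apply: (@continuousD); last by apply: continuous_scale; exact: cdq.
  by apply: (@continuousD); [exact: cf|exact: cst_continuous].
have dg1 z : rnorm z < 1 -> z != 0 -> z != a -> exists k, cdiff g1 z k.
  move=> z1 z0 za; have [k' hk] := ddq a m fa z z1 za.
  by eexists; apply: (cdiffM (cdiff_cst _ _) (cdiffM (cdiff_id _) hk)).
have cg2 z : rnorm z < 1 -> {for z, continuous g2}.
  by move=> z1; apply: continuous_scale; exact: cdq.
have dg2 z : rnorm z < 1 -> z != 0 -> z != 0 -> exists k, cdiff g2 z k.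
  move=> z1 z0 _; have [k' hk] := ddq 0 l f0 z z1 z0.
  by eexists; apply: (cdiffM (cdiff_cst _ _) hk).
have dg3 z : rnorm z < 1 -> exists k, cdiff g3 z k.
  move=> /df[k fz]; eexists.
  by apply: (cdiffM (cdiff_cst _ _) (cdiffD fz (cdiff_cst _ _))).
have cg3 z : rnorm z < 1 -> {for z, continuous g3}.
  by move=> /dg3[k]; exact: cdiff_continuous.
have M1 := cmean_value cg1 dg1 rI; have M2 := cmean_value cg2 dg2 rI.
have M3 := @cmean_value 1 0 g3 cg3 (fun z z1 _ _ => dg3 z z1) r rI.
have M4 := cmean_kernel (c * (f a - f 0)) ar.
have ccont g : (forall z, rnorm z < 1 -> {for z, continuous g}) ->
    circle_cont r (fun z => complex.Re (g z)).
  by move=> cg; apply: circle_cont_Re => z zr; apply: cg; rewrite zr.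
have c4 : circle_cont r (fun z => complex.Re (g4 z)).
  apply: circle_cont_Re => z zr; apply: continuous_scale.
  have za : z - a != 0.
    by rewrite subr_eq0; apply/eqP => E; move: ar; rewrite -E zr ltxx.
  have d1 : cdiff (fun w : C => w + - a) z (1 + 0) :=
    cdiffD (@cdiff_id R z) (cdiff_cst _ _).
  exact: (cdiff_continuous (cdiffM (cdiff_id z) (cdiffV d1 za))).
transitivity (cmean r (fun z => complex.Re (g1 z) + complex.Re (g2 z) +
   (complex.Re (g3 z) + complex.Re (g4 z)))).
  rewrite !cmeanD ?(ltW r0)//; try exact: ccont;
    try (by apply: circle_contD; rewrite //; exact: ccont).
  rewrite M1 M2 M3 M4 /g1 /g2 /g3 /dquot eqxx subrr mulr0 mul0r mulr0 add0r.
  rewrite [complex.Re 0]/= add0r -raddfD /=; congr complex.Re; ring.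
apply: eq_cmean => [|z zr]; first exact: ltW.
have z0 : z != 0 by rewrite -rnorm_gt0 zr.
have za : z != a by apply/eqP => E; move: ar; rewrite -E zr ltxx.
have za0 : z - a != 0 by rewrite subr_eq0.
rewrite -!raddfD /=; congr complex.Re; rewrite /g1 /g2 /g3 /g4 /dquot.
by rewrite (negPf za) (negPf z0) subr0; field; rewrite z0 za0.
Qed.

(** Testing the remainder against its own conjugate turns its real part into its
    squared modulus. *)
Lemma taylor2_le f l (M : R) a :
  (forall z, rnorm z < 1 -> exists m, cdiff f z m) -> cdiff f 0 l ->
  (forall z, rnorm z < 1 -> rnorm (f z) <= M) -> rnorm a <= 4^-1 ->
  rnorm (f a - f 0 - a * l) <= 16 * M * rnorm a ^+ 2.
Proof.
move=> df f0 fM a4; set X := f a - f 0 - a * l.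
have M0 : 0 <= M.
  by apply: le_trans (fM 0 _); rewrite ?rnorm_ge0// rnorm0.
have a0 := rnorm_ge0 a.
have [->|X0] := eqVneq X 0; first by rewrite rnorm0 !mulr_ge0// sqr_ge0.
have XX : complex.Re (X^* * X) = rnorm X ^+ 2 by rewrite mulrC mulcJ.
have hr : 0 < (2^-1 : R) < 1 by apply/andP; split; lra.
have ar : rnorm a < 2^-1 by lra.
rewrite -(ler_pM2l (_ : 0 < rnorm X)) ?rnorm_gt0// -expr2 -XX.
rewrite (cmean_remainder _ hr ar df f0).
have zfacts z : rnorm z = 2^-1 -> [/\ z != 0, z - a != 0 & 4^-1 <= rnorm (z - a)].
  move=> zr; have z4 : 4^-1 <= rnorm (z - a).
    by have := rnorm_sub_ge z a; rewrite zr; move: a4; clear; lra.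
  split=> //; rewrite -rnorm_gt0; first by rewrite zr; lra.
  by apply: lt_le_trans z4; lra.
apply: cmean_le.
- by lra.
- apply: circle_cont_Re => z zr; have [z0 za _] := zfacts z zr.
  have [m fz] : exists m, cdiff f z m by apply: df; rewrite zr; lra.
  have d1 : cdiff (fun w : C => w + - a) z (1 + 0) :=
    cdiffD (@cdiff_id R z) (cdiff_cst _ _).
  have d2 := cdiffV (cdiffM (cdiff_id z) d1) (mulf_neq0 z0 za).
  exact: (cdiff_continuous (cdiffM (cdiff_cst _ _)
    (cdiffM (cdiffD fz (cdiff_cst _ _)) (cdiffM (cdiff_cst _ _) d2)))).
- move=> z zr; have [z0 za z4] := zfacts z zr.
  apply: le_trans (ler_norm _) _; apply: le_trans (Re_le_rnorm _) _.
  rewrite rnormM rnormJ ler_wpM2l ?rnorm_ge0// (rnormM (f z - f 0)).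
  rewrite (rnormM (a ^+ 2)) rnormV (rnormM z) rnormX zr.
  have h1 : rnorm (f z - f 0) <= 2 * M.
    have h2 := fM z ltac:(by rewrite zr; lra).
    have h3 := fM 0 ltac:(by rewrite rnorm0).
    by have := rnormB (f z) (f 0); move: h2 h3; clear; lra.
  rewrite mulrA ler_pdivrMr; last by rewrite mulr_gt0//; lra.
  have A0 := sqr_ge0 (rnorm a).
  apply: le_trans (ler_wpM2r A0 h1) _.
  have MA : 0 <= M * rnorm a ^+ 2 by rewrite mulr_ge0.
  have := ler_wpM2l MA z4; move: MA; clear; set x := M * _.
  move=> x0 h; rewrite (_ : 2 * M * rnorm a ^+ 2 = 2 * x); last by rewrite /x; ring.
  by rewrite (_ : 16 * M * rnorm a ^+ 2 * _ = 8 * (x * rnorm (z - a)));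
    [lra | rewrite /x; field].
Qed.

Lemma conj_symmetrize (c w w0 z : C) :
  complex.Re (c * ((w - w0) * z^*)) +
    (complex.Re (c^* * (z * w)) + complex.Re ((c * w0)^* * z)) =
  2 * complex.Re w * complex.Re (c * z^*).
Proof. by case: c w w0 z => ? ? [? ?] [? ?] [? ?] /=; ring. Qed.

(** With [h = m - g], the mean of [2 * Re h * Re (c * conj z)] is
    [r ^+ 2 * Re (c * h'(0))] because [z * h] has mean zero. Since [Re h] is
    nonnegative on the circle, that mean is at most [2 * rnorm c * r * Re (h 0)];
    take [c] conjugate to [h'(0)]. *)
Lemma borel_caratheodory g l (m : R) r : 0 < r < 1 ->
  (forall z, rnorm z < 1 -> exists k, cdiff g z k) -> cdiff g 0 l ->
  (forall z, rnorm z = r -> complex.Re (g z) <= m) ->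
  rnorm l * r <= 2 * (m - complex.Re (g 0)).
Proof.
move=> /andP[r0 r1] dg g0 gm; have r0' := ltW r0.
have rI : 0 <= r < 1 by rewrite r0'.
pose h z : C := m%:C + - 1 * g z.
have dh z : rnorm z < 1 -> exists k, cdiff h z k.
  move=> /dg[k gk]; eexists.
  exact: (cdiffD (cdiff_cst _ _) (cdiffM (cdiff_cst _ _) gk)).
have h0 : cdiff h 0 (- l).
  have := cdiffD (@cdiff_cst R C m%:C 0) (cdiffM (@cdiff_cst R C (- 1) 0) g0).
  by rewrite mul0r !add0r mulN1r.
have hE z : complex.Re (h z) = m - complex.Re (g z).
  by rewrite /h mulN1r; case: (g z).
rewrite -hE.
have ch z : rnorm z < 1 -> {for z, continuous h}.
  by move=> /dh[k]; exact: cdiff_continuous.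
have ccont k : (forall z, rnorm z < 1 -> {for z, continuous k}) ->
    circle_cont r (fun z => complex.Re (k z)).
  by move=> ck; apply: circle_cont_Re => z zr; apply: ck; rewrite zr.
have Mh := @cmean_value 1 0 h ch (fun z z1 _ _ => dh z z1) r rI.
have hpos z : rnorm z = r -> 0 <= complex.Re (h z).
  by move=> /gm; rewrite hE subr_ge0.
have h0pos : 0 <= complex.Re (h 0).
  rewrite -Mh -(cmean_cst r 0); apply: le_cmean => //; last exact: ccont.
  exact: circle_cont_cst.
have [->|l0] := eqVneq l 0; first by rewrite rnorm0 mul0r mulr_ge0.
pose c : C := (- l)^*.
pose g1 z : C := c * dquot h 0 (- l) z.
pose g2 z : C := c^* * (z * h z).
pose g3 z : C := (c * h 0)^* * z.
have cg1 z : rnorm z < 1 -> {for z, continuous g1}.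
  move=> z1; apply: continuous_scale.
  have [->|zb] := eqVneq z 0; first exact: dquot_continuous.
  have [k hz] := dh z z1; have [k' dz] := dquot_cdiff (- l) zb hz.
  exact: cdiff_continuous dz.
have dg1 z : rnorm z < 1 -> z != 0 -> z != 0 -> exists k, cdiff g1 z k.
  move=> z1 z0 _; have [k hz] := dh z z1; have [k' dz] := dquot_cdiff (- l) z0 hz.
  by eexists; apply: (cdiffM (cdiff_cst _ _) dz).
have dg2 z : rnorm z < 1 -> exists k, cdiff g2 z k.
  move=> /dh[k hz]; eexists.
  exact: (cdiffM (cdiff_cst _ _) (cdiffM (cdiff_id _) hz)).
have dg3 z : rnorm z < 1 -> exists k, cdiff g3 z k.
  by move=> _; eexists; exact: (cdiffM (cdiff_cst _ _) (cdiff_id _)).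
have cg2 z : rnorm z < 1 -> {for z, continuous g2}.
  by move=> /dg2[k]; exact: cdiff_continuous.
have cg3 z : rnorm z < 1 -> {for z, continuous g3}.
  by move=> /dg3[k]; exact: cdiff_continuous.
have M1 := cmean_value cg1 dg1 rI.
have M2 := @cmean_value 1 0 g2 cg2 (fun z z1 _ _ => dg2 z z1) r rI.
have M3 := @cmean_value 1 0 g3 cg3 (fun z z1 _ _ => dg3 z z1) r rI.
have c1 := ccont _ cg1; have c2 := ccont _ cg2; have c3 := ccont _ cg3.
have chh := ccont _ ch.
have c1' : circle_cont r (fun z => r ^+ 2 * complex.Re (g1 z)).
  by apply: circle_contM => //; exact: circle_cont_cst.
have c4 : circle_cont r (fun z => 2 * rnorm l * r * complex.Re (h z)).
  by apply: circle_contM => //; exact: circle_cont_cst.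
have lp : 0 < rnorm l by rewrite rnorm_gt0.
have key : r ^+ 2 * rnorm l ^+ 2 <= 2 * rnorm l * r * complex.Re (h 0).
  have -> : r ^+ 2 * rnorm l ^+ 2 = cmean r (fun z =>
      r ^+ 2 * complex.Re (g1 z) + (complex.Re (g2 z) + complex.Re (g3 z))).
    rewrite !cmeanD//; last exact: circle_contD.
    rewrite cmeanZ// M1 M2 M3 /g1 /g2 /g3 /dquot eqxx mul0r !mulr0 /= !addr0.
    by congr (_ * _); rewrite /c mulrC mulcJ rnormN.
  rewrite -Mh -cmeanZ//; apply: le_cmean => //.
    by apply: circle_contD => //; exact: circle_contD.
  move=> z zr; have z0 : z != 0 by rewrite -rnorm_gt0 zr.
  have zz := mulcJ z; rewrite zr in zz.
  have -> : r ^+ 2 * complex.Re (g1 z) = complex.Re (c * ((h z - h 0) * z^*)).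
    have -> : c * ((h z - h 0) * z^*) = (r ^+ 2)%:C * g1 z.
      by rewrite /g1 /dquot (negPf z0) subr0 -zz; field.
    by case: (g1 z) => x y; rewrite /= mul0r subr0.
  have -> : complex.Re (c * ((h z - h 0) * z^*)) +
      (complex.Re (g2 z) + complex.Re (g3 z)) =
      2 * complex.Re (h z) * complex.Re (c * z^*).
    exact: conj_symmetrize.
  have hz := hpos z zr.
  have : complex.Re (c * z^*) <= rnorm l * r.
    apply: le_trans (ler_norm _) _; apply: le_trans (Re_le_rnorm _) _.
    by rewrite rnormM /c !rnormJ rnormN zr.
  move=> /(ler_wpM2l hz); move: hz; clear.
  set X := complex.Re (h z); set Y := complex.Re _; set Z := rnorm l * r.
  move=> X0 XY; rewrite (_ : 2 * rnorm l * r * X = 2 * (X * Z)); last by rewrite /Z; ring.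
  by rewrite -mulrA ler_wpM2l.
rewrite -(ler_pM2l (mulr_gt0 lp r0)).
by move: key; clear; set X := complex.Re (h 0) => k; lra.
Qed.

End CauchyEstimates.

(** * Harmonic approximation on the circle *)

Section HerglotzKernel.
Context {R : realType}.
Local Notation C := R[i].
Implicit Types (w z x : C) (W : C -> R).

Lemma complexM_real (a : R) z : a%:C * z = (a * complex.Re z) +i* (a * complex.Im z).
Proof.
by case: z => x y; apply/eqP; rewrite eq_complex /=; apply/andP; split; apply/eqP;
  ring.
Qed.

(** The partial sums [1 + 2 x + ... + 2 x ^ T] of [(1 + x) / (1 - x)]: unlike the
    full kernel they are polynomials, so that the smoothed functions are entire. *)
Fixpoint herglotz T x : C :=
  if T is T'.+1 then herglotz T' x + 2%:R * x ^+ T'.+1 else 1.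

Lemma herglotzE T x : (1 - x) * herglotz T x = 1 + x - 2%:R * x ^+ T.+1.
Proof.
elim: T => [|T IH] /=; first by ring.
by rewrite mulrDr IH [x ^+ T.+2]exprS; ring.
Qed.

Lemma herglotz0 T : herglotz T 0 = 1.
Proof. by elim: T => //= T ->; rewrite exprS mul0r mulr0 addr0. Qed.

(** Up to the tail of the geometric series, the real part is the Poisson kernel. *)
Lemma Re_herglotz T x : rnorm x < 1 ->
  `|complex.Re (herglotz T x) - (1 - rnorm x ^+ 2) / rnorm (1 - x) ^+ 2| <=
    2 * rnorm x ^+ T.+1 / (1 - rnorm x).
Proof.
move=> x1; have nx := rnorm_sub_ge (1 : C) x; rewrite rnorm1 in nx.
have n0 : 0 < rnorm (1 - x) by apply: lt_le_trans nx; rewrite subr_gt0.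
have x0 : 1 - x != 0 by rewrite -rnorm_gt0.
have -> : herglotz T x = (1 + x) / (1 - x) - 2%:R * x ^+ T.+1 / (1 - x).
  by apply: (mulfI x0); rewrite herglotzE; field.
have -> : complex.Re ((1 + x) / (1 - x) - 2%:R * x ^+ T.+1 / (1 - x)) =
   (1 - rnorm x ^+ 2) / rnorm (1 - x) ^+ 2 -
   complex.Re (2%:R * x ^+ T.+1 / (1 - x)).
  rewrite raddfB /=; congr (_ - _).
  have cx0 : (1 - x)^* != 0 by rewrite conjc_eq0.
  have -> : (1 + x) / (1 - x) = (rnorm (1 - x) ^- 2)%:C * ((1 + x) * (1 - x)^*).
    have zz := mulcJ (1 - x).
    have -> : (rnorm (1 - x) ^- 2)%:C = ((1 - x) * (1 - x)^*)^-1.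
      by rewrite zz fmorphV.
    by rewrite invfM mulrCA -!mulrA mulVf// mulr1.
  rewrite complexM_real /= mulrC; congr (_ / _); rewrite rnorm_sqr.
  by case: (x) => a b /=; ring.
rewrite addrAC subrr add0r normrN; apply: le_trans (Re_le_rnorm _) _.
rewrite !rnormM rnormV rnormX.
have -> : rnorm (2%:R : C) = 2.
  by rewrite (_ : 2%:R = (2 : R)%:C) ?rnormc ?ger0_norm// rmorph_nat.
apply: ler_pM => //; rewrite ?invr_ge0 ?rnorm_ge0//.
  by rewrite mulr_ge0// exprn_ge0// rnorm_ge0.
by rewrite lef_pV2// posrE subr_gt0.
Qed.

(** The kernel [herglotz T (s * w)] is an approximate identity on the unit
    circle as [s] tends to 1, once the truncation [T] is large enough. *)
Lemma herglotz_bounds (d e : R) : 0 < d -> 0 < e -> exists s T, [/\ 0 < s < 1,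
  forall w, rnorm w = 1 -> - e <= complex.Re (herglotz T (s%:C * w)) &
  forall w, rnorm w = 1 -> d <= rnorm (1 - w) ->
    complex.Re (herglotz T (s%:C * w)) <= e].
Proof.
move=> d0 e0; pose q := Num.min 2^-1 (e * d ^+ 2 / 16).
have q0 : 0 < q.
  by rewrite lt_min invr_gt0 ltr0n /= divr_gt0// mulr_gt0// exprn_gt0.
have q12 : q <= 2^-1 by rewrite ge_min lexx.
have qe : 16 * q <= e * d ^+ 2.
  by rewrite mulrC -ler_pdivlMr// ge_min lexx orbT.
pose s := 1 - q.
have s01 : 0 < s < 1 by rewrite /s; apply/andP; split; move: q0 q12; clear; lra.
case/andP: (s01) => s0 s1.
have [T hT] : exists T : nat, 2 * s ^+ T.+1 / (1 - s) <= e / 2.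
  have m0 : 0 < e / 2 * (1 - s) / 2.
    by rewrite divr_gt0// mulr_gt0// ?subr_gt0// divr_gt0.
  have : (fun k => s ^+ k) @ \oo --> (0 : R).
    by apply: cvg_expr; rewrite ger0_norm// ltW.
  move=> /cvgrPdist_lt/(_ _ m0)[T _ /(_ T.+1 (leqnSn T))] /=.
  rewrite sub0r normrN ger0_norm ?exprn_ge0 ?(ltW s0)// => h.
  by exists T; rewrite ler_pdivrMr ?subr_gt0//; move: h; clear; lra.
exists s, T; split=> // [w w1|w w1 dw].
  have nx : rnorm (s%:C * w) = s by rewrite rnormM w1 mulr1 rnormc gtr0_norm.
  have := @Re_herglotz T (s%:C * w); rewrite nx => /(_ s1).
  set A := _ / _ in hT *; set B := (1 - s ^+ 2) / _.
  have B0 : 0 <= B.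
    by rewrite divr_ge0 ?sqr_ge0// subr_ge0 expr_le1 ?(ltW s0) ?(ltW s1).
  by rewrite ler_norml => /andP[h _]; move: h B0 hT e0; clear; lra.
have nx : rnorm (s%:C * w) = s by rewrite rnormM w1 mulr1 rnormc gtr0_norm.
have := @Re_herglotz T (s%:C * w); rewrite nx => /(_ s1).
set A := _ / _ in hT *; set B := (1 - s ^+ 2) / _.
suff B1 : B <= e / 2.
  by rewrite ler_norml => /andP[_ h]; move: h B1 hT; clear; lra.
have h1 : 1 - s <= rnorm (1 - s%:C * w).
  by have := rnorm_sub_ge (1 : C) (s%:C * w); rewrite rnorm1 nx.
have h2 : rnorm (1 - w) <= rnorm (1 - s%:C * w) + (1 - s).
  apply: le_trans (rnorm_triangle (s%:C * w) _ _) _; rewrite lerD2l.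
  rewrite -[X in _ - X]mul1r -mulrBl rnormM w1 mulr1.
  rewrite rnorm_distC -(rmorph1 (real_complex R)) -rmorphB rnormc ger0_norm//.
  by rewrite subr_ge0 ltW.
have n0 : 0 < rnorm (1 - s%:C * w) by apply: lt_le_trans h1; rewrite subr_gt0.
rewrite ler_pdivrMr ?exprn_gt0//.
have h3 : d / 2 <= rnorm (1 - s%:C * w) by move: h1 h2 dw; clear; lra.
have h4 : (d / 2) ^+ 2 <= rnorm (1 - s%:C * w) ^+ 2.
  by rewrite ler_pXn2r ?nnegrE ?(ltW n0)// divr_ge0// ltW.
have := ler_wpM2l (ltW e0) h4; rewrite /s; move: qe q0; clear.
set X := rnorm _ ^+ 2 => qe q0; rewrite expr_div_n => h.
have -> : 1 - (1 - q) ^+ 2 = 2 * q - q ^+ 2 by ring.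
have := sqr_ge0 q; move: h; set Y := d ^+ 2 in qe *.
by rewrite (_ : 2 ^+ 2 = 4 :> R); [lra|ring].
Qed.

Definition entire (f : C -> C) := forall z, exists l, cdiff f z l.

Lemma entire_cst (c : C) : entire (fun=> c).
Proof. by move=> z; exists 0; exact: cdiff_cst. Qed.

Lemma entire_id : entire id.
Proof. by move=> z; exists 1; exact: cdiff_id. Qed.

Lemma entireD f g : entire f -> entire g -> entire (fun z => f z + g z).
Proof.
by move=> ef eg z; have [l hl] := ef z; have [m hm] := eg z; exists (l + m);
  exact: cdiffD.
Qed.

Lemma entireM f g : entire f -> entire g -> entire (fun z => f z * g z).
Proof.
by move=> ef eg z; have [l hl] := ef z; have [m hm] := eg z; eexists;
  exact: (cdiffM hl hm).
Qed.

Lemma entireX f k : entire f -> entire (fun z => f z ^+ k).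
Proof.
move=> ef; elim: k => [|k IH]; first exact: entire_cst.
rewrite (_ : (fun z => f z ^+ k.+1) = (fun z => f z * f z ^+ k)).
  exact: entireM.
by apply/funext => z; rewrite exprS.
Qed.

Lemma entire_comp f g : entire f -> entire g -> entire (fun z => f (g z)).
Proof.
by move=> ef eg z; have [m hm] := eg z; have [l hl] := ef (g z); eexists;
  exact: (cdiff_comp hl hm).
Qed.

Lemma entire_continuous f z : entire f -> {for z, continuous f}.
Proof. by move=> /(_ z)[l]; exact: cdiff_continuous. Qed.

Lemma circle_cont_entire f r : entire f ->
  circle_cont r (fun z => complex.Re (f z)).
Proof. by move=> ef; apply: circle_cont_Re => z _; exact: entire_continuous. Qed.

Lemma entire_herglotz T : entire (herglotz T).
Proof.
elim: T => [|T IH]; first exact: entire_cst.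
apply: entireD => //; apply: entireM; first exact: entire_cst.
by apply: entireX; exact: entire_id.
Qed.

(** Each power of [conj z * w] is a function of [z] times a function of [w], so the
    smoothed function is the real part of a polynomial in [z] whose coefficients
    are the moments [A], [B] of [W]. *)
Lemma smoothing_entire W (s : R) T : circle_cont 1 W -> exists p, [/\ entire p,
  complex.Re (p 0) = cmean 1 W & forall z, complex.Re (p z) =
    cmean 1 (fun w => W w * complex.Re (herglotz T (s%:C * (z^* * w))))].
Proof.
move=> cW; elim: T => [|T [p [ep p0 hp]]].
  exists (fun=> (cmean 1 W)%:C); split=> // [|z]; first exact: entire_cst.
  by apply: eq_cmean => // w _ /=; rewrite mulr1.
pose A := cmean 1 (fun w => W w * complex.Re (w ^+ T.+1)).
pose B := cmean 1 (fun w => W w * complex.Re (- 'i%C * w ^+ T.+1)).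
exists (fun z => p z + (2 * s ^+ T.+1)%:C * ((A -i* B) * z ^+ T.+1)).
have eX k : entire (fun w : C => w ^+ k) by apply: entireX; exact: entire_id.
split=> [|| z].
- apply: entireD => //; apply: entireM; first exact: entire_cst.
  by apply: entireM; [exact: entire_cst|exact: eX].
- by rewrite [0 ^+ _]exprS mul0r !mulr0 addr0.
rewrite raddfD /= hp.
have cA : circle_cont 1 (fun w => W w * complex.Re (w ^+ T.+1)).
  by apply: circle_contM => //; exact: circle_cont_entire.
have cB : circle_cont 1 (fun w => W w * complex.Re (- 'i%C * w ^+ T.+1)).
  apply: circle_contM => //; apply: circle_cont_entire; apply: entireM => //.
  exact: entire_cst.
set a := complex.Re (z ^+ T.+1); set b := complex.Im (z ^+ T.+1).
set k : R := 2 * s ^+ T.+1.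
have -> : complex.Re (k%:C * ((A -i* B) * z ^+ T.+1)) = k * a * A + k * b * B.
  by rewrite /a /b; case: (z ^+ T.+1) => x y /=; ring.
have cH : circle_cont 1
    (fun w => W w * complex.Re (herglotz T (s%:C * (z^* * w)))).
  apply: circle_contM => //; apply: circle_cont_entire.
  apply: entire_comp; first exact: entire_herglotz.
  by do 2! (apply: entireM; first exact: entire_cst); exact: entire_id.
have cA' : circle_cont 1 (fun w => k * a * (W w * complex.Re (w ^+ T.+1))).
  by apply: circle_contM => //; exact: circle_cont_cst.
have cB' : circle_cont 1
    (fun w => k * b * (W w * complex.Re (- 'i%C * w ^+ T.+1))).
  by apply: circle_contM => //; exact: circle_cont_cst.
rewrite -!cmeanZ// -!cmeanD//; last exact: circle_contD.
apply: eq_cmean => // w _.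
have -> : complex.Re (herglotz T (s%:C * (z^* * w)) +
    2%:R * (s%:C * (z^* * w)) ^+ T.+1) =
  complex.Re (herglotz T (s%:C * (z^* * w))) +
    k * (a * complex.Re (w ^+ T.+1) +
         b * complex.Re (- 'i%C * w ^+ T.+1)).
  rewrite raddfD; congr (_ + _); rewrite !exprMn.
  rewrite -rmorphXn -(rmorphXn (@conjc R)) /a /b.
  rewrite (_ : 2%:R = (2 : R)%:C); last by rewrite rmorph_nat.
  rewrite !complexM_real /= /k -mulrA; congr (_ * (_ * _)).
  by case: (z ^+ T.+1) (w ^+ T.+1) => x y [x' y'] /=; ring.
by ring.
Qed.

(** The kernel [k] has mean one and is at least [- e1]. Where [w] is within [d] of
    [z] the Lipschitz bound makes [W w - W z] small, and elsewhere [k] is at most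
    [e1]; both cases are covered by the bound [key], whose mean is computable. *)
Lemma circle_approx W (L e : R) : 0 <= L -> 0 < e -> circle_cont 1 W ->
  (forall z w, rnorm z = 1 -> rnorm w = 1 -> `|W w - W z| <= L * rnorm (w - z)) ->
  exists p, [/\ entire p, complex.Re (p 0) = cmean 1 W &
    forall z, rnorm z = 1 -> `|complex.Re (p z) - W z| <= e].
Proof.
move=> L0 e0 cW lW.
pose d := e / (4 * (L + 1)).
have L1 : 0 < L + 1 by rewrite ltr_wpDl.
have d0 : 0 < d by rewrite divr_gt0// mulr_gt0.
have Ld : L * d <= e / 4.
  rewrite /d mulrA ler_pdivrMr ?mulr_gt0//; move: e0 L0; clear; nra.
have Ld0 : 0 <= L * d by rewrite mulr_ge0// ltW.
pose e1 := Num.min 2^-1 (e / (16 * (L + 1))).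
have e10 : 0 < e1 by rewrite lt_min invr_gt0 ltr0n /= divr_gt0// mulr_gt0.
have e12 : e1 <= 2^-1 by rewrite ge_min lexx.
have Le1 : L * e1 <= e / 16.
  have : e1 <= e / (16 * (L + 1)) by rewrite ge_min lexx orbT.
  move=> /(ler_wpM2l L0)/le_trans; apply.
  by rewrite mulrA ler_pdivrMr ?mulr_gt0//; move: e0 L0; clear; nra.
have [s [T [/andP[s0 s1] lower upper]]] := herglotz_bounds d0 e10.
have [p [ep p0 hp]] := smoothing_entire s T cW.
exists p; split=> // z z1.
pose k w := complex.Re (herglotz T (s%:C * (z^* * w))).
have eH : entire (fun w => herglotz T (s%:C * (z^* * w))).
  apply: entire_comp; first exact: entire_herglotz.
  by do 2! (apply: entireM; first exact: entire_cst); exact: entire_id.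
have ck : circle_cont 1 k by exact: circle_cont_entire.
have mk : cmean 1 k = 1.
  rewrite (@cmean_value _ 2 0) ?ler01 ?ltr1n//.
  - by rewrite !mulr0 herglotz0.
  - by move=> w _; exact: entire_continuous.
have c1 : circle_cont 1 (fun w => W z * k w).
  by apply: circle_contM => //; exact: circle_cont_cst.
have c2 : circle_cont 1 (fun w => W w * k w) by exact: circle_contM.
have c3 : circle_cont 1 (fun w => (W w * k w) + (- 1) * (W z * k w)).
  apply: circle_contD => //; apply: circle_contM => //.
  exact: circle_cont_cst.
have -> : complex.Re (p z) - W z =
    cmean 1 (fun w => W w * k w + (- 1) * (W z * k w)).
  rewrite cmeanD//; last by apply: circle_contM => //; exact: circle_cont_cst.
  by rewrite cmeanZ// cmeanZ// mk hp mulr1 mulN1r.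
have c4 : circle_cont 1 (fun w => L * d * (k w + 2 * e1) + 4 * L * e1).
  apply: circle_contD; last exact: circle_cont_cst.
  apply: circle_contM; first exact: circle_cont_cst.
  by apply: circle_contD => //; exact: circle_cont_cst.
have m4 : cmean 1 (fun w => L * d * (k w + 2 * e1) + 4 * L * e1) <= e.
  have c5 : circle_cont 1 (fun w => k w + 2 * e1).
    by apply: circle_contD => //; exact: circle_cont_cst.
  rewrite cmeanD//; last 2 first.
  - by apply: circle_contM => //; exact: circle_cont_cst.
  - exact: circle_cont_cst.
  rewrite cmeanZ// cmean_cst cmeanD//; last exact: circle_cont_cst.
  rewrite mk cmean_cst.
  have h : L * d * (1 + 2 * e1) <= e / 4 * (1 + 2 * e1).
    by apply: ler_wpM2r Ld; move: e10; clear; lra.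
  have h2 : e / 4 * (1 + 2 * e1) <= e / 4 * 2.
    by rewrite ler_pM2l ?divr_gt0//; move: e12; clear; lra.
  by move: h h2 Le1 e0; clear; lra.
have key w : rnorm w = 1 ->
    `|W w * k w + (- 1) * (W z * k w)| <= L * d * (k w + 2 * e1) + 4 * L * e1.
  move=> w1; have zw1 : rnorm (z^* * w) = 1 by rewrite rnormM rnormJ z1 w1 mulr1.
  have low := lower _ zw1; rewrite -/(k w) in low.
  rewrite mulN1r -mulrBl normrM.
  have kk : `|k w| <= k w + 2 * e1.
    by rewrite ler_norml; apply/andP; split; move: low e10; clear; lra.
  have kp : 0 <= k w + 2 * e1 := le_trans (normr_ge0 _) kk.
  have zw : rnorm (1 - z^* * w) = rnorm (w - z).
    have zz : z^* * z = 1 by rewrite mulrC mulcJ z1 expr1n.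
    by rewrite -zz -mulrBr rnormM rnormJ z1 mul1r rnorm_distC.
  have [far|near] := leP d (rnorm (w - z)).
    have up := upper _ zw1; rewrite zw in up; have {}up := up far.
    rewrite -/(k w) in up.
    have ke : `|k w| <= e1 by rewrite ler_norml; apply/andP; split.
    have W2 : `|W w - W z| <= 2 * L.
      apply: le_trans (lW _ _ z1 w1) _; rewrite mulrC ler_wpM2r//.
      by have := rnormB w z; rewrite w1 z1; clear; lra.
    apply: le_trans (ler_pM _ _ W2 ke) _ => //.
    by have := mulr_ge0 Ld0 kp; have := mulr_ge0 L0 (ltW e10); clear; lra.
  have W2 : `|W w - W z| <= L * d.
    by apply: le_trans (lW _ _ z1 w1) _; rewrite ler_wpM2l// ltW.
  apply: le_trans (ler_pM _ _ W2 kk) _ => //.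
  by have := mulr_ge0 L0 (ltW e10); clear; lra.
rewrite ler_norml; apply/andP; split.
  rewrite lerNl -[leLHS]mulN1r -cmeanZ//; apply: le_trans m4.
  apply: le_cmean => //; first by apply: circle_contM => //; exact: circle_cont_cst.
  by move=> w /key/ler_normlP[h _]; rewrite [leLHS]mulN1r.
apply: le_trans m4; apply: le_cmean => // w /key.
by apply: le_trans; exact: ler_norm.
Qed.

(** The maximum principle for [v = W - Re p + g * |z| ^ 2], where [p] approximates
    [W] on the circle: [v] is larger at the center than on the circle, so its
    maximum is attained at an interior point [z0]. Expanding [|z0 + t| ^ 2]
    produces [2 * Re (conj z0 * t)], which is harmonic and absorbed by [F], and
    [|t| ^ 2], which remains. *)
Lemma touching_point W (L : R) : 0 <= L ->
  (forall z, rnorm z <= 1 -> {for z, continuous W}) ->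
  (forall z w, rnorm z = 1 -> rnorm w = 1 -> `|W w - W z| <= L * rnorm (w - z)) ->
  cmean 1 W < W 0 ->
  exists z0 (F : C -> C) (e : R), [/\ rnorm z0 < 1, entire F, 0 < e,
    F 0 = (W z0)%:C & forall t, rnorm (z0 + t) <= 1 ->
      W (z0 + t) <= complex.Re (F t) - e * rnorm t ^+ 2].
Proof.
move=> L0 cW lW gap.
have cW1 : circle_cont 1 W by move=> z z1; apply: cW; rewrite z1.
(* One third of the gap pays for the approximation on the circle, one for the
   quadratic term, and the last one makes the maximum interior. *)
pose g := (W 0 - cmean 1 W) / 3.
have g0 : 0 < g by rewrite divr_gt0// subr_gt0.
have [p [ep p0 hp]] := circle_approx L0 g0 cW1 lW.
pose v z := W z - complex.Re (p z) + g * rnorm z ^+ 2.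
pose D := [set z : C | rnorm (z - 0) <= 1].
have [|||z0 z0D zmax] := @compact_EVT_max C R v D.
- by exists 0; rewrite /D /= subrr rnorm0.
- exact: compact_disc.
- apply: continuous_in_subspaceT => z /set_mem; rewrite /D /= subr0 => z1.
  have cn : {for z, continuous (fun w : C => g * rnorm w ^+ 2)}.
    have cn : {for z, continuous (fun w : C => rnorm w)}.
      apply/continuous_RP => e e0; exists e => // y; apply: le_lt_trans.
      rewrite ler_norml; have := rnorm_sub_ge y z; have := rnorm_sub_ge z y.
      by rewrite (rnorm_distC z); clear => ? ?; apply/andP; split; lra.
    have cc : {for z, continuous (fun=> g : R)} := @cst_continuous _ _ g z.
    exact: (continuousM cc (continuousM cn cn)).
  have cp : {for z, continuous (fun w => complex.Re (p w))}.
    by apply: (circle_cont_entire ep (r := rnorm z)).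
  exact: (continuousD (continuousB (cW z z1) cp) cn).
move: z0D; rewrite inE /D /= subr0 => z0D.
have v0 : v 0 <= v z0 by apply: zmax; rewrite inE /D /= subr0 rnorm0.
have v0E : v 0 = 3 * g.
  by rewrite /v p0 rnorm0 expr0n mulr0 addr0 /g; field.
have z01 : rnorm z0 < 1.
  rewrite lt_neqAle z0D andbT; apply/eqP => z1.
  have := hp _ z1; rewrite ler_norml => /andP[h _].
  by move: v0; rewrite v0E /v z1 expr1n; move: h g0; clear; lra.
pose F t := (W z0)%:C + (p (z0 + t) + (- p z0 + (- (2 * g)%:C * z0^*) * t)).
exists z0, F, g; split=> //.
- apply: entireD; first exact: entire_cst.
  apply: entireD.
    by apply: entire_comp => //; apply: entireD; [exact: entire_cst|exact: entire_id].
  apply: entireD; first exact: entire_cst.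
  by apply: entireM; [exact: entire_cst|exact: entire_id].
- by rewrite /F addr0 mulr0 addr0 subrr addr0.
move=> t t1; have := zmax (z0 + t); rewrite inE /D /= subr0 => /(_ t1).
rewrite /v.
have -> : complex.Re (F t) = W z0 + (complex.Re (p (z0 + t)) - complex.Re (p z0) -
    2 * g * complex.Re (z0^* * t)).
  rewrite /F; move: (p (z0 + t)) (p z0) (W z0) => a b c.
  by case: a b (z0) (t) => ? ? [? ?] [? ?] [? ?] /=; ring.
have -> : rnorm (z0 + t) ^+ 2 =
    rnorm z0 ^+ 2 + 2 * complex.Re (z0^* * t) + rnorm t ^+ 2.
  by rewrite !rnorm_sqr; case: (z0) (t) => ? ? [? ?] /=; ring.
by clear; lra.
Qed.

End HerglotzKernel.

(** * The distance to the complement *)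

Section Distance.
Context {R : realType} {n : nat}.
Local Notation C := R[i].
Local Notation V := 'rV[R[i]]_n.
Context (D : set V).
Context (compl : ~` D !=set0).

Definition cdist (z : V) : R := inf [set rnorm (w - z) | w in ~` D].

Let has_inf_dist z : has_inf [set rnorm (w - z) | w in ~` D].
Proof.
split; first by case: compl => w Dw; exists (rnorm (w - z)), w.
by exists 0 => _ [w _ <-]; exact: rnorm_ge0.
Qed.

Lemma cdist_le z w : ~ D w -> cdist z <= rnorm (w - z).
Proof. by move=> Dw; apply: ge_inf; [case: (has_inf_dist z)|exists w]. Qed.

Lemma le_cdist z (r : R) : (forall w, ~ D w -> r <= rnorm (w - z)) ->
  r <= cdist z.
Proof.
move=> h; apply: lb_le_inf; first by case: (has_inf_dist z).
by move=> _ [w Dw <-]; exact: h.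
Qed.

Lemma cdist_ge0 z : 0 <= cdist z.
Proof. by apply: le_cdist => w _; exact: rnorm_ge0. Qed.

Lemma cdist_in z w : rnorm (w - z) < cdist z -> D w.
Proof.
move=> h; apply: contrapT => Dw; have := cdist_le z Dw.
by rewrite leNgt h.
Qed.

Lemma cdist_lip z w : `|cdist z - cdist w| <= rnorm (z - w).
Proof.
have key x y : cdist x <= cdist y + rnorm (x - y).
  rewrite -lerBlDr; apply: le_cdist => v Dv; rewrite lerBlDr.
  apply: le_trans (cdist_le x Dv) _; apply: le_trans (rnorm_triangle y _ _) _.
  by rewrite lerD2l rnorm_distC.
rewrite ler_norml; have := key z w; have := key w z.
by rewrite (rnorm_distC w); clear => ? ?; apply/andP; split; lra.
Qed.

Lemma cdist_continuous : continuous cdist.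
Proof.
move=> z; apply/continuous_RP => e e0; exists e => // w.
by apply: le_lt_trans; exact: cdist_lip.
Qed.

Lemma cdist_gt0 z : open D -> D z -> 0 < cdist z.
Proof.
rewrite openE => oD /oD /nbhs_rnormP[e e0 he]; apply: lt_le_trans e0 _.
by apply: le_cdist => w Dw; rewrite leNgt; apply/negP => /he.
Qed.

Lemma cdist_out z : ~ D z -> cdist z = 0.
Proof.
move=> Dz; apply/eqP; rewrite eq_le cdist_ge0 andbT.
by rewrite -(@rnorm0 R V) -(subrr z); exact: cdist_le.
Qed.

Lemma rnorm_sub_continuous (z : V) : continuous (fun w : V => rnorm (w - z)).
Proof.
move=> w; apply/continuous_RP => e e0; exists e => // y; apply: le_lt_trans.
rewrite ler_norml; have := rnorm_triangle w y z; have := rnorm_triangle y w z.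
by rewrite (rnorm_distC w y); clear => ? ?; apply/andP; split; lra.
Qed.

Lemma cdist_attained z : open D -> exists p, ~ D p /\ rnorm (p - z) = cdist z.
Proof.
move=> oD; pose A := ~` D `&` [set w : V | rnorm (w - z) <= cdist z + 1].
have A0 : A !=set0.
  have [|_ [w Dw <-] hw] := @inf_adherent _ [set rnorm (w - z) | w in ~` D] 1 ltr01.
    exact: has_inf_dist.
  by exists w; split => //=; apply/ltW.
have cA : compact A.
  apply: (@compact_rV R n A (cdist z + 1 + rnorm z)).
    apply: closedI; first exact: open_closedC.
    apply: (@preimage_closed _ _ (fun w : V => rnorm (w - z)) [set x | x <= cdist z + 1]).
      by move=> w _; exact: rnorm_sub_continuous.
    exact: closed_le.
  move=> v [_ /= hv]; have := rnorm_sub_ge v z; move: hv; clear; lra.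
have [p pA hp] := @compact_EVT_min _ _ (fun w : V => rnorm (w - z)) A A0 cA
  (continuous_subspaceT (@rnorm_sub_continuous z)).
move: pA; rewrite inE => -[Dp pz].
exists p; split=> //; apply/eqP; rewrite eq_le cdist_le// andbT.
apply: le_cdist => w Dw.
have [wz|wz] := leP (rnorm (w - z)) (cdist z + 1).
  by apply: hp; rewrite inE; split.
exact: le_trans (ltW wz).
Qed.

End Distance.

(** * Linear approximation of continuously differentiable functions *)

Section Differentiability.
Context {R : realType} {n : nat}.
Local Notation C := R[i].
Local Notation V := 'rV[R[i]]_n.
Implicit Types (rho : V -> R).

Lemma rnorm_real_basis (v : V) : real_basis v -> rnorm v <= 1.
Proof.
case=> -[j _ <-]; apply: rnorm_le_coord => // k; rewrite !mxE.
  by case: (_ && _); rewrite ?mulr0n ?mulr1n ?rnorm0 ?rnorm1.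
rewrite rnormM; have -> : rnorm ('i%C : C) = 1.
  by apply/eqP; rewrite -(@eqrXn2 _ 2) ?rnorm_ge0// rnorm_sqr /= expr0n add0r expr1n.
by rewrite mul1r; case: (_ && _); rewrite ?mulr0n ?mulr1n ?rnorm0 ?rnorm1.
Qed.

Lemma slice_mvt rho (q v : V) (t : R) :
  (forall s : R, `|s| <= `|t| -> derivable (real_slice rho (q + s%:C *: v) v) 0 1) ->
  exists2 s : R, `|s| <= `|t| &
    rho (q + t%:C *: v) - rho q = partial v rho (q + s%:C *: v) * t.
Proof.
move=> dr.
pose f (s : R) := rho (q + s%:C *: v).
pose df (s : R) := partial v rho (q + s%:C *: v).
have isd (s : R) : `|s| <= `|t| -> is_derive s 1 f (df s).
  move=> /dr h.
  have -> : f = (fun x => real_slice rho (q + s%:C *: v) v (x - s)).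
    apply/funext => x; rewrite /f /real_slice -addrA -scalerDl -rmorphD.
    by rewrite (addrC s) subrK.
  have h1 : is_derive (s - s) 1 (real_slice rho (q + s%:C *: v) v) (df s).
    rewrite (_ : s - s = 0); last exact: subrr.
    by rewrite /df /partial derive1E; exact: derivableP.
  have h2 : is_derive s 1 (fun x : R => x - s) (1 - 0).
    exact: (is_deriveB (is_derive_id _ _) (is_derive_cst _ _ _)).
  by have := @is_derive1_comp R _ (fun x => x - s) s _ _ h1 h2; rewrite subr0 mulr1.
have cf (s : R) : `|s| <= `|t| -> {for s, continuous f}.
  move=> /isd[h _]; apply: differentiable_continuous; exact/derivable1_diffP.
have f0 : f 0 = rho q by rewrite /f scale0r addr0.
have [t0|t0] := leP 0 t.
  have [||s] := @MVT_segment R f df 0 t t0.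
  - move=> s; rewrite in_itv/= => /andP[s0 st]; apply: isd.
    by rewrite !ger0_norm// ltW.
  - apply: continuous_in_subspaceT => s /set_mem /=; rewrite in_itv/=.
    by move=> /andP[s0 st]; apply: cf; rewrite !ger0_norm.
  rewrite in_itv/= subr0 f0 => /andP[s0 st] E; exists s => //.
  by rewrite !ger0_norm.
have [||s] := @MVT_segment R f df t 0 (ltW t0).
- move=> s; rewrite in_itv/= => /andP[ts s0]; apply: isd.
  by rewrite !ler0_norm ?lerN2 // ltW.
- apply: continuous_in_subspaceT => s /set_mem /=; rewrite in_itv/=.
  by move=> /andP[ts s0]; apply: cf; rewrite !ler0_norm ?lerN2 // ltW.
rewrite in_itv/= sub0r f0 => /andP[ts s0] E; exists s.
  by rewrite !ler0_norm ?lerN2 // ltW.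
by rewrite -/(f t); move: E; rewrite -/(df s) mulrN; clear; lra.
Qed.

(** From [p] one moves along real coordinate directions only, one after the other;
    the mean value theorem applies to every step, and the partial derivatives
    there are within [eta] of those at [p]. *)
Lemma steps_linear_approx rho p (eta tau d : R) : 0 <= eta -> 0 <= tau ->
  (forall v w, real_basis v -> rnorm (w - p) < d ->
    derivable (real_slice rho w v) 0 1 /\
    `|partial v rho w - partial v rho p| <= eta) ->
  forall s : seq (V * R),
  (forall x, x \in s -> real_basis x.1 /\ `|x.2| <= tau) ->
  (size s)%:R * tau < d ->
  let q := p + \sum_(x <- s) x.2%:C *: x.1 in
  rnorm (q - p) <= (size s)%:R * tau /\
  `|rho q - rho p - \sum_(x <- s) partial x.1 rho p * x.2| <=
    (size s)%:R * eta * tau.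
Proof.
move=> eta0 tau0 H; elim=> [_ _|[v t] s IH hs] /=.
  by rewrite !big_nil !addr0 !subrr rnorm0 normr0 !mul0r.
rewrite -natr1 mulrDl mul1r => sd.
have [||IH1 IH2] := IH.
- by move=> x xs; apply: hs; rewrite inE xs orbT.
- by apply: le_lt_trans sd; rewrite lerDl.
have [bv tt] := hs (v, t) (mem_head _ _).
rewrite /= in bv tt.
rewrite !big_cons /=; set S := \sum_(x <- s) _ *: _ in IH1 IH2 *.
set T := \sum_(x <- s) _ * _ in IH2 *.
have -> : p + (t%:C *: v + S) = (p + S) + t%:C *: v by rewrite addrCA addrC.
have near (u : R) : `|u| <= `|t| ->
    rnorm (p + S + u%:C *: v - p) <= (size s)%:R * tau + tau.
  move=> ut; rewrite addrAC; apply: le_trans (rnormD _ _) _.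
  rewrite lerD// rnormZ rnormc -[tau]mulr1 ler_pM ?rnorm_ge0//.
    exact: le_trans tt.
  exact: rnorm_real_basis.
split; first exact: near.
have [u ut E] : exists2 u : R, `|u| <= `|t| &
    rho (p + S + t%:C *: v) - rho (p + S) =
    partial v rho (p + S + u%:C *: v) * t.
  apply: slice_mvt => u ut; have [] // := H v (p + S + u%:C *: v) bv.
  exact: le_lt_trans (near u ut) sd.
have [_ pe] := H v (p + S + u%:C *: v) bv (le_lt_trans (near u ut) sd).
have -> : rho (p + S + t%:C *: v) - rho p - (partial v rho p * t + T) =
  (rho (p + S) - rho p - T) +
  (partial v rho (p + S + u%:C *: v) - partial v rho p) * t.
  by rewrite mulrBl -E; ring.
apply: le_trans (ler_normD _ _) _; rewrite -[leRHS]mulrA [leRHS]mulrDl mul1r.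
rewrite [X in _ <= X + _]mulrA lerD//.
by rewrite normrM ler_pM.
Qed.

Lemma C1_linear_approx (U : set V) rho p : open U -> U p -> C1_on U rho ->
  forall eta : R, 0 < eta -> exists2 d : R, 0 < d & forall h, rnorm h < d ->
  `|rho (p + h) - rho p - \sum_(j < n)
      (partial (delta_mx 0 j) rho p * complex.Re (h 0 j) +
       partial ('i%C *: delta_mx 0 j) rho p * complex.Im (h 0 j))| <=
    eta * rnorm h.
Proof.
move=> oU Up cU eta eta0.
pose N : R := (n + n)%:R + 1.
have N0 : 0 < N by rewrite ltr_wpDl// ler0n.
have eN : 0 < eta / N by rewrite divr_gt0.
have : \forall w \near p, U w /\ forall j : 'I_n,
   `|partial (delta_mx 0 j) rho w - partial (delta_mx 0 j) rho p| < eta / N /\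
   `|partial ('i%C *: delta_mx 0 j) rho w -
     partial ('i%C *: delta_mx 0 j) rho p| < eta / N.
  have b1 j : @real_basis R n (delta_mx 0 j) by left; exists j.
  have b2 j : @real_basis R n ('i%C *: delta_mx 0 j) by right; exists j.
  apply: filterI; first exact: open_nbhs_nbhs.
  apply: (@filter_forall _ _ (fun (j : 'I_n) w =>
    `|partial (delta_mx 0 j) rho w - partial (delta_mx 0 j) rho p| < eta / N /\
    `|partial ('i%C *: delta_mx 0 j) rho w -
      partial ('i%C *: delta_mx 0 j) rho p| < eta / N) (nbhs p)) => j.
  have [_ /continuous_RP/(_ _ eN)[d1 d10 h1]] := cU _ (b1 j) _ Up.
  have [_ /continuous_RP/(_ _ eN)[d2 d20 h2]] := cU _ (b2 j) _ Up.
  apply/nbhs_rnormP; exists (Num.min d1 d2); first by rewrite lt_min d10.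
  by move=> y; rewrite lt_min => /andP[/h1 ? /h2 ?].
move=> /nbhs_rnormP[d d0 hd].
exists (d / N); first by rewrite divr_gt0.
move=> h; rewrite ltr_pdivlMr// => hN.
pose s := [seq (delta_mx 0 j : V, complex.Re (h 0 j)) | j <- index_enum 'I_n] ++
  [seq ('i%C *: delta_mx 0 j : V, complex.Im (h 0 j)) | j <- index_enum 'I_n].
have ss : size s = (n + n)%N.
  have sz : size (index_enum 'I_n) = n.
    by rewrite -sum1_size sum1_card card_ord.
  by rewrite size_cat !size_map sz.
have hs x : x \in s -> real_basis x.1 /\ `|x.2| <= rnorm h.
  rewrite mem_cat => /orP[] /mapP[j _ ->] /=; split.
  - by left; exists j.
  - exact: le_trans (Re_le_rnorm _) (rnorm_coord _ _).
  - by right; exists j.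
  - exact: le_trans (Im_le_rnorm _) (rnorm_coord _ _).
have sd : (size s)%:R * rnorm h < d.
  rewrite ss; apply: le_lt_trans hN; rewrite mulrC ler_wpM2l ?rnorm_ge0//.
  by rewrite lerDl.
have [v w bv wp|_] := @steps_linear_approx rho p (eta / N) (rnorm h) d
    (ltW eN) (rnorm_ge0 _) _ s hs sd.
  have [Uw hw] := hd w wp; have [dv _] := cU _ bv _ Uw; split=> //.
  by case: bv => -[j _ <-]; apply/ltW; have [] := hw j.
have -> : \sum_(x <- s) x.2%:C *: x.1 = h.
  rewrite big_cat !big_map /= -big_split /=.
  rewrite [RHS]row_sum_delta; apply: eq_bigr => j _.
  rewrite scalerA -scalerDl; congr (_ *: _).
  by rewrite [in RHS](complexE (h 0 j)) mulrC.
have -> : \sum_(x <- s) partial x.1 rho p * x.2 = \sum_(j < n)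
      (partial (delta_mx 0 j) rho p * complex.Re (h 0 j) +
       partial ('i%C *: delta_mx 0 j) rho p * complex.Im (h 0 j)).
  by rewrite big_cat !big_map /= -big_split.
move=> /le_trans; apply; rewrite ss; apply: ler_wpM2r; first exact: rnorm_ge0.
by rewrite mulrCA ler_piMr ?(ltW eta0)// ler_pdivrMr// mul1r lerDl.
Qed.

End Differentiability.

(** * Discs near a boundary point *)

Section BoundaryForm.
Context {R : realType} {n : nat}.
Local Notation C := R[i].
Local Notation V := 'rV[R[i]]_n.
Implicit Types (D : set V) (l : 'I_n -> C) (v w p Y : V).

Definition linf l v : C := \sum_(j < n) l j * v 0 j.

Lemma linfD l v w : linf l (v + w) = linf l v + linf l w.
Proof. by rewrite -big_split; apply: eq_bigr => j _; rewrite mxE mulrDr. Qed.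

Lemma linfZ l (a : C) v : linf l (a *: v) = a * linf l v.
Proof. by rewrite mulr_sumr; apply: eq_bigr => j _; rewrite mxE mulrCA. Qed.

Lemma linfN l v : linf l (- v) = - linf l v.
Proof. by rewrite -scaleN1r linfZ mulN1r. Qed.

Lemma Re_linfZ l (a : R) v :
  complex.Re (linf l (a%:C *: v)) = a * complex.Re (linf l v).
Proof. by rewrite linfZ complexM_real. Qed.

Lemma rnorm_sum (f : 'I_n -> C) :
  rnorm (\sum_(j < n) f j) <= \sum_(j < n) rnorm (f j).
Proof.
elim/big_ind2 : _ => //; first by rewrite rnorm0.
by move=> x1 x2 y1 y2 h1 h2; apply: le_trans (rnormD _ _) (lerD h1 h2).
Qed.

Lemma rnorm_linf l v : rnorm (linf l v) <= (\sum_(j < n) rnorm (l j)) * rnorm v.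
Proof.
apply: le_trans (rnorm_sum _) _; rewrite mulr_suml; apply: ler_sum => j _.
by rewrite rnormM ler_wpM2l ?rnorm_ge0// rnorm_coord.
Qed.

Lemma Re_conj_mul (a b : R) (z : C) :
  complex.Re ((a -i* b) * z) = a * complex.Re z + b * complex.Im z.
Proof. by case: z => x y /=; rewrite mulNr opprK. Qed.

(** To first order at [p], the domain lies in the half space [Re (linf l) <= 0]. *)
Definition supporting D p l := forall eta : R, 0 < eta -> exists2 d : R, 0 < d &
  forall h, rnorm h < d -> D (p + h) ->
    complex.Re (linf l h) <= eta * rnorm h.

(** The defining function is nonnegative at [p] and negative in [D], so its
    linear part at [p] is nonpositive on [D] to first order. That linear part is
    the real part of the form with coefficients [d/dx_j - i d/dy_j]. *)
Lemma C1_supporting D p : open D -> C1_boundary D -> closure D p -> ~ D p ->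
  exists l, supporting D p l /\ exists v, 0 < complex.Re (linf l v).
Proof.
move=> oD bD cp Dp.
have [|U [rho [[oU Up] cU gU DU]]] := bD p.
  by split=> // /interior_subset.
have rp : 0 <= rho p.
  rewrite leNgt; apply/negP => rp.
  by apply: Dp; have [] : (D `&` U) p by rewrite DU; split.
pose l j : C := (partial (delta_mx 0 j) rho p) -i*
  (partial ('i%C *: delta_mx 0 j) rho p).
have lE h : complex.Re (linf l h) = \sum_(j < n)
    (partial (delta_mx 0 j) rho p * complex.Re (h 0 j) +
     partial ('i%C *: delta_mx 0 j) rho p * complex.Im (h 0 j)).
  rewrite /linf raddf_sum; apply: eq_bigr => j _.
  exact: Re_conj_mul.
exists l; split=> [eta eta0|].
  have [d d0 hd] := C1_linear_approx oU Up cU eta0.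
  have /nbhs_rnormP[d' d'0 hU] : nbhs p U by exact: open_nbhs_nbhs.
  exists (Num.min d d'); first by rewrite lt_min d0.
  move=> h; rewrite lt_min => /andP[/hd hh hd'] Dh.
  have Uh : U (p + h) by apply: hU; rewrite addrAC subrr add0r.
  have [_ rh] : [set z | U z /\ rho z < 0] (p + h) by rewrite -DU; split.
  rewrite lE; move: hh; rewrite ler_norml => /andP[hh _].
  by move: hh rh rp; clear; lra.
have [v bv pv] := gU p Up.
have [j lj] : exists j, l j != 0.
  case: bv pv => -[j _ <-] pv; exists j; apply: contra pv.
    by rewrite /l eq_complex /= => /andP[].
  by rewrite /l eq_complex /= oppr_eq0 => /andP[].
exists ((l j)^* *: delta_mx 0 j).
rewrite linfZ /linf (bigD1 j)//= big1 => [|k kj]; last first.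
  by rewrite mxE (negPf kj) mulr0.
move: (l j) lj => x x0.
by rewrite mxE !eqxx /= mulr1 addr0 mulrC mulcJ /= exprn_gt0// rnorm_gt0.
Qed.

(** The segment from [z0 + d0 Y] to [z0 + d0 Y'] stays in the ball about [z0] for
    every [Y'] of norm less than one, hence [Re (linf l (Y' - Y)) <= 0]; choose
    [Y'] with a positive value. *)
Lemma supporting_ball_gt0 D l (z0 Y : V) (d0 : R) : 0 < d0 -> rnorm Y <= 1 ->
  (forall w, rnorm (w - z0) < d0 -> D w) ->
  supporting D (z0 + d0%:C *: Y) l -> (exists v, 0 < complex.Re (linf l v)) ->
  0 < complex.Re (linf l Y).
Proof.
move=> d00 Y1 ball sup [v lv].
have v0 : 0 < rnorm v.
  rewrite rnorm_gt0; apply: contraTneq lv => ->.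
  by rewrite -(scale0r v) linfZ mul0r /= ltxx.
pose Y' := (2 * rnorm v)^-1%:C *: v.
have vv : 0 < (2 * rnorm v)^-1 by rewrite invr_gt0 mulr_gt0.
have Y'2 : rnorm Y' = 2^-1.
  by rewrite rnormZ rnormc gtr0_norm// invfM mulfVK// gt_eqF.
pose k := complex.Re (linf l Y').
have k0 : 0 < k by rewrite /k Re_linfZ mulr_gt0.
have k4 : 0 < k / 4 by rewrite divr_gt0.
have [d dp hd] := sup _ k4.
pose t := Num.min 1 (d / (4 * d0)).
have t0 : 0 < t by rewrite lt_min ltr01 divr_gt0// mulr_gt0.
have t1 : t <= 1 by rewrite ge_min lexx.
have td : t * d0 * 2 < d.
  have : t <= d / (4 * d0) by rewrite ge_min lexx orbT.
  rewrite ler_pdivlMr ?mulr_gt0//; move: dp; clear; lra.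
have n2 : rnorm (Y' - Y) <= 2.
  by apply: le_trans (rnormB _ _) _; rewrite Y'2; move: Y1; clear; lra.
have td0 : 0 < t * d0 by rewrite mulr_gt0.
have nh : rnorm ((t * d0)%:C *: (Y' - Y)) <= t * d0 * 2.
  by rewrite rnormZ rnormc gtr0_norm// ler_pM2l.
have := hd ((t * d0)%:C *: (Y' - Y)) (le_lt_trans nh td).
have inD : D (z0 + d0%:C *: Y + (t * d0)%:C *: (Y' - Y)).
  apply: ball; rewrite -(addrA z0) (addrC z0) addrK.
  have -> : d0%:C *: Y + (t * d0)%:C *: (Y' - Y) =
      d0%:C *: ((1 - t)%:C *: Y + t%:C *: Y').
    rewrite !scalerBr !scalerDr !scalerA -!rmorphM mulrBr mulr1 rmorphB scalerBl.
    by rewrite (mulrC t) addrCA addrC.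
  rewrite rnormZ rnormc gtr0_norm// -[ltRHS]mulr1 ltr_pM2l//.
  apply: le_lt_trans (rnormD _ _) _; rewrite (rnormZ _ Y) (rnormZ _ Y') Y'2 !rnormc (gtr0_norm t0).
  rewrite ger0_norm ?subr_ge0//.
  have : (1 - t) * rnorm Y <= 1 - t by rewrite ler_piMr// subr_ge0.
  by move: t0; clear; lra.
move=> /(_ inD); rewrite Re_linfZ rnormZ rnormc (gtr0_norm td0) mulrCA ler_pM2l//.
rewrite linfD linfN raddfB /= -/k => h.
have := ler_wpM2l (ltW k4) n2; move: h k0; clear; lra.
Qed.

Lemma holo_disc_cdiff D phi z : holo_disc D phi -> rnorm z < 1 ->
  exists v, cdiff phi z v.
Proof.
move=> hphi z1; have [|dphi _] := hphi z.
  by rewrite /unit_disc /= rnormE -(rmorph1 (real_complex R)) ltcR.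
by exists (phi^`()%classic z); apply/cdiff_derivable.
Qed.

Lemma holo_disc_in D phi z : holo_disc D phi -> rnorm z < 1 -> D (phi z).
Proof.
move=> hphi z1; have [|//] := hphi z.
by rewrite /unit_disc /= rnormE -(rmorph1 (real_complex R)) ltcR.
Qed.

Lemma holo_disc_taylor D phi v (M : R) a :
  (forall w, D w -> rnorm w <= M) -> holo_disc D phi -> cdiff phi 0 v ->
  rnorm a <= 4^-1 ->
  rnorm (phi a - phi 0 - a *: v) <= 16 * M * rnorm a ^+ 2.
Proof.
move=> DM hphi phi0 a4.
have M0 : 0 <= M.
  apply: le_trans (rnorm_ge0 _) (DM (phi 0) _).
  by apply: (holo_disc_in hphi); rewrite rnorm0.
apply: rnorm_le_coord; first by apply: mulr_ge0 (mulr_ge0 _ M0) (sqr_ge0 _).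
move=> j; rewrite !mxE.
apply: (@taylor2_le _ (fun z => phi z 0 j)) => //.
- move=> z /(holo_disc_cdiff hphi)[m hm]; exists (m 0 j); exact: cdiff_coord.
- exact: cdiff_coord.
- move=> z z1; apply: le_trans (rnorm_coord _ _) (DM _ _).
  exact: (holo_disc_in hphi).
Qed.

(** The scale is parabolic, with normal speed [s] at depth [s ^+ 2]: it is the one
    at which a quadratic bound for the inverse distance is felt. The error [K] is
    zero for the Kobayashi metric, and comes from Taylor's formula for the Lempert
    function. *)
Definition fast_normal_discs D p Y (e : R) := exists c K s0 : R,
  [/\ 0 < c, 0 <= K, 0 < s0 & forall s : R, 0 < s < s0 ->
    exists phi v (b : C), [/\ holo_disc D phi,
      phi 0 = p - (e * s ^+ 2)%:C *: Y, cdiff phi 0 v, c * s <= rnorm b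
      & rnorm (v - b *: Y) <= K * s ^+ 2]].

(** On the circle of radius [N * s] such a disc stays within
    [O (s * rnorm v + s ^+ 2)] of [p], so the real part of [linf l] is small there,
    and Borel-Caratheodory bounds the normal speed by an arbitrarily small multiple
    of [s]. *)
Lemma no_fast_normal_discs D p l Y (M e : R) :
  (forall w, D w -> rnorm w <= M) -> supporting D p l ->
  rnorm Y <= 1 -> 0 < complex.Re (linf l Y) ->
  0 < e -> 0 <= M -> ~ fast_normal_discs D p Y e.
Proof.
move=> DM sup Y1 k0 e0 M0 [c [K [s0 [c0 K0 s00 fast]]]].
set k := complex.Re (linf l Y) in k0.
pose La := \sum_(j < n) rnorm (l j).
have La0 : 0 <= La by rewrite sumr_ge0// => j _; exact: rnorm_ge0.
have ck : 0 < c * k by rewrite mulr_gt0.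
have ek : 0 < e * k by rewrite mulr_gt0.
(* The constants are chosen so that the final inequality fails: first the radius
   [N * s], then the accuracy [eta] of the supporting form, then [s]. *)
have [N N0 NE] : exists2 N : R, 0 < N & c * k * N = 4 * e * k + 6.
  exists ((4 * e * k + 6) / (c * k)); last by rewrite mulrC divfK// gt_eqF.
  by rewrite divr_gt0//; move: ek; clear; lra.
have N2 : 0 <= M * N ^+ 2 by rewrite mulr_ge0// sqr_ge0.
pose q := 2 * e + 32 * M * N ^+ 2 + 1.
have q0 : 0 < q by rewrite /q; move: e0 N2; clear; lra.
have [eta [eta0 eta1 eta2]] : exists eta : R,
    [/\ 0 < eta, eta <= k / 4 & eta * q <= 1].
  exists (Num.min (k / 4) q^-1); split.
  - by rewrite lt_min divr_gt0//= invr_gt0.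
  - by rewrite ge_min lexx.
  - by rewrite -ler_pdivlMr// mul1r ge_min lexx orbT.
have [d d0 hd] := sup _ eta0.
pose B := e + 12 * M * N + 16 * M * N ^+ 2.
have MN : 0 <= M * N by rewrite mulr_ge0// ltW.
have B0 : 0 < B by rewrite /B; move: e0 MN N2; clear; lra.
pose T := (La * K + 2 * eta * K) * N.
have T0 : 0 <= T.
  apply: mulr_ge0 (ltW N0); apply: addr_ge0; first exact: mulr_ge0.
  by apply: mulr_ge0 => //; rewrite mulr_ge0// ltW.
pose Q := 4 * N + T + 2 * B / d + 1 + 2 / s0.
have Bd0 : 0 < 2 * B / d by rewrite divr_gt0// mulr_gt0.
have s00' : 0 < 2 / s0 by rewrite divr_gt0.
have Q0 : 0 < Q by rewrite /Q; move: N0 T0 Bd0 s00'; clear; lra.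
have [s sp sQ] : exists2 s : R, 0 < s & s * Q = 1.
  by exists Q^-1; rewrite ?invr_gt0// mulVf// gt_eqF.
have part x y : 0 <= x -> 0 <= y -> Q = x + y -> s * x <= 1.
  by move=> x0 y0 E; rewrite -sQ E mulrDr lerDl mulr_ge0// ltW.
have s4N : s * (4 * N) <= 1.
  apply: (part _ (T + 2 * B / d + 1 + 2 / s0)); rewrite /Q ?addrA //;
    by move: N0 T0 Bd0 s00'; clear; lra.
have sT : s * T <= 1.
  apply: (part _ (4 * N + 2 * B / d + 1 + 2 / s0)) => //; rewrite /Q;
    by move: N0 T0 Bd0 s00'; clear; lra.
have sB : s * (2 * B / d) <= 1.
  apply: (part _ (4 * N + T + 1 + 2 / s0)); rewrite /Q;
    by move: N0 T0 Bd0 s00'; clear; lra.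
have s1 : s * 1 <= 1.
  apply: (part _ (4 * N + T + 2 * B / d + 2 / s0)); rewrite /Q;
    by move: N0 T0 Bd0 s00'; clear; lra.
have ss0 : s * (2 / s0) <= 1.
  apply: (part _ (4 * N + T + 2 * B / d + 1)); rewrite /Q;
    by move: N0 T0 Bd0 s00'; clear; lra.
rewrite mulr1 in s1.
have {}sB : s * B <= d / 2.
  by move: sB; rewrite mulrA ler_pdivrMr//; clear; lra.
have {}ss0 : s < s0.
  by move: ss0; rewrite mulrA ler_pdivrMr//; move: sp; clear; lra.
have [|phi [v [b [hphi phi0 dphi cb vb]]]] := fast s; first by rewrite sp.
have tay a := holo_disc_taylor (a := a) DM hphi dphi.
have V12 : rnorm v <= 12 * M.
  pose a : C := 4^-1%:C; have na : rnorm a = 4^-1.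
    by rewrite rnormc ger0_norm// invr_ge0.
  have ta := tay a; rewrite na in ta; have {}ta := ta (lexx _).
  have p1 : rnorm (phi a) <= M.
    by apply: DM; apply: (holo_disc_in hphi); rewrite na; clear; lra.
  have p2 : rnorm (phi 0) <= M.
    by apply: DM; apply: (holo_disc_in hphi); rewrite rnorm0.
  have := rnorm_sub_ge (a *: v) (phi a - phi 0).
  rewrite rnormZ na rnorm_distC; have := rnormB (phi a) (phi 0).
  by move: ta p1 p2; rewrite expr2; clear; lra.
pose r := N * s.
have r0 : 0 < r by rewrite mulr_gt0.
have r4 : r <= 4^-1 by rewrite /r; move: s4N; clear; lra.
have r01 : 0 < r < 1 by rewrite r0; move: r4; clear; lra.
pose m := e * s ^+ 2 + r * rnorm v + 16 * M * r ^+ 2.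
have phi0p : phi 0 - p = - ((e * s ^+ 2)%:C *: Y) by rewrite phi0 addrAC subrr add0r.
have es2 : 0 < e * s ^+ 2 by rewrite mulr_gt0// exprn_gt0.
have pm z : rnorm z = r -> rnorm (phi z - p) <= m.
  move=> zr; have := tay z; rewrite zr => /(_ r4) h.
  have -> : phi z - p = (phi z - phi 0 - z *: v) + (phi 0 - p) + z *: v.
    by rewrite addrAC subrK addrA subrK.
  apply: le_trans (rnormD _ _) _; rewrite rnormZ zr.
  apply: le_trans (lerD (rnormD _ _) (lexx _)) _.
  rewrite phi0p rnormN rnormZ rnormc gtr0_norm// /m.
  have : e * s ^+ 2 * rnorm Y <= e * s ^+ 2 by rewrite ler_piMr// ltW.
  by move: h; clear; lra.
have md : m < d.
  have h1 : r * rnorm v <= r * (12 * M) by rewrite ler_wpM2l// ltW.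
  have h2 : m <= s * B.
    have h3 : e * s ^+ 2 <= e * s.
      by rewrite ler_wpM2l ?(ltW e0)// expr2 ler_piMr// ltW.
    have h4 : (M * N ^+ 2) * s ^+ 2 <= (M * N ^+ 2) * s.
      by rewrite ler_wpM2l// expr2 ler_piMr// ltW.
    have E1 : r * (12 * M) = 12 * (M * N * s) by rewrite /r; ring.
    have E2 : 16 * M * r ^+ 2 = 16 * (M * N ^+ 2 * s ^+ 2) by rewrite /r; ring.
    have E3 : s * B = e * s + 12 * (M * N * s) + 16 * (M * N ^+ 2 * s).
      by rewrite /B; ring.
    rewrite /m E2 E3; rewrite E1 in h1; move: h1 h3 h4; clear; lra.
  by apply: le_lt_trans h2 _; move: sB d0; clear; lra.
pose g z := linf l (phi z - p).
have dlin z w : cdiff phi z w -> cdiff g z (linf l w).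
  move=> pw; rewrite (_ : linf l w = \sum_(j < n) (0 * (phi z - p) 0 j + l j * w 0 j)).
    apply: cdiff_sum => j; apply: (cdiffM (cdiff_cst _ _)).
    rewrite (_ : (fun w0 : C => (phi w0 - p) 0 j) =
        (fun w0 : C => phi w0 0 j + - p 0 j)).
      rewrite -[w 0 j]addr0; apply: cdiffD (cdiff_cst _ _).
      exact: cdiff_coord.
    by apply/funext => w0; rewrite !mxE.
  by apply: eq_bigr => j _; rewrite mul0r add0r.
have dg z : rnorm z < 1 -> exists k', cdiff g z k'.
  by move=> /(holo_disc_cdiff hphi)[w pw]; exists (linf l w); exact: dlin.
have gm z : rnorm z = r -> complex.Re (g z) <= eta * m.
  move=> zr; have zm := pm z zr.
  have := hd (phi z - p) (le_lt_trans zm md).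
  rewrite (addrC p) subrK => h.
  apply: le_trans (h _) _.
    by apply: (holo_disc_in hphi); rewrite zr; case/andP: r01.
  by rewrite ler_pM2l.
have := borel_caratheodory r01 dg (dlin _ _ dphi) gm.
have -> : complex.Re (g 0) = - (e * s ^+ 2 * k).
  by rewrite /g phi0p linfN raddfN /= Re_linfZ.
have lv : rnorm b * k - La * (K * s ^+ 2) <= rnorm (linf l v).
  have h1 : rnorm b * k <= rnorm (linf l (b *: Y)).
    rewrite linfZ rnormM ler_wpM2l ?rnorm_ge0//.
    exact: le_trans (ler_norm _) (Re_le_rnorm _).
  have h2 : rnorm (linf l (v - b *: Y)) <= La * (K * s ^+ 2).
    by apply: le_trans (rnorm_linf _ _) _; rewrite ler_wpM2l.
  rewrite linfD linfN in h2.
  have := rnorm_sub_ge (linf l (b *: Y)) (linf l v).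
  by rewrite rnorm_distC; move: h1 h2; clear; lra.
have vle : rnorm v <= rnorm b + K * s ^+ 2.
  have := rnorm_sub_ge v (b *: Y); rewrite rnormZ.
  have : rnorm b * rnorm Y <= rnorm b by rewrite ler_piMr// rnorm_ge0.
  by move: vb; clear; lra.
have s2 : 0 < s ^+ 2 by rewrite exprn_gt0.
have bp := rnorm_ge0 b.
move=> main.
have {main} : (rnorm b * k - La * (K * s ^+ 2)) * r <=
   2 * (eta * (e * s ^+ 2 + r * (rnorm b + K * s ^+ 2) + 16 * M * r ^+ 2) +
        e * s ^+ 2 * k).
  apply: le_trans (ler_wpM2r (ltW r0) lv) _; apply: le_trans main _.
  rewrite opprK ler_pM2l// lerD2r ler_pM2l// /m lerD2r lerD2l.
  by rewrite ler_wpM2l// ltW.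
move: (rnorm b) cb bp => x cb x0 main.
have h1 : 2 * (eta * (r * x)) <= x * k * r / 2.
  have := ler_wpM2r (mulr_ge0 (ltW r0) x0) eta1; clear; lra.
have h2 : c * s * (k * r) <= x * (k * r) by rewrite ler_wpM2r// mulr_ge0 ?ltW.
have h3 : c * s * (k * r) = (4 * e * k + 6) * s ^+ 2.
  by rewrite -NE /r; ring.
have h4 : La * (K * s ^+ 2) * r + 2 * (eta * (r * (K * s ^+ 2))) = s * T * s ^+ 2.
  by rewrite /T /r; ring.
have h5 : 2 * (eta * (e * s ^+ 2)) + 2 * (eta * (16 * M * r ^+ 2)) <= s ^+ 2.
  have -> : 2 * (eta * (e * s ^+ 2)) + 2 * (eta * (16 * M * r ^+ 2)) =
    (eta * q - eta) * s ^+ 2 by rewrite /q /r; ring.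
  by rewrite ler_piMl ?(ltW s2)//; move: eta2 eta0; clear; lra.
have h6 : s * T * s ^+ 2 <= s ^+ 2 by rewrite ler_piMl// ltW.
by move: main h1 h2 h3 h4 h5 h6 s2; clear; lra.
Qed.

End BoundaryForm.

(** * Fast discs at a pseudoconcave boundary point *)

Section PseudoconcaveDiscs.
Context {R : realType} {n : nat}.
Local Notation C := R[i].
Local Notation V := 'rV[R[i]]_n.
Context (D : set V) (z0 X Y : V) (F : C -> C) (d0 eps r0 : R).
Context (d0_gt0 : 0 < d0) (Y1 : rnorm Y = 1) (eps0 : 0 < eps) (r00 : 0 < r0).
Context (entF : entire F) (F0 : F 0 = (d0^-1)%:C).
Context (Fneq0 : forall t, rnorm t < r0 -> F t != 0).

(** For fixed [t] and [w] in the unit disc this is the disc of radius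
    [(rnorm (F t))^-1] about [z0 + t X] in the direction [Y]. By [graph_in] the
    domain contains more than that, and [(t, w) = (0, 1)] gives the point
    [z0 + d0 Y]. *)
Definition graph_disc (t w : C) : V := z0 + t *: X + (w / F t) *: Y.

Context (graph_in : forall t w, rnorm t < r0 ->
  rnorm w < 1 + eps * rnorm t ^+ 2 -> D (graph_disc t w)).

Lemma graph_disc0 w : graph_disc 0 w = z0 + (w * d0%:C) *: Y.
Proof. by rewrite /graph_disc scale0r addr0 F0 fmorphV invrK. Qed.

Lemma graph_disc_cdiff (a0 a1 b0 b1 z : C) : F (a0 + a1 * z) != 0 ->
  exists v, cdiff (fun x => graph_disc (a0 + a1 * x) (b0 + b1 * x)) z v.
Proof.
move=> Fz.
have d1 (c0 c1 : C) : cdiff (fun x => c0 + c1 * x) z (0 + (0 * z + c1 * 1)).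
  by apply: (cdiffD (cdiff_cst _ _)); apply: (cdiffM (cdiff_cst _ _)); exact: cdiff_id.
have [m Fm] := entF (a0 + a1 * z).
have dF := @cdiff_comp _ _ F (fun x => a0 + a1 * x) z _ _ Fm (d1 a0 a1).
have d2 := cdiffM (d1 b0 b1) (cdiffV dF Fz).
have d3 := cdiffD (cdiffD (@cdiff_cst R V z0 z) (cdiffZ (d1 a0 a1) (@cdiff_cst R V X z)))
  (cdiffZ d2 (@cdiff_cst R V Y z)).
by eexists; exact: d3.
Qed.

Lemma graph_disc_holo (a0 a1 b0 b1 : C) :
  (forall x, rnorm x < 1 -> rnorm (a0 + a1 * x) < r0 /\
     rnorm (b0 + b1 * x) < 1 + eps * rnorm (a0 + a1 * x) ^+ 2) ->
  holo_disc D (fun x => graph_disc (a0 + a1 * x) (b0 + b1 * x)).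
Proof.
move=> h z; rewrite /unit_disc /= rnormE -(rmorph1 (real_complex R)) ltcR => z1.
have [ha hb] := h z z1; split; last exact: graph_in.
have [v hv] := @graph_disc_cdiff a0 a1 b0 b1 z (Fneq0 ha).
by have [] := (cdiff_derivable _ _ _).1 hv.
Qed.

(** The contribution [a1 * g] of the derivative of [F] is linear in [a1], so the
    velocities for [a1] and [- a1] have a sum proportional to [Y]. *)
Lemma graph_disc_velocity (b0 : C) : exists g : C, forall a1 b1 : C,
  cdiff (fun x => graph_disc (0 + a1 * x) (b0 + b1 * x)) 0
    (a1 *: X + (b1 * d0%:C + a1 * g) *: Y).
Proof.
have [m Fm] := entF 0; exists (b0 * (m * - F 0 ^- 2)) => a1 b1.
have d1 (c0 c1 : C) : cdiff (fun x => c0 + c1 * x) 0 (0 + (0 * 0 + c1 * 1)).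
  by apply: (cdiffD (cdiff_cst _ _)); apply: (cdiffM (cdiff_cst _ _)); exact: cdiff_id.
have E0 : 0 + a1 * 0 = 0 by rewrite mulr0 addr0.
have Fm' : cdiff F (0 + a1 * 0) m by rewrite E0.
have F00' : F (0 + a1 * 0) != 0 by rewrite E0 Fneq0// rnorm0.
have dF := @cdiff_comp _ _ F (fun x => 0 + a1 * x) 0 _ _ Fm' (d1 0 a1).
have d2 := cdiffM (d1 b0 b1) (cdiffV dF F00').
have := cdiffD (cdiffD (@cdiff_cst R V z0 0) (cdiffZ (d1 0 a1) (@cdiff_cst R V X 0)))
  (cdiffZ d2 (@cdiff_cst R V Y 0)).
set l := (X in cdiff _ _ X).
suff -> : l = a1 *: X + (b1 * d0%:C + a1 * (b0 * (m * - F 0 ^- 2))) *: Y.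
  by [].
rewrite /l E0 !scaler0 !addr0 !add0r !mulr0 !addr0 !mulr1 add0r F0 fmorphV invrK.
congr (_ + _ *: _); congr (_ + _); first by rewrite add0r.
by rewrite [a1 *: m](_ : _ = a1 * m)// -mulrA mulrCA.
Qed.

Let a : R := Num.min 4^-1 (r0 / 2).
Let a_gt0 : 0 < a.
Proof. by rewrite lt_min invr_gt0 ltr0n /= divr_gt0. Qed.
Let a4 : a <= 4^-1.
Proof. by rewrite ge_min lexx. Qed.
Let ar0 : 2 * a <= r0.
Proof. by rewrite mulrC -ler_pdivlMr// ge_min lexx orbT. Qed.

(** With [y = rnorm t], [rnorm w] is at most [1 - eps * (s ^+ 2 - s * y)], and
    [s ^+ 2 - s * y + y ^+ 2] is positive. *)
Lemma graph_disc_pair (s : R) (a1 : C) : 0 < s -> eps * s ^+ 2 <= 1 ->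
  rnorm a1 = a ->
  holo_disc D (fun x => graph_disc (0 + a1 * x)
    ((1 - eps * s ^+ 2)%:C + (eps * a * s)%:C * x)).
Proof.
move=> s0 es na; apply: graph_disc_holo => x x1.
have x0 := rnorm_ge0 x; rewrite add0r rnormM na; split.
  have : a * rnorm x <= a by rewrite ler_piMr// ltW.
  by move: ar0 a_gt0; lra.
apply: le_lt_trans (rnormD _ _) _; rewrite rnormM !rnormc.
rewrite ger0_norm ?subr_ge0// gtr0_norm ?mulr_gt0//.
have : 0 < eps * (s ^+ 2 - s * (a * rnorm x) + (a * rnorm x) ^+ 2).
  rewrite mulr_gt0//; move: (a * rnorm x) s0 => y s0.
  have := sqr_ge0 (s - 2 * y); have : 0 < s ^+ 2 by rewrite exprn_gt0.
  rewrite !expr2; nra.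
by move: (rnorm x) => y; lra.
Qed.

Let start s : V := z0 + d0%:C *: Y - (eps * d0 * s ^+ 2)%:C *: Y.

Let startE (s : R) : graph_disc 0 (1 - eps * s ^+ 2)%:C = start s.
Proof.
rewrite graph_disc0 /start -addrA -scalerBl -rmorphM -rmorphB.
by congr (_ + _%:C *: _); ring.
Qed.

(** The two discs of [graph_disc_pair] with [a1 = a] and [a1 = - a] start at the
    same point with velocities of Kobayashi length at most one, whose sum is
    [2 * eps * a * s * d0] times [Y]. *)
Lemma kobayashi_fast_discs : kobayashi_quasi_triangle D ->
  fast_normal_discs D (z0 + d0%:C *: Y) Y (eps * d0).
Proof.
case=> k k0 tri.
have k1 : 0 < 2 * k + 1 by move: k0; lra.
exists (2 * (eps * a * d0) / (2 * k + 1)), 0, (Num.min 1 (eps + 1)^-1).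
have e1 : 0 < eps + 1 by rewrite addr_gt0.
split=> //; first by rewrite divr_gt0// !mulr_gt0.
  by rewrite lt_min ltr01 invr_gt0.
move=> s; rewrite lt_min => /and3P[sp s1 se].
have es : eps * s ^+ 2 <= 1.
  have h1 : s * (eps + 1) < 1 by rewrite -ltr_pdivlMr// mul1r.
  have h2 : eps * s ^+ 2 <= eps * s.
    by rewrite ler_pM2l// expr2 ler_piMr// ltW.
  by move: h1 h2 sp; lra.
pose b : C := (eps * a * s)%:C; pose b0 : C := (1 - eps * s ^+ 2)%:C.
have bp : 0 < eps * a * s by rewrite !mulr_gt0.
have [g hg] := graph_disc_velocity b0.
have na : rnorm (a%:C : C) = a by rewrite rnormc gtr0_norm.
have nNa : rnorm (- a%:C : C) = a by rewrite rnormN.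
have Dstart : D (start s).
  have := holo_disc_in (graph_disc_pair sp es na) (z := 0).
  by rewrite rnorm0 !mulr0 !addr0 startE; apply.
have kle (a1 : C) : rnorm a1 = a ->
    (kobayashi D (start s) (a1 *: X + (b * d0%:C + a1 * g) *: Y) <= 1%:E)%E.
  move=> h; apply: ereal_inf_lbound; exists 1; last by rewrite normr1.
  exists (fun x => graph_disc (0 + a1 * x) (b0 + b * x)); split.
  - exact: graph_disc_pair.
  - by rewrite !mulr0 !addr0 startE.
  - by rewrite scale1r; have [] := (cdiff_derivable _ _ _).1 (hg a1 b).
have := tri _ (a%:C *: X + (b * d0%:C + a%:C * g) *: Y)
  (- a%:C *: X + (b * d0%:C + - a%:C * g) *: Y) Dstart.
have -> : a%:C *: X + (b * d0%:C + a%:C * g) *: Y +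
    (- a%:C *: X + (b * d0%:C + - a%:C * g) *: Y) = (2 * (eps * a * s * d0))%:C *: Y.
  rewrite addrACA -scalerDl subrr scale0r add0r -scalerDl; congr (_ *: _).
  by rewrite !rmorphM /= /b !rmorphM rmorph_nat; ring.
move=> H.
have {H} : (kobayashi D (start s) ((2 * (eps * a * s * d0))%:C *: Y) <
    (2 * k + 1)%:E)%E.
  apply: le_lt_trans H _.
  apply: (@le_lt_trans _ _ (k%:E * (1%:E + 1%:E))%E).
    by apply: lee_wpmul2l; [rewrite lee_fin ltW|apply: leeD; exact: kle].
  by rewrite -EFinD -EFinM lte_fin; move: k0; lra.
move=> /ereal_inf_lt[_ [al [phi [hphi phi0 E]] <-]].
rewrite lte_fin -/(rnorm al) => alk.
have w0 : 0 < 2 * (eps * a * s * d0) by rewrite !mulr_gt0.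
have al0 : al != 0.
  apply: contraTneq w0 => al0; rewrite al0 scale0r in E.
  have : rnorm ((2 * (eps * a * s * d0))%:C *: Y) = 0 by rewrite -E rnorm0.
  by rewrite rnormZ Y1 mulr1 rnormc => /normr0_eq0 ->; rewrite ltxx.
have alp : 0 < rnorm al by rewrite rnorm_gt0.
have [v hv] := holo_disc_cdiff hphi (z := 0) ltac:(by rewrite rnorm0).
have [_ vE] := (cdiff_derivable _ _ _).1 hv.
exists phi, v, (al^-1 * (2 * (eps * a * s * d0))%:C); split=> //.
  rewrite rnormM rnormV rnormc gtr0_norm// ler_pdivlMl//.
  rewrite [leLHS](_ : _ = rnorm al / (2 * k + 1) * (2 * (eps * a * s * d0))).
    by rewrite ler_piMl ?(ltW w0)// ler_pdivrMr// mul1r ltW.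
  by ring.
rewrite mul0r -scalerA -E -vE scalerA mulVf// scale1r subrr.
by rewrite rnorm0.
Qed.

(** The first disc of the pair is followed from [0] to [s ^+ 2], and then a
    translate of the second one back to [t = 0]; this moves by a multiple of [Y]
    of order [s ^+ 3]. A disc joining the end points does so with a parameter [al]
    of order [s ^+ 2], so by Taylor's formula its velocity is of order [s] in the
    direction [Y], up to [O (s ^+ 2)]. *)
Lemma lempert_fast_discs (M : R) : (forall w, D w -> rnorm w <= M) ->
  lempert_quasi_triangle D ->
  fast_normal_discs D (z0 + d0%:C *: Y) Y (eps * d0).
Proof.
move=> DM [k k1 tri]; have k0 : 0 < k := lt_le_trans ltr01 k1.
have M0 : 0 <= M.
  apply: le_trans (rnorm_ge0 _) (DM (graph_disc 0 0) _).
  by apply: graph_in; rewrite ?rnorm0// expr0n mulr0 addr0.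
exists (2 * (eps * a * d0) / (3 * k)), (48 * M * k),
  (Num.min 2^-1 (Num.min (eps + 1)^-1 (12 * k)^-1)).
have e1 : 0 < eps + 1 by rewrite addr_gt0.
split=> //.
- by rewrite divr_gt0 ?mulr_gt0.
- by rewrite !mulr_ge0// ltW.
- by rewrite !lt_min !invr_gt0 ltr0n e1 mulr_gt0.
move=> s; rewrite !lt_min => /and4P[sp s2 se sk].
have es : eps * s ^+ 2 <= 1.
  have h1 : s * (eps + 1) < 1 by rewrite -ltr_pdivlMr// mul1r.
  have h2 : eps * s ^+ 2 <= eps * s.
    by rewrite ler_pM2l// expr2 ler_piMr ?(ltW sp)//; move: s2; lra.
  by move: h1 h2 sp; lra.
have sk' : 12 * (k * s) < 1.
  by move: sk; rewrite -[X in _ < X]div1r ltr_pdivlMr ?mulr_gt0//; lra.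
have ss : 0 < s ^+ 2 by rewrite exprn_gt0.
have ss1 : s ^+ 2 <= s / 2 by rewrite expr2 ler_pM2l// ltW.
have ss4 : s ^+ 2 <= 4^-1 by move: ss1 s2; lra.
have ks : 3 * k * s ^+ 2 <= 4^-1.
  have := ler_wpM2l (ltW k0) ss1; move: sk' sp; lra.
pose b : C := (eps * a * s)%:C; pose b0 : C := (1 - eps * s ^+ 2)%:C.
pose S : C := (s ^+ 2)%:C.
have bp : 0 < eps * a * s by rewrite !mulr_gt0.
have na : rnorm (a%:C : C) = a by rewrite rnormc gtr0_norm.
have nS : rnorm S = s ^+ 2 by rewrite rnormc gtr0_norm.
have S1 : unit_disc S.
  rewrite /unit_disc /= rnormE -(rmorph1 (real_complex R)) ltcR nS.
  by move: ss4; lra.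
have disc1 := graph_disc_pair sp es na.
have disc2 : holo_disc D (fun x => graph_disc (a%:C * S + - a%:C * x)
    (b0 + b * S + b * x)).
  apply: graph_disc_holo => x x1.
  have -> : a%:C * S + - a%:C * x = a%:C * (S - x) by ring.
  rewrite rnormM na; have x0 := rnorm_ge0 (S - x).
  have x2 : rnorm (S - x) <= s ^+ 2 + rnorm x.
    by apply: le_trans (rnormB _ _) _; rewrite nS.
  split.
    have : a * rnorm (S - x) < a * 2.
      by rewrite ltr_pM2l//; move: x2 ss4 x1; lra.
    by move: ar0; lra.
  have x3 : rnorm x <= rnorm (S - x) + s ^+ 2.
    have := rnorm_sub_ge x S; rewrite rnorm_distC nS; lra.
  have -> : b0 + b * S + b * x = b0 + b * (S + x) by ring.
  apply: le_lt_trans (rnormD _ _) _; rewrite rnormM !rnormc.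
  rewrite ger0_norm ?subr_ge0// gtr0_norm//.
  have n1 : rnorm (S + x) <= rnorm (S - x) + 2 * s ^+ 2.
    apply: le_trans (rnormD _ _) _; rewrite nS; move: x3; lra.
  have := ler_wpM2l (ltW bp) n1.
  have h1 : 2 * a * (s * s ^+ 2) <= s ^+ 2 / 4.
    have : s * s ^+ 2 <= 2^-1 * s ^+ 2 by rewrite ler_wpM2r// ltW.
    move=> h2; have := ler_pM (ltW a_gt0) (mulr_ge0 (ltW sp) (ltW ss)) a4 h2.
    by lra.
  have : 0 < eps * (s ^+ 2 - s * (a * rnorm (S - x)) -
      2 * a * (s * s ^+ 2) + (a * rnorm (S - x)) ^+ 2).
    rewrite mulr_gt0//; move: (a * rnorm (S - x)) h1 ss => y h1 ss.
    by have := sqr_ge0 (s - 2 * y); rewrite !expr2 in h1 ss *; nra.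
  by move: (rnorm (S - x)) (rnorm (S + x)) => y y' h2 h3; lra.
pose x1 := start s; pose x2 := graph_disc (a%:C * S) (b0 + b * S).
pose x3 := graph_disc 0 (b0 + b * S + b * S).
have D1 : D x1.
  have := holo_disc_in disc1 (z := 0).
  by rewrite rnorm0 !mulr0 !addr0 startE; apply.
have S1' : rnorm S < 1 by rewrite nS; move: ss4; lra.
have D2 : D x2 by have := holo_disc_in disc1 S1'; rewrite add0r.
have D3 : D x3 by have := holo_disc_in disc2 S1'; rewrite mulNr subrr.
have l1 : (lempert D x1 x2 <= (s ^+ 2)%:E)%E.
  apply: ereal_inf_lbound; exists S; last by rewrite -/(rnorm S) nS.
  split=> //; exists (fun x => graph_disc (0 + a%:C * x) (b0 + b * x)); split=> //.
    by rewrite !mulr0 !addr0 startE.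
  by rewrite add0r.
have l2 : (lempert D x2 x3 <= (s ^+ 2)%:E)%E.
  apply: ereal_inf_lbound; exists S; last by rewrite -/(rnorm S) nS.
  split=> //; exists (fun x => graph_disc (a%:C * S + - a%:C * x)
    (b0 + b * S + b * x)); split=> //.
    by rewrite !mulr0 !addr0.
  by rewrite mulNr subrr.
have : (lempert D x1 x3 < (3 * k * s ^+ 2)%:E)%E.
  apply: le_lt_trans (tri _ _ _ D1 D2 D3) _.
  apply: (@le_lt_trans _ _ (k%:E * ((s ^+ 2)%:E + (s ^+ 2)%:E))%E).
    by apply: lee_wpmul2l; [rewrite lee_fin ltW|apply: leeD].
  rewrite -EFinD -EFinM lte_fin; have := mulr_gt0 k0 ss; lra.
move=> /ereal_inf_lt[_ [al [al1 [phi [hphi phi0 phial]]] <-]].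
rewrite lte_fin -/(rnorm al) => alk.
pose w := 2 * (eps * a * s * s ^+ 2 * d0).
have w0 : 0 < w by rewrite !mulr_gt0.
have x31 : x3 - x1 = w%:C *: Y.
  rewrite /x3 /x1 -startE !graph_disc0 opprD addrACA subrr add0r -scalerBl.
  congr (_ *: _); rewrite /b0 /b /S /w -!rmorphM -!rmorphD -!rmorphM -rmorphB.
  by congr (_%:C); ring.
have al0 : al != 0.
  apply: contraTneq w0 => al0; move: x31; rewrite -phial al0 phi0 subrr => E.
  have : rnorm (w%:C *: Y) = 0 by rewrite -E rnorm0.
  by rewrite rnormZ Y1 mulr1 rnormc => /normr0_eq0 ->; rewrite ltxx.
have alp : 0 < rnorm al by rewrite rnorm_gt0.
have [v hv] := holo_disc_cdiff hphi (z := 0) ltac:(by rewrite rnorm0).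
have al4 : rnorm al <= 4^-1 by move: alk ks; lra.
have tay := holo_disc_taylor DM hphi hv al4.
exists phi, v, (al^-1 * w%:C); split=> //.
  rewrite rnormM rnormV rnormc gtr0_norm// ler_pdivlMl//.
  rewrite [leLHS](_ : _ = rnorm al / (3 * k * s ^+ 2) * w).
    by rewrite ler_piMl ?(ltW w0)// ler_pdivrMr ?mulr_gt0// mul1r ltW.
  by rewrite /w; field; rewrite !gt_eqF.
have -> : v - (al^-1 * w%:C) *: Y = - (al^-1 *: (phi al - phi 0 - al *: v)).
  rewrite phial phi0 x31 scalerBr !scalerA mulVf// scale1r opprB.
  by [].
rewrite rnormN rnormZ rnormV ler_pdivrMl//; apply: le_trans tay _.
rewrite expr2 mulrCA ler_pM2l//.
have := ler_wpM2l M0 (ltW alk); lra.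
Qed.

End PseudoconcaveDiscs.

(** * The exhaustion by the inverse distance *)

Section Assembly.
Context {R : realType} {n : nat}.
Local Notation C := R[i].
Local Notation V := 'rV[R[i]]_n.
Implicit Types (D : set V).

Lemma bounded_rnorm D : bounded_set D -> exists M : R, forall z, D z -> rnorm z <= M.
Proof.
move=> [m [mr hm]]; exists (complex.Re m + 1) => z Dz.
rewrite -lecR -rnormE; apply: hm => //.
by rewrite -(RRe_real mr) ltcR ltrDl.
Qed.

(** The point [z0 + d0 Y] is a boundary point through which the domain contains a
    family of discs as in [fast_normal_discs], and this is what smoothness of the
    boundary excludes. *)
Lemma quasi_triangle_not_pseudoconcave D (z0 X Y : V) (F : C -> C)
    (d0 eps r0 : R) :
  open D -> bounded_set D -> C1_boundary D ->
  lempert_quasi_triangle D \/ kobayashi_quasi_triangle D ->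
  0 < d0 -> rnorm Y = 1 -> 0 < eps -> 0 < r0 -> entire F -> F 0 = (d0^-1)%:C ->
  (forall t, rnorm t < r0 -> F t != 0) ->
  (forall t w, rnorm t < r0 -> rnorm w < 1 + eps * rnorm t ^+ 2 ->
    D (graph_disc z0 X Y F t w)) ->
  (forall w, rnorm (w - z0) < d0 -> D w) ->
  ~ D (z0 + d0%:C *: Y) -> False.
Proof.
move=> oD /bounded_rnorm[M DM] bD quasi d00 Y1 eps0 r00 eF F0 Fn gin ball Dp.
have Y1' : rnorm Y <= 1 by rewrite Y1.
have cp : closure D (z0 + d0%:C *: Y).
  move=> B /nbhs_rnormP[e e0 hB]; pose t := Num.min (d0 / 2) (e / 2).
  have t0 : 0 < t by rewrite lt_min !divr_gt0.
  have te : t < e.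
    have : t <= e / 2 by rewrite ge_min lexx orbT.
    by move: e0; clear; lra.
  have td : t < d0.
    have : t <= d0 / 2 by rewrite ge_min lexx.
    by move: d00; clear; lra.
  exists (z0 + (d0 - t)%:C *: Y); split.
    apply: ball; rewrite (addrC z0) addrK rnormZ Y1 mulr1 rnormc ger0_norm.
      by move: t0; clear; lra.
    by move: td; clear; lra.
  apply: hB; rewrite opprD addrACA subrr add0r -scalerBl -rmorphB addrAC subrr add0r.
  by rewrite rnormZ Y1 mulr1 rnormc normrN gtr0_norm.
have [l [sup lv]] := C1_supporting oD bD cp Dp.
have k0 := supporting_ball_gt0 d00 Y1' ball sup lv.
have M0 : 0 <= M.
  by apply: le_trans (rnorm_ge0 z0) (DM _ (ball _ _)); rewrite subrr rnorm0.
have e0 : 0 < eps * d0 by rewrite mulr_gt0.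
apply: (no_fast_normal_discs DM sup Y1' k0 e0 M0).
case: quasi => [lq|kq].
  exact: (lempert_fast_discs d00 Y1 eps0 r00 eF F0 Fn gin DM lq).
exact: (kobayashi_fast_discs d00 Y1 eps0 r00 eF F0 Fn gin kq).
Qed.

Lemma usc_on_continuous (W : normedModType C) (U : set W) (u : W -> R) :
  (forall z, U z -> {for z, continuous u}) -> usc_on U (EFin \o u).
Proof.
move=> cu z Uz [r| |] //= h; last by apply: nearW => w; rewrite ltry.
rewrite lte_fin in h.
have /continuous_RP/(_ (r - u z)) := cu z Uz; rewrite subr_gt0 => /(_ h)[d d0 hd].
apply/nbhs_rnormP; exists d => // w /hd /ltr_normlP[_].
by rewrite lte_fin ltrD2r.
Qed.

Lemma continuous_inv (W : normedModType C) (f : W -> R) x :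
  0 < f x -> {for x, continuous f} -> {for x, continuous (fun y => (f y)^-1)}.
Proof.
move=> fx cf; apply: (@continuous_comp _ _ _ f (@GRing.inv R)) => //.
by apply: inv_continuous; rewrite gt_eqF.
Qed.

Lemma continuous_line (f : V -> R) z X (t : C) :
  {for z + t *: X, continuous f} -> {for t, continuous (fun s : C => f (z + s *: X))}.
Proof.
move=> cf; apply/continuous_RP => e e0.
have /continuous_RP/(_ e e0)[d d0 hd] := cf.
have X1 : 0 < rnorm X + 1 by rewrite ltr_wpDl// rnorm_ge0.
exists (d / (rnorm X + 1)); first by rewrite divr_gt0.
move=> y; rewrite ltr_pdivlMr// => h; apply: hd.
rewrite opprD addrACA subrr add0r -scalerBl rnormZ.
apply: le_lt_trans h; rewrite ler_wpM2l ?rnorm_ge0// lerDl.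
exact: ler01.
Qed.

Lemma submean_cmean (f : C -> R) (a : C) (r : R) :
  circle_cont 1 (fun z => f (a + r%:C * z)) ->
  f a <= cmean 1 (fun z => f (a + r%:C * z)) ->
  ((f a)%:E <= ((2 * pi)^-1)%:E *
    \int[lebesgue_measure]_(t in `[0%R, (2 * pi)%R]) (f (circle_point a r t))%:E)%E.
Proof.
move=> cf fa.
have E t : f (circle_point a r t) = f (a + r%:C * circle_point 0 1 t).
  by rewrite /circle_point add0r mul1r.
have ci := cont_on_integrable (@circle_cont_on _ 0 (2 * pi) _ _ ler01 cf).
under eq_integral do rewrite E.
rewrite -[X in (_ * X)%E]fineK; last exact: integrable_fin_num ci.
by rewrite -EFinM lee_fin.
Qed.

Lemma inv_sub_le (m a b : R) : 0 < m -> m <= a -> m <= b ->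
  `|a^-1 - b^-1| <= `|b - a| / m ^+ 2.
Proof.
move=> m0 ma mb; have a0 := lt_le_trans m0 ma; have b0 := lt_le_trans m0 mb.
have -> : a^-1 - b^-1 = (b - a) / (a * b).
  by field; rewrite (gt_eqF a0) (gt_eqF b0).
rewrite normrM normfV (gtr0_norm (mulr_gt0 a0 b0)) ler_wpM2l//.
by rewrite lef_pV2 ?posrE ?mulr_gt0 ?exprn_gt0// expr2 ler_pM// ltW.
Qed.

(** If [d] is the distance at [z0 + t X], [f = rnorm (F t)] and
    [tau = rnorm t ^+ 2], this turns the touching inequality for [d^-1] into the
    inclusion of a disc of relative radius larger than one. *)
Lemma slack_product (d0 d f e tau : R) : 0 < d0 -> 0 < d -> 0 <= e -> 0 <= tau ->
  f < 2 * d0^-1 -> d^-1 <= f - e * tau -> 1 + e * d0 / 2 * tau <= d * f.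
Proof.
move=> d00 dp e0 t0 fu h.
have et : 0 <= e * tau by rewrite mulr_ge0.
have dd : d0 / 2 <= d.
  rewrite -lef_pV2 ?posrE ?divr_gt0// invfM invrK mulrC.
  by move: h fu et; clear; lra.
have h1 : 1 <= d * (f - e * tau) by rewrite -(mulfV (lt0r_neq0 dp)) ler_pM2l.
have h2 : e * tau * (d0 / 2) <= e * tau * d by rewrite ler_wpM2l.
by move: h1 h2; clear; lra.
Qed.

Context (D : set V).

(** If the inequality fails, [touching_point] gives [F], and the ball of radius
    [cdist D (P t)] about each [P t] contains the figure required by
    [quasi_triangle_not_pseudoconcave], with [Y] pointing from [P t0] to a nearest
    point of the complement. *)
Lemma inv_cdist_submean z X a (r : R) : open D -> bounded_set D ->
  C1_boundary D ->
  lempert_quasi_triangle D \/ kobayashi_quasi_triangle D ->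
  ~` D !=set0 -> 0 < r ->
  (forall x : C, rnorm (x - a) <= r -> D (z + x *: X)) ->
  let W x := (cdist D (z + (a + r%:C * x) *: X))^-1 in
  (forall x, rnorm x <= 1 -> {for x, continuous W}) /\ W 0 <= cmean 1 W.
Proof.
move=> oD bD cD quasi nD r0 disc W.
pose P x := z + (a + r%:C * x) *: X.
have inD x : rnorm x <= 1 -> D (P x).
  move=> x1; apply: disc; rewrite addrAC subrr add0r rnormM rnormc gtr0_norm//.
  by rewrite ler_piMr// ltW.
have PB x y : P x - P y = (r%:C * (x - y)) *: X.
  by rewrite /P opprD addrACA subrr add0r -scalerBl opprD addrACA subrr add0r mulrBr.
pose L := r * rnorm X; have L0 : 0 <= L by rewrite mulr_ge0 ?rnorm_ge0// ltW.
have lipP x y : `|cdist D (P x) - cdist D (P y)| <= L * rnorm (x - y).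
  apply: le_trans (cdist_lip nD _ _) _; rewrite PB rnormZ rnormM rnormc.
  by rewrite gtr0_norm// /L mulrAC.
have cP : continuous (fun x => cdist D (P x)).
  move=> x; apply/continuous_RP => e e0; have L1 : 0 < L + 1 by rewrite ltr_wpDl.
  exists (e / (L + 1)); first by rewrite divr_gt0.
  move=> y; rewrite ltr_pdivlMr// => h; apply: le_lt_trans (lipP y x) _.
  apply: le_lt_trans h; rewrite mulrC ler_wpM2l ?rnorm_ge0// lerDl.
  exact: ler01.
have pos x : rnorm x <= 1 -> 0 < cdist D (P x).
  by move=> /inD; exact: cdist_gt0.
have cW x : rnorm x <= 1 -> {for x, continuous W}.
  move=> /pos p; have := @continuous_inv C (fun x => cdist D (P x)) x p (cP x); exact.
split=> //.
pose B := [set x : C | rnorm (x - 0) <= 1].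
have [|x1 x1B x1min] := @compact_EVT_min C R (fun x => cdist D (P x)) B _
    (@compact_disc R 0 1) (continuous_subspaceT cP).
  by exists 0; rewrite /B /= subrr rnorm0.
set m := cdist D (P x1) in x1min.
have m0 : 0 < m by apply: pos; move: x1B; rewrite inE /B /= subr0.
have mle x : rnorm x <= 1 -> m <= cdist D (P x).
  by move=> h; apply: x1min; rewrite inE /B /= subr0.
have lW x y : rnorm x = 1 -> rnorm y = 1 -> `|W y - W x| <= L / m ^+ 2 * rnorm (y - x).
  move=> hx hy.
  have mx : m <= cdist D (P x) by apply: mle; rewrite hx.
  have my : m <= cdist D (P y) by apply: mle; rewrite hy.
  rewrite mulrAC; apply: le_trans (inv_sub_le m0 my mx) _.
  rewrite ler_wpM2r// ?invr_ge0 ?sqr_ge0// rnorm_distC; exact: lipP.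
rewrite leNgt; apply/negP => gap.
have Lm : 0 <= L / m ^+ 2 by rewrite divr_ge0// sqr_ge0.
have [t0 [F [e [t01 eF e0 F0 touch]]]] := touching_point Lm cW lW gap.
pose d0 := cdist D (P t0).
have d00 : 0 < d0 by apply: pos; exact: ltW.
have F0' : F 0 = (d0^-1)%:C by rewrite F0.
have [p [Dp pd]] := cdist_attained nD (P t0) oD.
have i0 : 0 < d0^-1 by rewrite invr_gt0.
have cF : {for 0, continuous F} by exact: entire_continuous eF.
(* Near [0] the values of [F] are within a factor two of [d0^-1]. *)
have h2 : 0 < d0^-1 / 2 by rewrite divr_gt0.
have /continuous_rnormP/(_ _ h2)[d1 d10 hF] := cF.
pose r1 := Num.min d1 (1 - rnorm t0).
have r10 : 0 < r1 by rewrite lt_min d10 subr_gt0.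
have Fle t : rnorm t < r1 -> d0^-1 / 2 < rnorm (F t) /\ rnorm (F t) < 2 * d0^-1.
  rewrite lt_min => /andP[td _]; have := hF t; rewrite subr0 => /(_ td).
  rewrite F0' => h.
  have n0 : rnorm ((d0^-1)%:C : C) = d0^-1 by rewrite rnormc gtr0_norm.
  have := rnorm_sub_ge (F t) (d0^-1)%:C.
  have := rnorm_sub_ge (d0^-1)%:C (F t); rewrite (rnorm_distC _ (F t)) n0.
  by move: h i0; clear; lra.
have Y1 : rnorm ((d0^-1)%:C *: (p - P t0)) = 1.
  by rewrite rnormZ pd rnormc (gtr0_norm i0) (mulVf (lt0r_neq0 d00)).
apply: (@quasi_triangle_not_pseudoconcave D (P t0) (r%:C *: X)
  ((d0^-1)%:C *: (p - P t0)) F d0 (e * d0 / 2) r1) => //.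
- by rewrite !mulr_gt0.
- by move=> t /Fle[h _]; rewrite -rnorm_gt0 (lt_trans h2).
- move=> t w tr wt; have [Fl Fu] := Fle t tr.
  have Fp : 0 < rnorm (F t) := lt_trans h2 Fl.
  have tt0 : rnorm (t0 + t) <= 1.
    apply: le_trans (rnormD _ _) _; move: tr; rewrite lt_min => /andP[_].
    by clear; lra.
  have PE : P t0 + t *: (r%:C *: X) = P (t0 + t).
    by rewrite /P -addrA scalerA -scalerDl mulrDr addrA (mulrC t).
  have dp := pos _ tt0.
  apply: (cdist_in nD (z := P (t0 + t))).
  rewrite /graph_disc PE addrAC subrr add0r rnormZ.
  rewrite Y1 mulr1 rnormM rnormV (ltr_pdivrMr _ _ Fp).
  have := touch t tt0; rewrite /W -/(P (t0 + t)) => h.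
  have {}h : (cdist D (P (t0 + t)))^-1 <= rnorm (F t) - e * rnorm t ^+ 2.
    by have := le_trans (ler_norm _) (Re_le_rnorm (F t)); move: h; clear; lra.
  apply: lt_le_trans wt _; apply: (slack_product d00 dp (ltW e0) (sqr_ge0 _) Fu h).
- move=> w; exact: (cdist_in nD).
- rewrite scalerA -rmorphM divff ?gt_eqF// scale1r addrC subrK.
  exact: Dp.
Qed.

End Assembly.

Theorem theorem2 (R : realType) (n : nat) (D : set 'rV[R[i]]_n)
    (D_domain : domain D) (D_bounded : bounded_set D)
    (D_C1 : C1_boundary D)
    (D_quasi : lempert_quasi_triangle D \/ kobayashi_quasi_triangle D) :
  pseudoconvex D.
Proof.
have [oD _ [x0 Dx0]] := D_domain.
have [M DM] := bounded_rnorm D_bounded.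
have closure_compact (S : set 'rV[R[i]]_n) (T : set 'rV[R[i]]_n) :
    closed T -> S `<=` T -> T `<=` D -> compact (closure S) /\ closure S `<=` D.
  move=> cT ST TD; have cS : closure S `<=` T.
    by rewrite ((closure_id T).1 cT); exact: closure_subset.
  split; last exact: subset_trans TD.
  apply: (@compact_rV R n _ M); first exact: closed_closure.
  by move=> v /cS/TD/DM.
have [DT|nD] : D = setT \/ ~` D !=set0.
  have [/eqP|] := eqVneq (~` D) set0; last by move=> /set0P; right.
  by move=> /eqP h; left; rewrite -(setCK D) h setC0.
- (* Without complement there is no distance, but the sublevel sets of any function
     are relatively compact in the bounded space. *)
  exists (fun=> 0); split=> [z _||c K].
  + exact: (@cst_continuous _ _ (0 : R) z).
  + split; first by apply: usc_on_continuous => z _; exact: (@cst_continuous _ _ (0 : R) z).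
    move=> z X; split=> [t _|| a r r0 _]; first exact: ltry.
      apply: (@usc_on_continuous _ _ _ (fun=> 0)) => t _.
      exact: (@cst_continuous _ _ (0 : R) t).
    apply: (@submean_cmean R (fun=> 0) a r); last by rewrite cmean_cst.
    exact: (@circle_cont_cst R 1 0).
  + by apply: (closure_compact _ setT); [exact: closedT|exact: subsetT|rewrite DT].
have cu z : D z -> {for z, continuous (fun w => (cdist D w)^-1)}.
  by move=> /(cdist_gt0 nD oD) p; exact: (continuous_inv p (@cdist_continuous _ _ _ nD z)).
exists (fun z => (cdist D z)^-1); split=> // [|c K].
  split; first exact: usc_on_continuous.
  move=> z X; split=> [t _|| a r r0 disc]; first exact: ltry.
    have cl t : D (z + t *: X) ->
        {for t, continuous (fun s : R[i] => (cdist D (z + s *: X))^-1)}.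
      by move=> /cu; exact: continuous_line.
    exact: (@usc_on_continuous R R[i] _ _ cl).
  have disc' x : rnorm (x - a) <= r -> D (z + x *: X).
    by move=> h; apply: (disc x); rewrite /= rnormE lecR.
  have [cW mW] := inv_cdist_submean oD D_bounded D_C1 D_quasi nD r0 disc'.
  apply: (@submean_cmean R (fun x => (cdist D (z + x *: X))^-1) a r).
    by move=> x x1; apply: cW; rewrite x1.
  by move: mW; rewrite mulr0 addr0.
apply: (closure_compact _ [set z | 1 <= c * cdist D z]).
- apply: (@preimage_closed _ _ (fun z => c * cdist D z) [set x : R | 1 <= x]).
    move=> z _; exact: (continuousM (@cst_continuous _ _ c z) (@cdist_continuous _ _ _ nD z)).
  exact: closed_ge.
- move=> z [Dz /=]; have p := cdist_gt0 nD oD Dz.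
  by rewrite -[(cdist D z)^-1]mul1r ltr_pdivrMr// => /ltW.
- move=> z /= h; apply: contrapT => Dz.
  by move: h; rewrite (cdist_out nD Dz) mulr0 ler10.
Qed.
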